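(* There exist a Riemannian metric $g$ on $S^2$ and an exact $2$-form $\sigma$ on $S^2$ such that, for the Hamiltonian $H:T^*S^2\to\mathbb{R}$, $H(q,p)=\frac12|p|_g^2$, and the twisted symplectic form $\omega=dp\wedge dq+\pi^*\sigma$ on $T^*S^2$, there are a value $k>c$, where $c$ is the Ma\~n\'e critical value, and a strongly non-degenerate closed orbit $y$ of $X_H$ with energy $k$ whose correction term is $\chi(y)=-1$. In particular, for the corresponding critical point $(q,T)$ of the free time action functional $\mathcal{S}_k$ one has $i(q,T)=i_T(q)+1$.
   Context: $\pi:T^*S^2\to S^2$ is the projection; $X_H$ is defined by $\omega(\cdot,X_H)=dH$ and $\phi_t$ is its flow. The Ma\~n\'e critical value is $c=\inf_\theta\sup_{q\in S^2}H(q,\theta_q)$, the infimum over all $1$-forms $\theta$ on $S^2$ with $d\theta=\sigma$ ($S^2$ is its own universal cover, so here $c=c_0$). A closed orbit $y:\mathbb{R}/T\mathbb{Z}\to H^{-1}(k)$ of $X_H$ is strongly non-degenerate if $\dim\ker(d_{y(0)}\phi_T-\mathrm{Id})=1$. Such an orbit admits a unique orbit cylinder, i.e. a family $(y_{k+s})_{s\in(-\varepsilon,\varepsilon)}$, smooth in $s$, of closed orbits $y_{k+s}:\mathbb{R}/T(k+s)\mathbb{Z}\to T^*S^2$ of $X_H$ with $H(y_{k+s})\equiv k+s$, $y_k=y$, and it satisfies $T'(k)\neq0$. The correction term is $\chi(y)=\mathrm{sign}(-T'(k))$. Let $L(q,v)=\frac12|v|_g^2$ be the Fenchel dual Lagrangian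 of $H$ and $\Lambda S^2$ the Hilbert manifold of $W^{1,2}$ loops $q:S^1=\mathbb{R}/\mathbb{Z}\to S^2$. The free time action functional is $\mathcal{S}_k(q,T)=T\int_{S^1}(L(q,\dot q/T)+k)dt+\int_{S^1\times[0,1]}\bar q^*\sigma$ on $\Lambda S^2\times\mathbb{R}^+$, where $\bar q$ is any homotopy from $q$ (at $0$) to a fixed reference loop (at $1$), and $\mathcal{S}_k^T(q)=\mathcal{S}_k(q,T)$. The critical point corresponding to $y$ is $(q,T)$ with $q(t)=\pi(y(Tt))$. $i(q,T)$ is the maximal dimension of a subspace of $W^{1,2}(S^1,q^*TS^2)\times\mathbb{R}$ on which $d^2_{(q,T)}\mathcal{S}_k$ is negative definite, and $i_T(q)$ is the maximal dimension of a subspace of $W^{1,2}(S^1,q^*TS^2)$ on which $d^2_q\mathcal{S}^T_k$ is negative definite. *)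

(* Defs.v *)
(* S^2 is the unit sphere of R^3 = 'rV[R]_3 and tensors on
   S^2 are restrictions of smooth tensor fields on R^3 (every smooth tensor on
   S^2 arises in this way). *)
From HB Require Import structures.
From mathcomp Require Import all_boot all_order all_algebra.
From mathcomp Require Import all_classical all_reals all_analysis.

Set Implicit Arguments.
Unset Strict Implicit.
Unset Printing Implicit Defensive.

Import Order.TTheory GRing.Theory Num.Theory.
Import numFieldNormedType.Exports.

Local Open Scope classical_set_scope.
Local Open Scope ring_scope.

Section Smooth.
Context {R : realType} {V W : normedModType R}.

(* C^n on an open set U: for n > 0, f is differentiable on U and all its
   directional derivatives are C^(n-1) on U. *)
Fixpoint Ck_on (U : set V) (n : nat) (f : V -> W) : Prop :=
  match n with
  | 0%N => forall x, U x -> {for x, continuous f}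
  | m.+1 => (forall x, U x -> differentiable f x) /\
            (forall v : V, Ck_on U m (fun x => 'D_v f x))
  end.

Definition smooth_on (U : set V) (f : V -> W) : Prop := forall n, Ck_on U n f.

(* L is the differential at x of the restriction of f to a submanifold M,
   tested on the curves contained in M and differentiable at 0. *)
Definition is_diff_along (M : set V) (f : V -> W) (x : V) (L : V -> W) : Prop :=
  forall (c : R -> V) (v : V), (forall s, M (c s)) -> c 0 = x ->
    is_derive (0 : R) 1 c v -> is_derive (0 : R) 1 (f \o c) (L v).

End Smooth.

Section Dimension.
Context {R : realType} {V : lmodType R}.

Definition has_dim (A : set V) (n : nat) : Prop :=
  exists e : 'I_n -> V,
    (forall a : 'I_n -> R, \sum_i a i *: e i = 0 -> forall i, a i = 0) /\
    A = [set v | exists a : 'I_n -> R, v = \sum_i a i *: e i].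

Definition neg_subspace (D : set V) (Q : V -> R) (n : nat) : Prop :=
  exists A : set V, [/\ A `<=` D, has_dim A n &
    forall v, A v -> v != 0 -> Q v < 0].

(* n is the maximal dimension of a subspace of D on which Q is negative
   definite; in particular the index is finite. *)
Definition morse_index (D : set V) (Q : V -> R) (n : nat) : Prop :=
  neg_subspace D Q n /\ forall m, neg_subspace D Q m -> (m <= n)%N.

End Dimension.

Section MagneticSphere.
Context {R : realType}.

Local Notation E := 'rV[R]_3.
Local Notation leb := (@lebesgue_measure R).
Local Notation I01 := (`[0%R, 1%R]%classic : set R).

Definition dot (u v : E) : R := \sum_(i < 3) u 0 i * v 0 i.

Definition sphere : set E := [set q | dot q q = 1].
Definition tangent (q : E) : set E := [set v | dot q v = 0].

(* A covector at q is represented by the unique p with dot q p = 0 such that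
   it maps v to dot p v. *)
Definition cotangent_bundle : set (E * E) :=
  [set x | sphere x.1 /\ tangent x.1 x.2].

(* The kernel of the differential at (q, p) of the two defining equations
   dot q q = 1 and dot q p = 0. *)
Definition tangent_cotangent (x : E * E) : set (E * E) :=
  [set z | dot x.1 z.1 = 0 /\ dot x.1 z.2 + dot x.2 z.1 = 0].

Definition bil (B : E -> 'M[R]_3) (q u v : E) : R :=
  (u *m B q *m v^T) 0 0.

Definition riemannian_metric (g : E -> 'M[R]_3) : Prop :=
  smooth_on setT g /\
  forall q, sphere q ->
    (forall u v, tangent q u -> tangent q v -> bil g q u v = bil g q v u) /\
    (forall u, tangent q u -> u != 0 -> 0 < bil g q u u).

Definition two_form (sigma : E -> 'M[R]_3) : Prop :=
  smooth_on setT sigma /\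
  forall q, sphere q -> forall u v, tangent q u -> tangent q v ->
    bil sigma q u v = - bil sigma q v u.

Definition one_form (theta : E -> E) : Prop :=
  smooth_on setT theta /\
  forall q, sphere q -> cotangent_bundle (q, theta q).

(* d theta = sigma on S^2 *)
Definition primitive (theta : E -> E) (sigma : E -> 'M[R]_3) : Prop :=
  forall q, sphere q -> forall u v, tangent q u -> tangent q v ->
    dot ('D_u theta q) v - dot ('D_v theta q) u = bil sigma q u v.

Definition exact_two_form (sigma : E -> 'M[R]_3) : Prop :=
  two_form sigma /\ exists theta, one_form theta /\ primitive theta sigma.

Section Dynamics.
Variables g sigma : E -> 'M[R]_3.

(* dual norm |p|_g on T_q^*S^2 *)
Definition conorm (q p : E) : R :=
  sup [set dot p v | v in [set v | tangent q v /\ bil g q v v <= 1]].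

Definition hamiltonian (x : E * E) : R := 2^-1 * conorm x.1 x.2 ^+ 2.

(* dp /\ dq is the exterior derivative of the tautological one-form
   (q, p), (u, w) |-> dot p u. *)
Definition omega (x z z' : E * E) : R :=
  dot z.2 z'.1 - dot z'.2 z.1 + bil sigma x.1 z.1 z'.1.

(* X = X_H(x), i.e. omega(., X) = dH at x *)
Definition hamiltonian_vector (x X : E * E) : Prop :=
  tangent_cotangent x X /\
  is_diff_along cotangent_bundle hamiltonian x (fun z => omega x z X).

Definition integral_curve (y : R -> E * E) : Prop :=
  (forall t, cotangent_bundle (y t)) /\
  forall t, exists2 X, hamiltonian_vector (y t) X & is_derive t 1 y X.

(* By uniqueness of integral curves the choice is immaterial. *)
Definition flow (t : R) (x : E * E) : E * E :=
  xget (fun=> x) [set y | integral_curve y /\ y 0 = x] t.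

Definition mane_critical_value : R :=
  inf [set sup [set hamiltonian (q, theta q) | q in sphere] |
       theta in [set theta | one_form theta /\ primitive theta sigma]].

Definition closed_orbit (k : R) (y : R -> E * E) (T : R) : Prop :=
  [/\ 0 < T, integral_curve y, forall t, y (t + T) = y t &
      forall t, hamiltonian (y t) = k].

Definition strongly_nondegenerate (y : R -> E * E) (T : R) : Prop :=
  exists L : {linear (E * E)%type -> (E * E)%type},
    is_diff_along cotangent_bundle (flow T) (y 0) L /\
    has_dim [set z | tangent_cotangent (y 0) z /\ L z - z = 0] 1.

(* Y e is the orbit of energy e of the cylinder and P e its period. *)
Definition orbit_cylinder (k : R) (y : R -> E * E) (T eps : R)
    (Y : R -> R -> E * E) (P : R -> R) : Prop :=
  [/\ 0 < eps, Y k = y, P k = T,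
      forall e, `|e - k| < eps -> closed_orbit e (Y e) (P e) &
      smooth_on [set e : R | `|e - k| < eps] P /\
      smooth_on [set x : (R * R)%type | `|x.1 - k| < eps]
        (fun x => Y x.1 x.2)].

(* By uniqueness of the orbit cylinder of a strongly non-degenerate orbit,
   chi is determined by y. *)
Definition correction_term (k : R) (y : R -> E * E) (T chi : R) : Prop :=
  exists eps Y P, orbit_cylinder k y T eps Y P /\ Num.sg (- derive1 P k) = chi.

End Dynamics.

(* u in L^2 is a weak derivative of f on [0, 1]: f is the indefinite integral
   of u. *)
Definition weak_derivative (f u : R -> E) : Prop :=
  forall i : 'I_3,
    [/\ measurable_fun I01 (fun t => u t 0 i),
        leb.-integrable I01 (fun t => (u t 0 i ^+ 2)%:E) &
        forall t, I01 t ->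
          f t 0 i = f 0 0 i + Rintegral leb `[0, t] (fun s => u s 0 i)].

(* W^{1,2}(R/Z, R^3), through continuous representatives *)
Definition W12 (f : R -> E) : Prop :=
  (forall t, f (t + 1) = f t) /\ exists u, weak_derivative f u.

Definition wderiv (f : R -> E) : R -> E := xget 0 [set u | weak_derivative f u].

Definition W12norm (f : R -> E) : R :=
  Num.sqrt (Rintegral leb I01
    (fun t => dot (f t) (f t) + dot (wderiv f t) (wderiv f t))).

Definition loop_space (q : R -> E) : Prop := W12 q /\ forall t, sphere (q t).

(* W^{1,2}(S^1, q^* TS^2) *)
Definition vector_field_along (q xi : R -> E) : Prop :=
  W12 xi /\ forall t, tangent (q t) (xi t).

(* Homotopies of loops from q to q0, as C^1 paths s |-> h s in the Hilbert
   manifold of W^{1,2} loops with velocity h'; this regularity makes the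
   integral of the pulled back two-form meaningful.  A C^1 path defined on
   [0, 1] extends to the real line, so only the latter is considered. *)
Definition loop_homotopy (q q0 : R -> E) (h h' : R -> R -> E) : Prop :=
  [/\ h 0 = q, h 1 = q0, forall s, loop_space (h s) /\ W12 (h' s),
      forall s, (fun e : R => W12norm (e^-1 *: (h (s + e) - h s) - h' s))
                  @ 0^' --> 0 &
      forall s, (fun e : R => W12norm (h' (s + e) - h' s)) @ 0^' --> 0].

Section Action.
Variables g sigma : E -> 'M[R]_3.

Definition lagrangian (q v : E) : R := 2^-1 * bil g q v v.

(* The integral over S^1 x [0, 1] of the pull-back of sigma by the homotopy,
   for the orientation dt /\ ds, t in S^1 and s in [0, 1]. *)
Definition homotopy_flux (h h' : R -> R -> E) : R :=
  Rintegral leb I01 (fun s =>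
    Rintegral leb I01 (fun t => bil sigma (h s t) (wderiv (h s) t) (h' s t))).

(* By Stokes' theorem (sigma is exact) the choice of the homotopy is
   immaterial. *)
Definition magnetic_term (q0 q : R -> E) : R :=
  xget 0 [set a | exists h h', loop_homotopy q q0 h h' /\
                               a = homotopy_flux h h'].

(* the free time action functional S_k, with reference loop q0 *)
Definition free_time_action (q0 : R -> E) (k : R) (q : R -> E) (T : R) : R :=
  T * Rintegral leb I01 (fun t => lagrangian (q t) (T^-1 *: wderiv q t) + k)
  + magnetic_term q0 q.

(* xi |-> loop_chart q xi is a local parametrization at q of the manifold of
   loops, whose differential at 0 is the identity of W^{1,2}(S^1, q^* TS^2). *)
Definition loop_chart (q xi : R -> E) : R -> E :=
  fun t => (Num.sqrt (dot (q t + xi t) (q t + xi t)))^-1 *: (q t + xi t).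

(* Quadratic forms of the Hessians d^2 S_k and d^2 S_k^T.  At a critical point
   the second derivative does not depend on the chart. *)
Definition hessian_free_time (q0 : R -> E) (k : R) (q : R -> E) (T : R)
    (z : ((R -> E) * R)%type) : R :=
  derive1n 2
    (fun s : R => free_time_action q0 k (loop_chart q (s *: z.1)) (T + s * z.2))
    0.

Definition hessian_fixed_time (q0 : R -> E) (k : R) (q : R -> E) (T : R)
    (xi : R -> E) : R :=
  derive1n 2 (fun s : R => free_time_action q0 k (loop_chart q (s *: xi)) T) 0.

Definition free_time_index (q0 : R -> E) (k : R) (q : R -> E) (T : R)
    (n : nat) : Prop :=
  morse_index [set z : ((R -> E) * R)%type | vector_field_along q z.1]
    (hessian_free_time q0 k q T) n.

Definition fixed_time_index (q0 : R -> E) (k : R) (q : R -> E) (T : R)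
    (n : nat) : Prop :=
  morse_index (vector_field_along q) (hessian_fixed_time q0 k q T) n.

End Action.

(* q(t) = pi(y(T t)) *)
Definition loop_of_orbit (y : R -> E * E) (T : R) : R -> E :=
  fun t => (y (T * t)).1.

End MagneticSphere.

(* Main.v *)
(* On the round sphere take [sigma = - z^2 dx /\ dy].  The latitude of radius [r],
   traversed with angular speed [z^2 = 1 - r^2], is an orbit of energy
   [(r - r^3)^2 / 2] and period [2 pi / (1 - r^2)].  While [3 r^2 < 1] both increase
   with [r], so that the latitudes form an orbit cylinder with chi = -1.  At [r = 4/7]
   the energy exceeds [1/20], an upper bound of the Mane value given by the primitive
   [(rho / 4 - 1/2) (x dy - y dx)], [rho = x^2 + y^2].  The Jacobi equation is
   explicitly solvable and yields strong non-degeneracy.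

   For [xi] with vertical component [- r eta] and horizontal velocity component [beta],
   [T d^2 S_k^T] is [int eta'^2 + beta^2 - D eta^2], [D = (2 pi)^2 (1 - 3 r^2)], where
   [int beta = 2 pi z int eta].  It is nonnegative, because [D <= 8] and the
   fluctuations of [eta] are controlled by [eta'].  Adding the period variation [tau]
   replaces [int beta^2] by the variance of [beta] plus
   [(2 pi)^2 (r tau / T - z int eta)^2], so that exactly one negative direction
   appears, the transverse deformation [eta = 1] with [tau = z T / r]. *)

Require Import Defs.
From HB Require Import structures.
From mathcomp Require Import all_boot all_order all_algebra.
From mathcomp Require Import all_classical all_reals all_analysis.
From mathcomp Require Import measurable_realfun ring lra.

Set Implicit Arguments.
Unset Strict Implicit.
Unset Printing Implicit Defensive.

Import Order.TTheory GRing.Theory Num.Theory.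
Import numFieldNormedType.Exports.
Local Open Scope classical_set_scope.
Local Open Scope ring_scope.

(** * Integration and weak derivatives on the unit interval *)

(** The choice of [sigma] lies in the strength of the field. On the sphere [dx /\ dy] is [z] times
    the area form, so [sigma] has strength [z^3] up to sign. Strength [z] would give all latitudes
    the same period; the extra [z^2] weakens the field away from the pole, so that wider latitudes
    take longer, while their energy still grows up to [r^2 = 1/3]. The top energy [2/27] is twice
    [1/27], the supremum of the Hamiltonian along the primitive, which leaves room above the Mane
    value.

    The obstacle that shapes the proof is that the flow, the weak derivative and the magnetic term
    are picked by [xget], which falls back on a default when there is no witness. Hence global
    integral curves have to be constructed, from a Picard iteration and a conserved quantity, and
    any two W^{1,2} loops on the sphere have to be joined by a C^1 path of loops; Stokes then turns
    the chosen flux into a difference of line integrals. Weak derivatives are fixed only almost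
    everywhere, so integrands are compared almost everywhere. The index is computed from exact
    quadratic forms, valid for every W^{1,2} field and not only for smooth ones. *)

Section L1L2.
Context {R : realType}.
Notation leb := (@lebesgue_measure R).
Notation I01 := (`[0%R, 1%R]%classic : set R).
Implicit Types (u v w f g h : R -> R) (a b c t : R).

(** The class of multipliers: a product with a bounded measurable function preserves both [L1] and
    [L2], and every function with a weak derivative belongs to it. *)
Definition Bm h := measurable_fun I01 h /\ exists M, forall t, I01 t -> `|h t| <= M.
Definition L1 u := leb.-integrable I01 (EFin \o u).
Definition L2 u := measurable_fun I01 u /\ L1 (fun t => u t ^+ 2).
Definition ing u := Rintegral leb I01 u.
Definition inab a b u := Rintegral leb `[a, b]%classic u.

Lemma mI01 : measurable (I01 : set (measurableTypeR R)).
Proof. exact: measurable_itv. Qed.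

Lemma L1_meas u : L1 u -> measurable_fun I01 u.
Proof. by move=> /integrableP[/measurable_EFinP]. Qed.

Lemma L1_le u v : measurable_fun I01 u -> L1 v ->
  (forall t, I01 t -> `|u t| <= `|v t|) -> L1 u.
Proof.
move=> mu iv uv; apply: (le_integrable mI01 _ _ iv).
  exact/measurable_EFinP.
by move=> t It; rewrite lee_fin; exact: uv.
Qed.

Lemma L1_ext u v : (forall t, I01 t -> u t = v t) -> L1 u -> L1 v.
Proof.
move=> uv; apply: eq_integrable; first exact: mI01.
by move=> t /set_mem It /=; rewrite uv.
Qed.

Lemma L1D u v : L1 u -> L1 v -> L1 (fun t => u t + v t).
Proof. by move=> iu iv; exact: (integrableD mI01 iu iv). Qed.

Lemma L1Z c u : L1 u -> L1 (fun t => c * u t).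
Proof. by move=> iu; exact: (integrableZl mI01 c iu). Qed.

Lemma L1N u : L1 u -> L1 (fun t => - u t).
Proof. by move=> /(L1Z (-1)); apply: L1_ext => t _; rewrite mulN1r. Qed.

Lemma L1B u v : L1 u -> L1 v -> L1 (fun t => u t - v t).
Proof. by move=> iu iv; apply: L1D => //; exact: L1N. Qed.

Lemma Bm_cst c : Bm (fun _ => c).
Proof. by split; [exact: measurable_cst|exists `|c|]. Qed.

Lemma BmD u v : Bm u -> Bm v -> Bm (fun t => u t + v t).
Proof.
move=> [mu [M uM]] [mv [N vN]]; split; first exact: measurable_funD.
by exists (M + N) => t It; rewrite (le_trans (ler_normD _ _))// lerD ?uM ?vN.
Qed.

Lemma BmM u v : Bm u -> Bm v -> Bm (fun t => u t * v t).
Proof.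
move=> [mu [M uM]] [mv [N vN]]; split; first exact: measurable_funM.
by exists (M * N) => t It; rewrite normrM ler_pM// ?uM ?vN.
Qed.

Lemma BmZ c u : Bm u -> Bm (fun t => c * u t).
Proof. by move=> bu; apply: BmM => //; exact: Bm_cst. Qed.

Lemma BmN u : Bm u -> Bm (fun t => - u t).
Proof.
move=> [mu [M uM]]; split; first exact: measurableT_comp.
by exists M => t It; rewrite normrN uM.
Qed.

Lemma BmB u v : Bm u -> Bm v -> Bm (fun t => u t - v t).
Proof. by move=> iu iv; apply: BmD => //; exact: BmN. Qed.

Lemma BmX u n : Bm u -> Bm (fun t => u t ^+ n).
Proof.
move=> bu; elim: n => [|n ih]; first exact: Bm_cst.
by under [X in Bm X]eq_fun do rewrite exprS; exact: BmM.
Qed.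

Lemma L1_cst c : L1 (fun=> c).
Proof.
apply: continuous_compact_integrable; first exact: segment_compact.
by move=> t; exact: cvg_cst.
Qed.

Lemma Bm_L1 u : Bm u -> L1 u.
Proof.
move=> [mu [M uM]]; apply: (L1_le mu (L1_cst M)) => t It.
exact: le_trans (uM _ It) (ler_norm _).
Qed.

Lemma L1M h u : Bm h -> L1 u -> L1 (fun t => h t * u t).
Proof.
move=> [mh [M hM]] iu; apply: (L1_le _ (L1Z M iu)).
  by apply: measurable_funM => //; exact: L1_meas.
move=> t It; rewrite !normrM ler_wpM2r//.
exact: le_trans (hM _ It) (ler_norm _).
Qed.

Lemma L2M_L1 u v : L2 u -> L2 v -> L1 (fun t => u t * v t).
Proof.
move=> [mu u2] [mv v2]; apply: (L1_le _ (L1D u2 v2)).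
  exact: measurable_funM.
move=> t _; rewrite normrM [leRHS]ger0_norm ?addr_ge0 ?sqr_ge0//.
rewrite -(real_normK (num_real (u t))) -(real_normK (num_real (v t))).
have := sqr_ge0 (`|u t| - `|v t|); have := normr_ge0 (u t).
have := normr_ge0 (v t).
by nra.
Qed.

Lemma Bm_L2 u : Bm u -> L2 u.
Proof. by move=> bu; split; [case: bu|apply: Bm_L1; exact: BmX]. Qed.

Lemma L2_L1 u : L2 u -> L1 u.
Proof.
move=> u2; have := L2M_L1 (Bm_L2 (Bm_cst 1)) u2.
by apply: L1_ext => t _; rewrite mul1r.
Qed.

Lemma L2M h u : Bm h -> L2 u -> L2 (fun t => h t * u t).
Proof.
move=> bh [mu u2]; split; first by apply: measurable_funM => //; case: bh.
by apply: L1_ext (L1M (BmX 2 bh) u2) => t _; rewrite exprMn.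
Qed.

Lemma L2Z c u : L2 u -> L2 (fun t => c * u t).
Proof. exact/L2M/Bm_cst. Qed.

Lemma L2D u v : L2 u -> L2 v -> L2 (fun t => u t + v t).
Proof.
move=> u2 v2; split.
  by apply: measurable_funD; [case: u2|case: v2].
have := L1D (L1D u2.2 v2.2) (L1Z 2 (L2M_L1 u2 v2)).
by apply: L1_ext => t _; ring.
Qed.

Lemma L2N u : L2 u -> L2 (fun t => - u t).
Proof.
move=> /(L2Z (-1)); suff -> : (fun t => -1 * u t) = (fun t => - u t) by [].
by apply/funext => t; rewrite mulN1r.
Qed.

Lemma L2B u v : L2 u -> L2 v -> L2 (fun t => u t - v t).
Proof. by move=> iu iv; apply: L2D => //; exact: L2N. Qed.

Lemma ingD u v : L1 u -> L1 v -> ing (fun t => u t + v t) = ing u + ing v.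
Proof. by move=> *; apply: RintegralD => //; exact: mI01. Qed.

Lemma ingB u v : L1 u -> L1 v -> ing (fun t => u t - v t) = ing u - ing v.
Proof. by move=> *; apply: RintegralB => //; exact: mI01. Qed.

Lemma ingZ c u : L1 u -> ing (fun t => c * u t) = c * ing u.
Proof. by move=> *; apply: RintegralZl => //; exact: mI01. Qed.

Lemma ing_cst c : ing (fun=> c) = c.
Proof.
rewrite /ing Rintegral_cst//; have := @lebesgue_measure_itv R `[0, 1].
by rewrite /= lte_fin ltr01 oppr0 adde0 => ->; rewrite mulr1.
Qed.

Lemma ing_ext u v : (forall t, I01 t -> u t = v t) -> ing u = ing v.
Proof. by move=> uv; apply: eq_Rintegral => t /set_mem /uv. Qed.

Lemma ing_le u v : L1 u -> L1 v -> (forall t, I01 t -> u t <= v t) -> ing u <= ing v.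
Proof. by move=> iu iv uv; apply: le_Rintegral => //; exact: mI01. Qed.

Lemma ing_ge0 u : (forall t, I01 t -> 0 <= u t) -> 0 <= ing u.
Proof. by move=> u0; apply: Rintegral_ge0. Qed.

Lemma ing_norm u : L1 u -> `|ing u| <= ing (fun t => `|u t|).
Proof. by move=> *; apply: le_normr_Rintegral => //; exact: mI01. Qed.

Lemma L1_norm u : L1 u -> L1 (fun t => `|u t|).
Proof.
move=> iu; apply: (L1_le _ iu).
  by apply: measurableT_comp => //; exact: L1_meas.
by move=> t _; rewrite normr_id.
Qed.

Lemma ing_ae u v : L1 u -> L1 v ->
  {ae leb, forall t, I01 t -> u t = v t} -> ing u = ing v.
Proof.
move=> iu iv uv; congr fine; apply: (ae_eq_integral _ _ mI01).
- by apply/measurable_EFinP; exact: L1_meas.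
- by apply/measurable_EFinP; exact: L1_meas.
- by move: uv; apply: (@filterS _ _ (ae_filter_ringOfSetsType leb)) => t uv It /=; rewrite uv.
Qed.

Lemma sub01 a b : 0 <= a -> b <= 1 -> `[a, b] `<=` I01.
Proof.
move=> a0 b1 t /=; rewrite !in_itv/= => /andP[at_ tb].
by rewrite (le_trans a0 at_) (le_trans tb b1).
Qed.

Lemma L1_sub a b u : 0 <= a -> b <= 1 -> L1 u ->
  leb.-integrable `[a, b]%classic (EFin \o u).
Proof. by move=> a0 b1; apply: integrableS => //; exact: sub01. Qed.

Lemma inabD a b u v : 0 <= a -> b <= 1 -> L1 u -> L1 v ->
  inab a b (fun t => u t + v t) = inab a b u + inab a b v.
Proof. by move=> a0 b1 iu iv; apply: RintegralD => //; exact: L1_sub. Qed.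

Lemma inabB a b u v : 0 <= a -> b <= 1 -> L1 u -> L1 v ->
  inab a b (fun t => u t - v t) = inab a b u - inab a b v.
Proof. by move=> a0 b1 iu iv; apply: RintegralB => //; exact: L1_sub. Qed.

Lemma inabZ a b c u : 0 <= a -> b <= 1 -> L1 u ->
  inab a b (fun t => c * u t) = c * inab a b u.
Proof. by move=> a0 b1 iu; apply: RintegralZl => //; exact: L1_sub. Qed.

Lemma inab_ext a b u v : (forall t, a <= t <= b -> u t = v t) -> inab a b u = inab a b v.
Proof. by move=> uv; apply: eq_Rintegral => t /set_mem /=; rewrite in_itv/= => /uv. Qed.

Lemma inab_le a b u v : 0 <= a -> b <= 1 -> L1 u -> L1 v ->
  (forall t, a <= t <= b -> u t <= v t) -> inab a b u <= inab a b v.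
Proof.
move=> a0 b1 iu iv uv; apply: le_Rintegral; [by []|exact: L1_sub..|].
by move=> t /=; rewrite in_itv/= => /uv.
Qed.

Lemma inab_ge0 a b u : (forall t, a <= t <= b -> 0 <= u t) -> 0 <= inab a b u.
Proof. by move=> u0; apply: Rintegral_ge0 => t /=; rewrite in_itv/= => /u0. Qed.

Lemma inab_norm a b u : 0 <= a -> b <= 1 -> L1 u ->
  `|inab a b u| <= inab a b (fun t => `|u t|).
Proof. by move=> a0 b1 iu; apply: le_normr_Rintegral => //; exact: L1_sub. Qed.

Lemma inab_cst a b c : a <= b -> inab a b (fun=> c) = c * (b - a).
Proof.
move=> ab; rewrite /inab Rintegral_cst//; have := @lebesgue_measure_itv R `[a, b].
rewrite /= lte_fin => ->.
by move: ab; rewrite le_eqVlt => /predU1P[->|->]; [rewrite ltxx subrr|].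
Qed.

Lemma inab_split a b c u : 0 <= a -> a <= b -> b <= c -> c <= 1 -> L1 u ->
  inab a c u = inab a b u + inab b c u.
Proof.
move=> a0 ab bc c1 iu; apply/eqP; rewrite addrC -subr_eq; apply/eqP.
rewrite /inab Rintegral_itvB//.
- apply: Rintegral_itv_obnd_cbnd.
  apply: (integrableS _ _ _ iu) => //.
  move=> t /=; rewrite !in_itv/= => /andP[bt tc]; apply/andP; split.
    exact: (le_trans a0 (le_trans ab (ltW bt))).
  exact: le_trans c1.
- exact: L1_sub.
Qed.

Lemma inab01 u : inab 0 1 u = ing u. Proof. by []. Qed.

(** Cauchy-Schwarz against the constant 1: integrate the square of [u] minus its mean. The division
    by [b - a] in the mean forces the degenerate interval to be treated apart. *)
Lemma inab_CS a b u : 0 <= a -> a <= b -> b <= 1 -> L2 u ->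
  inab a b u ^+ 2 <= (b - a) * inab a b (fun t => u t ^+ 2).
Proof.
move=> a0 ab b1 u2; have u1 := L2_L1 u2; set U := inab a b u.
move: (ab); rewrite le_eqVlt => /predU1P[abE|ab'].
  by rewrite /U -abE /inab set_itv1 Rintegral_set1 subrr mul0r expr0n/=.
have ba : 0 < b - a by rewrite subr_gt0.
pose c := U / (b - a).
have : 0 <= inab a b (fun t => (u t ^+ 2 - (2 * c) * u t) + c ^+ 2).
  by apply: inab_ge0 => t _; rewrite (_ : _ + _ = (u t - c) ^+ 2) ?sqr_ge0//; ring.
have i2 : L1 (fun t => 2 * c * u t) by exact: L1Z.
rewrite inabD//; last 2 first.
- by apply: L1B => //; case: u2.
- exact: L1_cst.
rewrite inabB//; last by case: u2.
rewrite inabZ// inab_cst// -/U.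
set V := inab a b _; move=> h.
have -> : U ^+ 2 = (b - a) * (2 * c * U - c ^+ 2 * (b - a)).
  by rewrite /c; field; exact: lt0r_neq0.
by rewrite ler_pM2l//; lra.
Qed.

End L1L2.

(** * Calculus of W^{1,2} functions of one variable: product and chain rules, uniqueness, Sobolev
    and Poincare inequalities *)

Section WeakDerivative.
Context {R : realType}.
Notation leb := (@lebesgue_measure R).
Notation I01 := (`[0%R, 1%R]%classic : set R).
Implicit Types (u v w f g h : R -> R) (a b c t : R).

(** One coordinate of [weak_derivative]; all the calculus is carried out on scalar functions. *)
Definition wd f u := L2 u /\ forall t, I01 t -> f t = f 0 + inab 0 t u.

Lemma weak_derivativeP (f u : R -> 'rV[R]_3) :
  weak_derivative f u <-> forall i, wd (fun t => f t 0 i) (fun t => u t 0 i).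
Proof.
by split=> h i; [have [? ? ?] := h i|have [[? ?] ?] := h i].
Qed.

Lemma in01 t : I01 t = (0 <= t <= 1).
Proof. by rewrite /= in_itv. Qed.

Lemma I01_0 : I01 0. Proof. by rewrite in01 lexx ler01. Qed.

Lemma wd_L1 f u : wd f u -> L1 u. Proof. by move=> [/L2_L1]. Qed.

Lemma wd_incr f u a b : wd f u -> 0 <= a -> a <= b -> b <= 1 ->
  f b - f a = inab a b u.
Proof.
move=> wf a0 ab b1; have [_ fE] := wf.
rewrite (fE b) ?in01 ?(le_trans a0)//.
rewrite (fE a) ?in01 ?a0 ?(le_trans ab)//.
rewrite (inab_split _ a0 ab b1 (wd_L1 wf))//; ring.
Qed.

Lemma wd_ext f g u v : (forall t, I01 t -> f t = g t) ->
  (forall t, I01 t -> u t = v t) -> wd f u -> wd g v.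
Proof.
move=> fg uv [[mu u2] fE]; split.
  split; last by apply: L1_ext u2 => t It; rewrite uv.
  by apply: (eq_measurable_fun _ _ mu) => t /set_mem It; rewrite uv.
move=> t It; rewrite -!fg//; last exact: I01_0.
rewrite fE//; congr (_ + _); apply: inab_ext => s /andP[s0 st]; apply: uv.
by move: It; rewrite !in01 s0/= => /andP[_ /(le_trans st)].
Qed.

Lemma wd_cst c : wd (fun=> c) (fun=> 0).
Proof.
split; first exact: Bm_L2 (Bm_cst 0).
by move=> t; rewrite in01 => /andP[t0 t1]; rewrite inab_cst// mul0r addr0.
Qed.

Lemma wdD f u g v : wd f u -> wd g v -> wd (fun t => f t + g t) (fun t => u t + v t).
Proof.
move=> wf wg; split; first by apply: L2D; [case: wf|case: wg].
move=> t It; have := It; rewrite in01 => /andP[t0 t1].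
by rewrite inabD ?(wd_L1 wf) ?(wd_L1 wg)// (wf.2 t It) (wg.2 t It); ring.
Qed.

Lemma wdZ c f u : wd f u -> wd (fun t => c * f t) (fun t => c * u t).
Proof.
move=> wf; split; first by apply: L2Z; case: wf.
move=> t It; have := It; rewrite in01 => /andP[t0 t1].
by rewrite inabZ ?(wd_L1 wf)// (wf.2 t It); ring.
Qed.

Lemma wdB f u g v : wd f u -> wd g v -> wd (fun t => f t - g t) (fun t => u t - v t).
Proof.
move=> wf /(wdZ (-1)) /(wdD wf); apply: wd_ext => t _; ring.
Qed.

Lemma wd_continuous f u : wd f u -> {within I01, continuous f}.
Proof.
move=> wf; have := parameterized_integral_continuous (ler01 : 0 <= 1 :> R) (wd_L1 wf).
move=> /(_ _) h; apply: (@subspace_eq_continuous _ _ _ (fun t => f 0 + inab 0 t u)).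
  by move=> t /set_mem It; rewrite /from_subspace (wf.2 t It).
by move=> t; apply: cvgD; [exact: cvg_cst|exact: h].
Qed.

Lemma wd_bounded f u : wd f u -> forall t, I01 t -> `|f t| <= `|f 0| + ing (fun s => `|u s|).
Proof.
move=> wf t It; have := It; rewrite in01 => /andP[t0 t1].
rewrite (wf.2 t It) (le_trans (ler_normD _ _))// lerD2l.
have u1 := wd_L1 wf.
apply: (le_trans (inab_norm _ _ u1)) => //.
rewrite -inab01 (@inab_split _ 0 t 1)//; last exact: L1_norm.
by rewrite lerDl inab_ge0.
Qed.

Lemma wd_Bm f u : wd f u -> Bm f.
Proof.
move=> wf; split; last by eexists; exact: wd_bounded wf.
apply: subspace_continuous_measurable_fun; first exact: mI01.
exact: wd_continuous wf.
Qed.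

Lemma lipschitz_within f u h c : wd f u ->
  (forall a b, I01 a -> I01 b -> `|h b - h a| <= c * `|f b - f a|) ->
  {within I01, continuous h}.
Proof.
move=> wf hf; have cf := wd_continuous wf; rewrite continuous_subspace_in.
move=> t /set_mem It; apply/cvgrPdist_lt => e e0.
have c0 : 0 < `|c| + 1 by rewrite ltr_wpDl.
have /cvgrPdist_lt/(_ (e / (`|c| + 1))) := cf t.
rewrite divr_gt0// => /(_ erefl) ft.
near=> s.
have Is : I01 s by near: s; rewrite /nbhs/= -nbhs_subspace_in//; exact: withinT.
rewrite distrC (le_lt_trans (hf _ _ It Is))//.
rewrite (@le_lt_trans _ _ ((`|c| + 1) * `|f s - f t|))//.
  by rewrite ler_wpM2r// ler_wpDr// ler_norm.
rewrite -ltr_pdivlMl// mulrC distrC; by near: s.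
Unshelve. all: by end_near. Qed.

Lemma lipschitz_Bm f u h c : wd f u ->
  (forall a b, I01 a -> I01 b -> `|h b - h a| <= c * `|f b - f a|) -> Bm h.
Proof.
move=> wf hf; split.
  apply: subspace_continuous_measurable_fun; first exact: mI01.
  exact: (lipschitz_within wf hf).
have [_ [M fM]] := wd_Bm wf.
exists (`|h 0| + `|c| * (M + `|f 0|)) => t It.
rewrite -(subrK (h 0) (h t)) addrC (le_trans (ler_normD _ _))// lerD2l.
apply: (le_trans (hf _ _ I01_0 It)).
apply: (@le_trans _ _ (`|c| * `|f t - f 0|)); first by rewrite ler_wpM2r// ler_norm.
rewrite ler_wpM2l//.
by rewrite (le_trans (ler_normB _ _))// lerD2r fM.
Qed.

Lemma wd_holder f u a b : wd f u -> 0 <= a -> a <= b -> b <= 1 ->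
  (f b - f a) ^+ 2 <= (b - a) * inab a b (fun t => u t ^+ 2).
Proof. by move=> wf a0 ab b1; rewrite (wd_incr wf)// inab_CS//; case: wf. Qed.

Lemma archi_le0 (x K : R) : (forall n, x <= K / n.+1%:R) -> x <= 0.
Proof.
move=> h; rewrite leNgt; apply/negP => x0.
have [n Kn] : exists n : nat, K / x < n%:R.
  exists (Num.bound `|K / x|); exact: le_lt_trans (ler_norm _) (archi_boundP (normr_ge0 _)).
have := h n; rewrite leNgt => /negP; apply.
rewrite ltr_pdivrMr// mulrC -ltr_pdivrMr// (lt_trans Kn)//.
by rewrite ltr_nat.
Qed.

(** Cut [[0, t]] into equal steps: the bounds on the increments telescope to [c * t * (V t - V 0)]
    divided by the number of steps, which is arbitrarily large. *)
Lemma small_increments_cst (G V : R -> R) c t : 0 <= t -> t <= 1 ->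
  (forall a b, 0 <= a -> a <= b -> b <= t -> `|G b - G a| <= c * (b - a) * (V b - V a)) ->
  G t = G 0.
Proof.
move=> t0 t1 h; apply/eqP; rewrite -subr_eq0 -normr_le0.
apply: (@archi_le0 _ (c * t * (V t - V 0))) => n.
pose s i : R := t * i%:R / n.+1%:R.
have n0 : (0 : R) < n.+1%:R by [].
have s0 i : 0 <= s i by rewrite divr_ge0// mulr_ge0.
have sS i : s i.+1 - s i = t / n.+1%:R.
  by rewrite /s -natr1; field; exact: lt0r_neq0.
have snt i : (i <= n.+1)%N -> s i <= t.
  by move=> ni; rewrite /s ler_pdivrMr// ler_wpM2l// ler_nat.
have : forall i, (i <= n.+1)%N -> `|G (s i) - G 0| <= c * (t / n.+1%:R) * (V (s i) - V 0).
  elim=> [|i ih] ni; first by rewrite /s mulr0 mul0r !subrr mulr0 normr0.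
  rewrite (_ : _ - G 0 = (G (s i.+1) - G (s i)) + (G (s i) - G 0)); last ring.
  rewrite (le_trans (ler_normD _ _))//.
  rewrite (_ : V (s i.+1) - V 0 = (V (s i.+1) - V (s i)) + (V (s i) - V 0)); last ring.
  rewrite mulrDr lerD ?ih ?(ltnW ni)//.
  rewrite -(sS i); apply: h => //; last exact: snt.
  by rewrite -subr_ge0 sS divr_ge0.
move=> /(_ n.+1 (leqnn _)).
have -> : s n.+1 = t by rewrite /s mulfK// lt0r_neq0.
by move=> /le_trans; apply; rewrite !mulrA (mulrAC (c * t)).
Qed.

(** Chain rule without pointwise differentiation. The defect [G] between [phi (f x)] and the
    candidate primitive has increments at most [2 * |c| * (b - a)] times the integral of [u ^+ 2]
    over [[a, b]], because [f] is 1/2-Hoelder with that constant; so [G] is constant by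
    [small_increments_cst]. *)
Lemma wd_comp f u (phi dphi : R -> R) c : wd f u ->
  (forall a b, I01 a -> I01 b ->
    `|phi (f b) - phi (f a) - dphi (f a) * (f b - f a)| <= c * (f b - f a) ^+ 2) ->
  (forall a b, I01 a -> I01 b ->
    `|dphi (f b) - dphi (f a)| <= c * `|f b - f a|) ->
  wd (fun t => phi (f t)) (fun t => dphi (f t) * u t).
Proof.
move=> wf h1 h2; have bd : Bm (fun t => dphi (f t)) := lipschitz_Bm wf h2.
have u2 : L2 u by case: wf.
have du2 : L2 (fun t => dphi (f t) * u t) by exact: L2M.
split=> // t; rewrite in01 => /andP[t0 t1].
pose G x := phi (f x) - inab 0 x (fun t => dphi (f t) * u t).
suff : G t = G 0.
  rewrite /G /inab set_itv1 Rintegral_set1 subr0 => <-; ring.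
pose c' := `|c|.
apply: (@small_increments_cst G (fun x => inab 0 x (fun t => u t ^+ 2)) (2 * c')) => //.
move=> a b a0 ab bt; have b1 := le_trans bt t1.
have du1 := L2_L1 du2; have u1 := L2_L1 u2.
have Ia : I01 a by rewrite in01 a0 (le_trans ab).
have Ib : I01 b by rewrite in01 b1 (le_trans a0).
rewrite (@inab_split _ 0 a b (fun t => u t ^+ 2)) ?a0//; last by case: u2.
rewrite (addrC (inab 0 a _)) addrK.
set V := inab a b _.
rewrite /G (@inab_split _ 0 a b)//.
(* The increment of [G] is the Taylor remainder of [phi] at [f a] minus the integral of the
   variation of [dphi] against [u]; each is bounded by [c' * ((b - a) * V)]. *)
have -> : phi (f b) - (inab 0 a (fun t => dphi (f t) * u t) + inab a b (fun t => dphi (f t) * u t))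
   - (phi (f a) - inab 0 a (fun t => dphi (f t) * u t)) =
   (phi (f b) - phi (f a) - dphi (f a) * (f b - f a)) -
   inab a b (fun t => (dphi (f t) - dphi (f a)) * u t).
  rewrite (_ : inab a b (fun t => (dphi (f t) - dphi (f a)) * u t) =
     inab a b (fun t => dphi (f t) * u t) - dphi (f a) * inab a b u).
    by rewrite (wd_incr wf)//; ring.
  rewrite -inabZ// -inabB//; last exact: L1Z.
  by apply: inab_ext => s _; ring.
have hV x y : 0 <= x -> a <= x -> x <= y -> y <= b -> (f y - f x) ^+ 2 <= (b - a) * V.
  move=> x0 ax xy yb; apply: (le_trans (wd_holder wf x0 xy (le_trans yb b1))).
  have V0 p q : 0 <= inab p q (fun t => u t ^+ 2) by apply: inab_ge0 => s _; exact: sqr_ge0.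
  rewrite ler_pM ?subr_ge0//; first by rewrite lerB.
  rewrite /V (@inab_split _ a x b)//; last 2 first.
  - exact: le_trans yb.
  - by case: u2.
  rewrite (@inab_split _ x y b)//; last by case: u2.
  by rewrite ler_wpDl// lerDl.
have c'0 : 0 <= c' by exact: normr_ge0.
have cc' : c <= c' by exact: ler_norm.
rewrite (le_trans (ler_normB _ _))//.
have -> : 2 * c' * (b - a) * V = c' * ((b - a) * V) + c' * ((b - a) * V) by ring.
rewrite lerD//.
  apply: (le_trans (h1 _ _ Ia Ib)).
  apply: (@le_trans _ _ (c' * (f b - f a) ^+ 2)); first by rewrite ler_wpM2r// sqr_ge0.
  by rewrite ler_wpM2l// hV.
apply: (le_trans (inab_norm a0 b1 _)).
  by apply: L1M => //; apply: BmB => //; exact: Bm_cst.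
have nu1 : L1 (fun t => `|u t|) by exact: L1_norm.
set W := inab a b (fun s => `|u s|).
have W0 : 0 <= W by apply: inab_ge0.
have fW x : a <= x <= b -> `|f x - f a| <= W.
  move=> /andP[ax xb]; rewrite (wd_incr wf)//; last exact: le_trans b1.
  rewrite (le_trans (inab_norm a0 _ u1))//; first exact: le_trans b1.
  by rewrite /W (@inab_split _ a x b)// lerDl inab_ge0.
have WV : W ^+ 2 <= (b - a) * V.
  have := @inab_CS _ a b (fun s => `|u s|) a0 ab b1.
  rewrite -/W /V => /(_ _)/le_trans; apply.
    split; first by apply: measurableT_comp => //; case: u2.
    by case: u2 => _; apply: L1_ext => s _; rewrite real_normK ?num_real.
  by under inab_ext do rewrite real_normK ?num_real//.
apply: (@le_trans _ _ (inab a b (fun t => (c' * W) * `|u t|))).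
  apply: inab_le => //.
  - by apply/L1_norm/L1M => //; apply: BmB => //; exact: Bm_cst.
  - exact: L1Z.
  - move=> s sab; rewrite normrM ler_wpM2r//.
    have Is : I01 s by apply: (sub01 a0 b1); rewrite /= in_itv.
    apply: (le_trans (h2 _ _ Ia Is)).
    apply: (@le_trans _ _ (c' * `|f s - f a|)); first by rewrite ler_wpM2r.
    by rewrite ler_wpM2l ?fW.
by rewrite inabZ// -/W -mulrA -expr2 ler_wpM2l.
Qed.

Lemma wd_sqr f u : wd f u -> wd (fun t => f t ^+ 2) (fun t => 2 * f t * u t).
Proof.
move=> wf; apply: (@wd_comp _ _ (fun x => x ^+ 2) (fun x => 2 * x) 2 wf) => a b _ _.
  rewrite (_ : _ - _ = (f b - f a) ^+ 2); last by ring.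
  by rewrite ger0_norm ?sqr_ge0// ler_peMl ?sqr_ge0// ler1n.
by rewrite -mulrBr normrM ger0_norm.
Qed.

(** Polarization: four times a product is a difference of two squares. *)
Lemma wdM f u g v : wd f u -> wd g v ->
  wd (fun t => f t * g t) (fun t => f t * v t + g t * u t).
Proof.
move=> wf wg; have := wdZ 4^-1 (wdB (wd_sqr (wdD wf wg)) (wd_sqr (wdB wf wg))).
by apply: wd_ext => t _; field.
Qed.

Lemma wd_inv f u m : 0 < m -> (forall t, I01 t -> m <= f t) -> wd f u ->
  wd (fun t => (f t)^-1) (fun t => - (f t) ^- 2 * u t).
Proof.
move=> m0 mf wf.
have [_ [M fM]] := wd_Bm wf.
have fpos t : I01 t -> 0 < f t by move=> /mf; exact: lt_le_trans.
have fV t : I01 t -> (f t)^-1 <= m^-1 by move=> It; rewrite lef_pV2 ?posrE ?fpos ?mf.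
have fV0 t : I01 t -> 0 <= (f t)^-1 by move=> It; rewrite invr_ge0 ltW ?fpos.
have mV : 0 < m^-1 by rewrite invr_gt0.
apply: (@wd_comp _ _ (fun x => x^-1) (fun x => - x ^- 2) (2 * m^-1 ^+ 3) wf) => a b Ia Ib.
  have fa := fpos a Ia; have fb := fpos b Ib.
  rewrite (_ : _ - _ = (f a)^-1 ^+ 2 * (f b)^-1 * (f b - f a) ^+ 2); last first.
    by field; rewrite ?lt0r_neq0.
  rewrite normrM [X in _ * X]ger0_norm ?sqr_ge0// ler_wpM2r ?sqr_ge0//.
  rewrite ger0_norm ?mulr_ge0 ?sqr_ge0 ?fV0//.
  apply: (@le_trans _ _ (m^-1 ^+ 3)).
    rewrite [leRHS]exprSr ler_pM ?sqr_ge0 ?fV0 ?fV//.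
    by rewrite ler_pXn2r ?nnegrE ?fV0 ?fV ?ltW.
  by rewrite ler_peMl ?exprn_ge0 ?ltW// ltr1n.
have fa := fpos a Ia; have fb := fpos b Ib.
rewrite (_ : _ - _ = ((f a)^-1 ^+ 2 * (f b)^-1 + (f a)^-1 * (f b)^-1 ^+ 2) * (f b - f a)); last first.
  by field; rewrite ?lt0r_neq0.
rewrite normrM ler_wpM2r// ger0_norm ?addr_ge0 ?mulr_ge0 ?sqr_ge0 ?fV0//.
rewrite mulr2n mulrDl mul1r lerD//.
  rewrite [leRHS]exprSr ler_pM ?sqr_ge0 ?fV0 ?fV//.
  by rewrite ler_pXn2r ?nnegrE ?fV0 ?fV ?ltW.
rewrite [leRHS]exprS ler_pM ?sqr_ge0 ?fV0 ?fV//.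
by rewrite ler_pXn2r ?nnegrE ?fV0 ?fV ?ltW.
Qed.

(** The lower bound 1 is that of [|q + s xi|^2 = 1 + s^2 |xi|^2], the function under the root in
    [loop_chart]. *)
Lemma wd_sqrt f u : (forall t, I01 t -> 1 <= f t) -> wd f u ->
  wd (fun t => Num.sqrt (f t)) (fun t => (2 * Num.sqrt (f t))^-1 * u t).
Proof.
move=> f1 wf.
have s1 t : I01 t -> 1 <= Num.sqrt (f t).
  by move=> It; rewrite -[leLHS]sqrtr1 ler_wsqrtr// f1.
have sE t : I01 t -> f t = Num.sqrt (f t) ^+ 2.
  by move=> It; rewrite sqr_sqrtr// (le_trans ler01) ?f1.
have sd a b : I01 a -> I01 b -> `|Num.sqrt (f b) - Num.sqrt (f a)| <= `|f b - f a|.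
  move=> Ia Ib; rewrite (sE a Ia) (sE b Ib) subr_sqr normrM.
  rewrite !sqrtr_sqr !(ger0_norm (le_trans ler01 (s1 _ _)))//.
  rewrite ler_peMr// ger0_norm ?addr_ge0 ?(le_trans ler01) ?s1//.
  by have := s1 a Ia; have := s1 b Ib; lra.
apply: (@wd_comp _ _ Num.sqrt (fun x => (2 * Num.sqrt x)^-1) 1 wf) => a b Ia Ib.
  have sa := s1 a Ia; have sb := s1 b Ib; have := sd a b Ia Ib.
  have := sE a Ia; have := sE b Ib.
  set x := Num.sqrt (f a) in sa *; set y := Num.sqrt (f b) in sb *.
  move=> -> ->; have x0 : x != 0 by rewrite lt0r_neq0// (lt_le_trans ltr01).
  move=> h; rewrite (_ : _ - _ = - ((2 * x)^-1 * (y - x) ^+ 2)); last by field.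
  rewrite normrN normrM normrX mul1r.
  rewrite -[leRHS]real_normK ?num_real// -[leRHS]mul1r ler_pM ?sqr_ge0//.
    rewrite ger0_norm ?invr_ge0; last lra.
    by rewrite invf_le1; lra.
  by rewrite ler_pXn2r ?nnegrE.
have sa := s1 a Ia; have sb := s1 b Ib; rewrite mul1r; apply: le_trans (sd a b Ia Ib).
set x := Num.sqrt (f a) in sa *; set y := Num.sqrt (f b) in sb *.
rewrite (_ : _ - _ = - ((2 * x * y)^-1 * (y - x))); last first.
  by field; rewrite !lt0r_neq0// (lt_le_trans ltr01).
rewrite normrN normrM ler_piMl// ger0_norm ?invr_ge0; last nra.
by rewrite invf_le1; nra.
Qed.

Lemma wd_C1 f u : (forall x : R, is_derive x (1 : R) f (u x)) -> continuous u -> wd f u.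
Proof.
move=> fu cu; have cwu A : {within A, continuous u} by exact: continuous_subspaceT.
have cf : continuous f.
  by move=> x; apply/differentiable_continuous/derivable1_diffP; case: (fu x).
split.
  apply: Bm_L2; split.
    by apply: subspace_continuous_measurable_fun => //; exact: mI01.
  have := compact_bounded (continuous_compact (cwu I01) (@segment_compact _ 0 1)).
  move=> [M [_ /(_ (M + 1))]]; rewrite ltrDl ltr01 => /(_ erefl) h.
  by exists (M + 1) => t It; apply: h; exists t.
move=> t; rewrite in01 => /andP[]; rewrite le_eqVlt => /predU1P[<- _|t0 t1].
  by rewrite /inab set_itv1 Rintegral_set1 addr0.
have := @continuous_FTC2 R u f 0 t t0 (cwu _).
rewrite /inab /Rintegral => ->.
- by rewrite -EFinB /= addrC subrK.
- split.
  + by move=> x _; case: (fu x).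
  + by apply: cvg_at_right_filter; exact: cf.
  + by apply: cvg_at_left_filter; exact: cf.
- by move=> x _; rewrite derive1E; case: (fu x).
Qed.

Lemma derive_near0 (F : R -> R) (t : R) : (\forall x \near t, F x = 0) -> 'D_1 F t = 0.
Proof.
move=> h; rewrite -(derive_cst (0 : R) t (1 : R)).
by apply: near_eq_derive; exact: h.
Qed.

(** Lebesgue differentiation: the primitive of [u - v], extended by 0 outside the interval, has
    derivative [u - v] almost everywhere, and it vanishes identically up to 1. The points 0 and 1
    are discarded so that this vanishing holds on a neighbourhood. *)
Lemma wd_uniq f u v : wd f u -> wd f v -> {ae leb, forall t, I01 t -> u t = v t}.
Proof.
move=> wf wf'; pose w t := u t - v t.
have w1 : L1 w by apply: L1B; [exact: wd_L1 wf|exact: wd_L1 wf'].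
have w0 t : 0 <= t -> t <= 1 -> inab 0 t w = 0.
  move=> t0 t1; rewrite inabB//; [|exact: wd_L1 wf|exact: wd_L1 wf'].
  by rewrite -(wd_incr wf)// -(wd_incr wf')// subrr.
pose wI := w \_ I01.
have iwI : leb.-integrable setT (EFin \o wI).
  by rewrite /wI -restrict_EFin; apply/integrable_restrict; [exact: mI01|by []|rewrite setTI].
have iy y : leb.-integrable [set` Interval (BLeft 0) (BRight y)] (EFin \o wI).
  by apply: integrableS iwI.
have := @FTC1 R wI (BLeft 0) iy (integrable_locally mI01 w1).
set F := fun x => _.
have F0 x : 0 <= x -> x <= 1 -> F x = 0.
  move=> x0 x1; rewrite -(w0 x x0 x1); apply: inab_ext => s /andP[s0 sx].
  by rewrite /wI patchE mem_set//= in_itv/= s0 (le_trans sx).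
have nz c : {ae leb, forall x, x != c}.
  exists [set c]; split; [exact: measurable_set1|exact: lebesgue_measure_set1|].
  by move=> x /= /negP; rewrite negbK => /eqP.
move=> h; apply: (@filterS3 _ _ (ae_filter_ringOfSetsType leb) _ _ _ _ _ h (nz 1) (nz 0)) => t ht t1 t00 It.
have := It; rewrite in01 => /andP[t0 tle1].
have {t1}t1 : t < 1 by rewrite lt_neqAle t1.
have {}t0 : 0 < t by rewrite lt_neqAle eq_sym t00.
move: ht; rewrite /= lte_fin t0 => /(_ isT)[_].
rewrite /wI patchE mem_set// derive1E => Fw.
apply/eqP; rewrite -subr_eq0 -/(w t) -Fw.
apply/eqP/derive_near0; near=> x.
have x1 : x <= 1 by apply: ltW; near: x; exact: lt_nbhsl.
have [x0|x0] := leP 0 x; first exact: F0.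
by rewrite /F set_itv_ge ?Rintegral_set0// bnd_simp -ltNge.
Unshelve. all: by end_near. Qed.

Lemma wd_ing f u : wd f u -> ing u = f 1 - f 0.
Proof. by move=> wf; rewrite -inab01 -(wd_incr wf). Qed.

(** On the circle, [s] and [t] cut two arcs of lengths [l] and [1 - l]. Cauchy-Schwarz on each arc,
    weighted by [1 - l] and [l], bounds the squared difference by [l * (1 - l)] times the total
    energy, and [l * (1 - l) <= 1/4]. *)
Lemma wd_osc f u s t : wd f u -> f 0 = f 1 -> I01 s -> I01 t ->
  (f t - f s) ^+ 2 <= 4^-1 * ing (fun x => u x ^+ 2).
Proof.
move=> wf f01; wlog st : s t / s <= t => [hw|].
  move=> Is It; have [st|ts] := leP s t; first exact: hw.
  by rewrite -sqrrN opprB hw// ltW.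
rewrite !in01 => /andP[s0 s1] /andP[t0 t1].
have u2 : L1 (fun x => u x ^+ 2) by case: wf => -[].
rewrite -inab01 (inab_split (lexx 0) s0 s1 (lexx 1) u2) (inab_split s0 st t1 (lexx 1) u2).
have := wd_holder wf (lexx 0) s0 s1; have := wd_holder wf s0 st t1.
have := wd_holder wf t0 t1 (lexx 1).
rewrite -f01; move: (f s) (f t) (f 0) => y z x.
have V0 a b : 0 <= inab a b (fun t => u t ^+ 2) by apply: inab_ge0 => r _; exact: sqr_ge0.
move: (V0 0 s) (V0 s t) (V0 t 1).
move: (inab 0 s _) (inab s t _) (inab t 1 _) => V1 V2 V3 V10 V20 V30 h3 h2 h1.
(* The arc through the base point, made of [[t, 1]] and [[0, s]], which periodicity joins. *)
have h13 : ((y - x) + (x - z)) ^+ 2 <= (s + (1 - t)) * (V1 + V3).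
  move: h1 h3; rewrite subr0; set A := y - x; set B := x - z; move=> h1 h3.
  have hAB : 2 * A * B <= s * V3 + (1 - t) * V1.
    apply: (le_trans (ler_norm _)).
    rewrite -[leRHS]ger0_norm; last by rewrite addr_ge0// mulr_ge0// subr_ge0.
    rewrite -ler_sqr ?nnegrE// !real_normK ?num_real//.
    apply: (@le_trans _ _ (4 * ((s * V1) * ((1 - t) * V3)))).
      rewrite (_ : (2 * A * B) ^+ 2 = 4 * (A ^+ 2 * B ^+ 2)); last ring.
      by rewrite ler_wpM2l// ler_pM ?sqr_ge0.
    by have := sqr_ge0 (s * V3 - (1 - t) * V1); nra.
  by nra.
rewrite (_ : _ + _ = - (z - y)) ?sqrrN in h13; last ring.
have : (1 - (t - s)) * ((z - y) ^+ 2) <= (1 - (t - s)) * ((t - s) * V2).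
  by rewrite ler_wpM2l//; lra.
have : (t - s) * ((z - y) ^+ 2) <= (t - s) * ((1 - (t - s)) * (V1 + V3)).
  by rewrite ler_wpM2l//; lra.
have : 4^-1 * (V1 + (V2 + V3)) - (t - s) * (1 - (t - s)) * (V1 + (V2 + V3))
   = (t - s - 2^-1) ^+ 2 * (V1 + (V2 + V3)) by field.
have : 0 <= (t - s - 2^-1) ^+ 2 * (V1 + (V2 + V3)) by rewrite mulr_ge0 ?sqr_ge0 ?addr_ge0.
by lra.
Qed.

(* The sharp constant is [4 * pi ^+ 2]; [8] is what [wd_osc] gives. *)
Lemma wirtinger f u : wd f u -> f 0 = f 1 ->
  8 * (ing (fun t => f t ^+ 2) - ing f ^+ 2) <= ing (fun x => u x ^+ 2).
Proof.
move=> wf f01; have bf := wd_Bm wf.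
set N := ing (fun x => u x ^+ 2); set F2 := ing _; set F := ing f.
(* The bound of [wd_osc] is averaged over [s], then over [t]. The double average of
   [(f t - f s) ^+ 2] is twice the variance, whence the constant 8. *)
have h t : I01 t -> f t ^+ 2 - 2 * f t * F + F2 <= 4^-1 * N.
  move=> It.
  have <- : ing (fun s => (f t - f s) ^+ 2) = f t ^+ 2 - 2 * f t * F + F2.
    rewrite -(ing_cst (f t ^+ 2)) -ingZ; last exact: Bm_L1.
    rewrite -ingB; [|exact: L1_cst|exact: L1Z (Bm_L1 bf)].
    rewrite -ingD; [|apply: L1B; [exact: L1_cst|exact: L1Z (Bm_L1 bf)]|exact: Bm_L1 (BmX 2 bf)].
    by apply: ing_ext => s _; ring.
  rewrite -(ing_cst (4^-1 * N)); apply: ing_le => [||s Is].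
  - by apply/Bm_L1/BmX/BmB => //; exact: Bm_cst.
  - exact: L1_cst.
  - exact: wd_osc.
have : ing (fun t => f t ^+ 2 - 2 * F * f t + F2) <= 4^-1 * N.
  rewrite -(ing_cst (4^-1 * N)); apply: ing_le => [||t It].
  - apply: Bm_L1; apply: BmD; last exact: Bm_cst.
    by apply: BmB; [exact: BmX|exact: BmZ].
  - exact: L1_cst.
  - by have := h t It; lra.
rewrite ingD; [|apply/Bm_L1/BmB; [exact: BmX|exact: BmZ]|exact: L1_cst].
rewrite ingB; [|exact/Bm_L1/BmX|exact/Bm_L1/BmZ].
rewrite ingZ; last exact: Bm_L1.
by rewrite ing_cst -/F2 -/F; lra.
Qed.

(** The Sobolev embedding into bounded functions: compare [f t] with [f s] and average over [s]. *)
Lemma wd_sup f u t : wd f u -> I01 t ->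
  f t ^+ 2 <= 2 * ing (fun s => f s ^+ 2) + 2 * ing (fun s => u s ^+ 2).
Proof.
move=> wf It; have bf := wd_Bm wf.
have u2 : L1 (fun x => u x ^+ 2) by case: wf => -[].
set U := ing (fun s => u s ^+ 2).
have h a b : 0 <= a -> a <= b -> b <= 1 -> (f b - f a) ^+ 2 <= U.
  move=> a0 ab b1; apply: (le_trans (wd_holder wf a0 ab b1)).
  have V0 p q : 0 <= inab p q (fun t => u t ^+ 2) by apply: inab_ge0 => r _; exact: sqr_ge0.
  rewrite -[leRHS]mul1r ler_pM ?subr_ge0//; first by lra.
  rewrite /U -inab01 (inab_split (lexx 0) a0 (le_trans ab b1) (lexx 1) u2).
  by rewrite (inab_split a0 ab b1 (lexx 1) u2); have := V0 0 a; have := V0 b 1; lra.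
have hh s : I01 s -> f t ^+ 2 <= 2 * f s ^+ 2 + 2 * U.
  move: It; rewrite !in01 => /andP[t0 t1] /andP[s0 s1].
  have : (f t - f s) ^+ 2 <= U.
    by have [st|ts] := leP s t; [exact: h|rewrite -sqrrN opprB h// ltW].
  by have := sqr_ge0 (f t - 2 * f s); nra.
rewrite -(ing_cst (f t ^+ 2)) -(ing_cst (2 * U)) -ingZ; last exact/Bm_L1/BmX.
rewrite -ingD; [|exact/L1Z/Bm_L1/BmX|exact: L1_cst].
apply: ing_le => [||s Is]; [exact: L1_cst| |exact: hh].
by apply: L1D; [exact/L1Z/Bm_L1/BmX|exact: L1_cst].
Qed.

End WeakDerivative.

(** * Smooth maps *)

Section Smoothness.
Context {R : realType}.
Implicit Types V W : normedModType R.

Lemma near_eq_differentiable V W (f g : V -> W) (x : V) :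
  (\forall y \near x, f y = g y) -> differentiable f x -> differentiable g x.
Proof.
move=> fg df; have fgx := nbhs_singleton fg.
have fE := diff_locally df.
have h : g \o shift x = cst (g x) + 'd f x +o_ 0 id.
  apply/eqaddoP => e e0; have /eqaddoP/(_ e e0) h := fE.
  have h2 : \forall y \near (0 : V), f (y + x) = g (y + x).
    by move: fg; rewrite (near_shift 0); apply: filterS => y; rewrite /= subr0.
  near=> y.
  suff -> : (g \o shift x - (cst (g x) + 'd f x)) y = (f \o shift x - (cst (f x) + 'd f x)) y.
    by near: y.
  rewrite !fctE /= fgx; congr (_ - _); apply/esym; by near: y.
apply/diff_locallyP; have cd := diff_continuous df.
by rewrite (diff_unique cd h).
Unshelve. all: by end_near. Qed.

Lemma Ck_ext V W (U : set V) n (f g : V -> W) : open U ->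
  (forall x, U x -> f x = g x) -> Ck_on U n f -> Ck_on U n g.
Proof.
move=> oU; elim: n f g => [|n ih] f g fg.
  move=> cf x Ux; rewrite /prop_for /continuous_at -(fg x Ux).
  apply: cvg_trans (cf x Ux); apply: near_eq_cvg.
  by apply: filterS (open_nbhs_nbhs (conj oU Ux)) => y Uy; rewrite fg.
have nfg x : U x -> \forall y \near x, f y = g y.
  by move=> Ux; apply: filterS (open_nbhs_nbhs (conj oU Ux)) => y Uy; rewrite fg.
move=> [df Df]; split; last first.
  move=> v; apply: (ih _ _ _ (Df v)) => x Ux; apply: near_eq_derive; exact: nfg.
by move=> x Ux; apply: near_eq_differentiable (df x Ux); exact: nfg.
Qed.

Lemma Ck_le V W (U : set V) n (f : V -> W) : Ck_on U n.+1 f -> Ck_on U n f.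
Proof.
elim: n f => [|n ih] f [df Df]; first by move=> x /df/differentiable_continuous.
by split=> // v; apply: ih; exact: Df.
Qed.

Lemma Ck_cst V W (U : set V) n (c : W) : Ck_on U n (fun _ => c).
Proof.
elim: n c => [|n ih] c; first by move=> x _; exact: cst_continuous.
split; first by move=> x _; exact: differentiable_cst.
by move=> v; under eq_fun do rewrite derive_cst; exact: ih.
Qed.

Lemma smooth_cst V W (U : set V) (c : W) : smooth_on U (fun _ => c).
Proof. by move=> n; exact: Ck_cst. Qed.

Lemma CkD V W (U : set V) n (f g : V -> W) : open U ->
  Ck_on U n f -> Ck_on U n g -> Ck_on U n (fun x => f x + g x).
Proof.
move=> oU; elim: n f g => [|n ih] f g.
  by move=> cf cg x Ux; apply: cvgD; [exact: cf|exact: cg].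
move=> [df Df] [dg Dg]; split.
  by move=> x Ux; apply: differentiableD; [exact: df|exact: dg].
move=> v; apply: (Ck_ext oU _ (ih _ _ (Df v) (Dg v))) => x Ux.
by rewrite deriveD//; apply: diff_derivable; [exact: df|exact: dg].
Qed.

Lemma CkM V (U : set V) n (f g : V -> R) : open U ->
  Ck_on U n f -> Ck_on U n g -> Ck_on U n (fun x => f x * g x).
Proof.
move=> oU; elim: n f g => [|n ih] f g.
  by move=> cf cg x Ux; apply: cvgM; [exact: cf|exact: cg].
move=> hf hg; have [df Df] := hf; have [dg Dg] := hg; split.
  by move=> x Ux; apply: differentiableM; [exact: df|exact: dg].
move=> v; have := CkD oU (ih _ _ (Ck_le hf) (Dg v)) (ih _ _ (Ck_le hg) (Df v)).
apply: Ck_ext => // x Ux.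
by rewrite deriveM//; apply: diff_derivable; [exact: df|exact: dg].
Qed.

Lemma smoothD V W (U : set V) (f g : V -> W) : open U ->
  smooth_on U f -> smooth_on U g -> smooth_on U (fun x => f x + g x).
Proof. by move=> oU sf sg n; exact: CkD. Qed.

Lemma smoothM V (U : set V) (f g : V -> R) : open U ->
  smooth_on U f -> smooth_on U g -> smooth_on U (fun x => f x * g x).
Proof. by move=> oU sf sg n; exact: CkM. Qed.

Lemma smoothN V (U : set V) (f : V -> R) : open U ->
  smooth_on U f -> smooth_on U (fun x => - f x).
Proof.
move=> oU sf; have := smoothM oU (smooth_cst U (-1 : R)) sf.
by under eq_fun do rewrite mulN1r.
Qed.

Lemma smoothB V (U : set V) (f g : V -> R) : open U ->
  smooth_on U f -> smooth_on U g -> smooth_on U (fun x => f x - g x).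
Proof. by move=> oU sf sg; apply: smoothD => //; exact: smoothN. Qed.

Lemma smooth_linear V W (U : set V) (f : {linear V -> W}) : continuous f -> smooth_on U f.
Proof.
move=> cf [|n]; first by move=> x _; exact: cf.
split=> [x _|v]; first exact: linear_differentiable.
rewrite (_ : 'D_v f = fun=> f v); first exact: Ck_cst.
apply/funext => x; rewrite deriveE ?diff_lin//.
exact: linear_differentiable.
Qed.

Lemma smooth_coord n (U : set 'rV[R]_n) (i : 'I_n) : smooth_on U (fun q => q 0 i : R).
Proof.
have @f : {linear 'rV[R]_n -> R}.
  by exists (fun N : 'rV[R]_n => N 0 i); do 2![eexists]; do ?[constructor];
     rewrite ?mxE// => ? *; rewrite ?mxE//; move=> ?; rewrite !mxE.
by apply: (@smooth_linear _ _ U f); exact: coord_continuous.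
Qed.

Lemma smooth_fst V W (U : set (V * W)) : smooth_on U fst.
Proof. by apply: (@smooth_linear _ _ U fst); move=> x; exact: cvg_fst. Qed.

Lemma smooth_snd V W (U : set (V * W)) : smooth_on U snd.
Proof. by apply: (@smooth_linear _ _ U snd); move=> x; exact: cvg_snd. Qed.

Lemma linear_scalar (L : {linear R -> R}) (a : R) : L a = a * L 1.
Proof. by rewrite -[in LHS](mulr1 a) -[a * 1]/(a *: (1 : R)) linearZ. Qed.

Lemma Ck_comp V (U : set V) (A : set R) n (phi : R -> R) (g : V -> R) : open U ->
  smooth_on A phi -> (forall x, U x -> A (g x)) -> Ck_on U n g ->
  Ck_on U n (fun x => phi (g x)).
Proof.
move=> oU + gA; elim: n phi => [|n ih] phi sphi hg.
  by move=> x Ux; apply: continuous_comp; [exact: hg|exact: (sphi 0%N _ (gA _ Ux))].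
have [dphi _] := sphi 1%N; have [dg Dg] := hg; split.
  by move=> x Ux; apply: differentiable_comp; [exact: dg|exact: dphi (gA _ Ux)].
move=> v.
have sd : smooth_on A ('D_1 phi) by move=> m; have [_ /(_ 1)] := sphi m.+1.
have := CkM oU (Dg v) (ih _ sd (Ck_le hg)).
apply: Ck_ext => // x Ux.
have df : differentiable phi (g x) := dphi _ (gA _ Ux).
have dgx := dg _ Ux.
rewrite [RHS](_ : _ = 'd (phi \o g) x v); last by rewrite -deriveE//; exact: differentiable_comp.
rewrite diff_comp// (deriveE v dgx) (deriveE (1 : R) df) /=.
exact/esym/(linear_scalar ('d phi (g x))).
Qed.

Lemma smooth_comp V (U : set V) (A : set R) (phi : R -> R) (g : V -> R) : open U ->
  smooth_on A phi -> (forall x, U x -> A (g x)) -> smooth_on U g ->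
  smooth_on U (fun x => phi (g x)).
Proof. by move=> oU sA UA sg n; exact: Ck_comp (sg n). Qed.

Lemma smooth_ext V W (U : set V) (f g : V -> W) : open U ->
  (forall x, U x -> f x = g x) -> smooth_on U f -> smooth_on U g.
Proof. by move=> oU fg sf n; exact: Ck_ext (sf n). Qed.

Lemma smooth_mx V (U : set V) m n (f : V -> 'M[R]_(m, n)) : open U ->
  (forall i j, smooth_on U (fun x => f x i j : R)) -> smooth_on U f.
Proof.
move=> oU sf k.
have df (g : V -> 'M[R]_(m, n)) : (forall i j, smooth_on U (fun x => g x i j : R)) ->
    forall x, U x -> differentiable g x.
  move=> sg x Ux.
  rewrite (_ : g = \sum_i (\sum_j (fun x => g x i j *: delta_mx i j))); last first.
    apply/funext => y; rewrite [LHS]matrix_sum_delta fct_sumE; apply: eq_bigr => i _.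
    by rewrite fct_sumE.
  apply: differentiable_sum => i; apply: differentiable_sum => j.
  by apply: differentiableZl; have [/(_ _ Ux)] := sg i j 1%N.
elim: k f sf => [|k ih] f sf.
  by move=> x Ux; apply/differentiable_continuous/df.
split=> [|v]; first exact: df.
apply: (Ck_ext oU _ (ih (fun x => \matrix_(i, j) 'D_v (fun t => f t i j) x) _)).
  by move=> x Ux; rewrite derive_mx//; apply: diff_derivable; exact: df.
move=> i j p; under eq_fun do rewrite mxE.
by have [_ /(_ v)] := sf i j p.+1.
Qed.

Lemma derive_pair V W W' (f : V -> W) (g : V -> W') x v :
  derivable f x v -> derivable g x v ->
  is_derive x v (fun y => (f y, g y)) ('D_v f x, 'D_v g x).
Proof.
move=> df dg.
have h : h^-1 *: ((f (h *: v + x), g (h *: v + x)) - (f x, g x)) @[h --> 0^'] -->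
    ('D_v f x, 'D_v g x).
  exact: (cvg_pair df dg).
by split; [apply/cvg_ex; eexists; exact: h|exact: cvg_lim h].
Qed.

Lemma smooth_pair V W W' (U : set V) (f : V -> W) (g : V -> W') : open U ->
  smooth_on U f -> smooth_on U g -> smooth_on U (fun x => (f x, g x)).
Proof.
move=> oU sf sg n; elim: n f g sf sg => [|n ih] f g sf sg.
  by move=> x Ux; apply: cvg_pair; [exact: (sf 0%N)|exact: (sg 0%N)].
have [df _] := sf 1%N; have [dg _] := sg 1%N; split.
  by move=> x Ux; apply: differentiable_pair; [exact: df|exact: dg].
move=> v; apply: (Ck_ext oU _ (ih ('D_v f) ('D_v g) _ _)).
- move=> x Ux; have dfx := @diff_derivable _ _ _ _ _ v (df _ Ux); have dgx := @diff_derivable _ _ _ _ _ v (dg _ Ux).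
  by have [_ ->] := derive_pair dfx dgx.
- by move=> p; have [_ /(_ v)] := sf p.+1.
- by move=> p; have [_ /(_ v)] := sg p.+1.
Qed.

Lemma Ck_derive (A : set R) n (f df : R -> R) : open A ->
  (forall x, A x -> is_derive x (1 : R) f (df x)) -> Ck_on A n df -> Ck_on A n.+1 f.
Proof.
move=> oA fdf cdf; split.
  by move=> x /fdf[? _]; exact/derivable1_diffP.
move=> v; apply: (Ck_ext oA _ (CkM oA (Ck_cst A n v) cdf)) => x Ax.
have [dfx dfE] := fdf x Ax; have d := (derivable1_diffP _ _).1 dfx.
rewrite (deriveE v d) -dfE (deriveE (1 : R) d).
exact/esym/(linear_scalar ('d f x)).
Qed.

(** Bootstrap: if [f' = F(f)] and composing with [F] preserves C^n, each step gains one derivative.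
    It serves for the inverse, the square root and [radius], whose derivatives are expressed through
    the functions themselves. *)
Lemma smooth_ode (A : set R) (f F : R -> R) : open A -> {in A, continuous f} ->
  (forall x, A x -> is_derive x (1 : R) f (F (f x))) ->
  (forall n, Ck_on A n f -> Ck_on A n (fun x => F (f x))) -> smooth_on A f.
Proof.
move=> oA cf fF h; elim=> [|n ih]; first by move=> x /mem_set /cf.
by apply: (Ck_derive oA fF); exact: h.
Qed.

Lemma derive_continuous (f : R -> R) x l : is_derive x (1 : R) f l -> {for x, continuous f}.
Proof. by move=> [/derivable1_diffP/differentiable_continuous]. Qed.

Lemma smooth_sin_cos n : Ck_on [set: R] n (@sin R) /\ Ck_on [set: R] n (@cos R).
Proof.
elim: n => [|n [ihs ihc]].
  by split=> x _; [exact: continuous_sin|exact: continuous_cos].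
split; first by apply: (Ck_derive openT _ ihc) => x _; exact: is_derive_sin.
apply: (Ck_derive openT (df := fun x => -1 * sin x)).
  by move=> x _; rewrite mulN1r; exact: is_derive_cos.
by apply: CkM ihs; [exact: openT|exact: Ck_cst].
Qed.

Lemma smooth_inv : smooth_on [set x : R | 0 < x] (@GRing.inv R).
Proof.
have oA : open [set x : R | 0 < x] by exact: open_gt.
apply: (@smooth_ode _ _ (fun x => -1 * (x * x))) => //.
- by move=> x /set_mem /= x0; apply: inv_continuous; rewrite lt0r_neq0.
- move=> x /= x0; apply: is_derive_eq; first by apply: is_deriveV; exact: lt0r_neq0.
  by rewrite /GRing.scale /= mulr1 mulN1r -invfM -expr2.
- by move=> n hf; exact: (CkM oA (Ck_cst _ _ (-1 : R)) (CkM oA hf hf)).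
Qed.

Lemma smooth_sqrt : smooth_on [set x : R | 0 < x] (@Num.sqrt R).
Proof.
have oA : open [set x : R | 0 < x] by exact: open_gt.
apply: (@smooth_ode _ _ (fun x => (2 * x)^-1)) => //.
- by move=> x _; exact: sqrt_continuous.
- move=> n hf; apply: (Ck_comp oA smooth_inv) => [x /= x0|].
    by rewrite mulr_gt0// sqrtr_gt0.
  exact: (CkM oA (Ck_cst _ _ (2 : R)) hf).
Qed.

Lemma smooth_sin : smooth_on [set: R] (@sin R).
Proof. by move=> n; have [] := smooth_sin_cos n. Qed.

Lemma smooth_cos : smooth_on [set: R] (@cos R).
Proof. by move=> n; have [] := smooth_sin_cos n. Qed.

End Smoothness.

(** * The metric and the magnetic form *)

Section Geometry.
Context {R : realType}.
Local Notation E := 'rV[R]_3.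
Implicit Types (q p u v : E) (a b c : R).

Definition o0 : 'I_3 := @Ordinal 3 0 isT.
Definition o1 : 'I_3 := @Ordinal 3 1 isT.
Definition o2 : 'I_3 := @Ordinal 3 2 isT.

Definition vec a b c : E := \row_i nth 0 [:: a; b; c] i.

Lemma vec0 a b c : vec a b c 0 o0 = a. Proof. by rewrite mxE. Qed.
Lemma vec1 a b c : vec a b c 0 o1 = b. Proof. by rewrite mxE. Qed.
Lemma vec2 a b c : vec a b c 0 o2 = c. Proof. by rewrite mxE. Qed.
Definition vecE := (vec0, vec1, vec2).

Lemma sum3 (V : nmodType) (F : 'I_3 -> V) : \sum_(i < 3) F i = F o0 + F o1 + F o2.
Proof.
by rewrite !big_ord_recl big_ord0 addr0 addrA; congr (F _ + F _ + F _); exact/val_inj.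
Qed.

Lemma ord3P (P : 'I_3 -> Prop) : P o0 -> P o1 -> P o2 -> forall i, P i.
Proof.
move=> P0 P1 P2 [[|[|[|//]]] h].
- by rewrite (_ : Ordinal h = o0)//; exact/val_inj.
- by rewrite (_ : Ordinal h = o1)//; exact/val_inj.
- by rewrite (_ : Ordinal h = o2)//; exact/val_inj.
Qed.

Lemma ext3 u v : u 0 o0 = v 0 o0 -> u 0 o1 = v 0 o1 -> u 0 o2 = v 0 o2 -> u = v.
Proof. by move=> h0 h1 h2; apply/rowP; apply: ord3P. Qed.

Lemma dotE u v : dot u v = u 0 o0 * v 0 o0 + u 0 o1 * v 0 o1 + u 0 o2 * v 0 o2.
Proof. by rewrite /dot sum3. Qed.

Definition round_metric (q : E) : 'M[R]_3 := 1%:M.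

Definition magnetic (q : E) : 'M[R]_3 :=
  \matrix_(i, j) (q 0 o2 ^+ 2 * (((i == o1) && (j == o0))%:R - ((i == o0) && (j == o1))%:R)).

(** The differential of [h(rho) (x dy - y dx)] is [2 (rho h)' dx /\ dy]. Requiring
    [2 (rho h)' = rho - 1], which is [- z^2] on the sphere, with [h] regular at [rho = 0], gives
    [h = rho / 4 - 1/2]. *)
Definition potential (q : E) : E :=
  let w := 4^-1 * (q 0 o0 * q 0 o0 + q 0 o1 * q 0 o1) - 2^-1 in
  vec (- (w * q 0 o1)) (w * q 0 o0) 0.

Lemma bil_round q u v : bil round_metric q u v = dot u v.
Proof. by rewrite /bil mulmx1 !mxE; apply: eq_bigr => i _; rewrite mxE. Qed.

Lemma bil_magnetic q u v : bil magnetic q u v =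
  q 0 o2 ^+ 2 * (u 0 o1 * v 0 o0 - u 0 o0 * v 0 o1).
Proof. by rewrite /bil !mxE sum3 !mxE !sum3 !mxE /=; ring. Qed.

Lemma dot_ge0 u : 0 <= dot u u.
Proof. by rewrite dotE -!expr2 !addr_ge0// sqr_ge0. Qed.

Lemma dot_gt0 u : u != 0 -> 0 < dot u u.
Proof.
rewrite lt_neqAle dot_ge0 andbT; apply: contraNneq => /esym; rewrite dotE => h.
have := sqr_ge0 (u 0 o0); have := sqr_ge0 (u 0 o1); have := sqr_ge0 (u 0 o2) => h2 h1 h0.
have e0 : u 0 o0 ^+ 2 = 0 by nra.
have e1 : u 0 o1 ^+ 2 = 0 by nra.
have e2 : u 0 o2 ^+ 2 = 0 by nra.
by apply/eqP/ext3; rewrite mxE; apply/eqP; rewrite -sqrf_eq0; apply/eqP.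
Qed.

Lemma dotC u v : dot u v = dot v u.
Proof. by rewrite !dotE; ring. Qed.

Lemma dot_CS u v : dot u v ^+ 2 <= dot u u * dot v v.
Proof.
rewrite !dotE -subr_ge0.
set x := u 0 o0; set y := u 0 o1; set z := u 0 o2.
set x' := v 0 o0; set y' := v 0 o1; set z' := v 0 o2.
rewrite (_ : _ - _ = (x * y' - y * x') ^+ 2 + (x * z' - z * x') ^+ 2 + (y * z' - z * y') ^+ 2).
  by rewrite !addr_ge0// sqr_ge0.
by ring.
Qed.

Lemma round_metricP : riemannian_metric round_metric.
Proof.
split; first exact: smooth_cst.
move=> q _; split=> [u v _ _|u _ u0]; rewrite !bil_round; first exact: dotC.
exact: dot_gt0.
Qed.

Lemma magnetic_two_form : two_form magnetic.
Proof.
split.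
  apply: smooth_mx; first exact: openT.
  move=> i j; under eq_fun do rewrite mxE expr2.
  apply: smoothM; [exact: openT| |exact: smooth_cst].
  by apply: smoothM; [exact: openT|exact: smooth_coord..].
by move=> q _ u v _ _; rewrite !bil_magnetic; ring.
Qed.

Lemma is_derive_linear (V W : normedModType R) (f : {linear V -> W}) (x v : V) :
  continuous f -> is_derive x v f (f v).
Proof.
move=> cf; have df : differentiable f x by exact: linear_differentiable.
by split; [exact: diff_derivable|rewrite deriveE// diff_lin].
Qed.

Global Instance is_derive_coord n (q v : 'rV[R]_n) i :
  is_derive q v (fun q : 'rV[R]_n => q 0 i : R) (v 0 i).
Proof.
have @f : {linear 'rV[R]_n -> R}.
  by exists (fun N : 'rV[R]_n => N 0 i); do 2![eexists]; do ?[constructor];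
     rewrite ?mxE// => ? *; rewrite ?mxE//; move=> ?; rewrite !mxE.
by apply: (@is_derive_linear _ _ f); exact: coord_continuous.
Qed.

Lemma potential_one_form : one_form potential.
Proof.
split.
  apply: smooth_mx; first exact: openT.
  have sc i : smooth_on setT (fun q : E => q 0 i : R) by exact: smooth_coord.
  have sw : smooth_on setT (fun q : E => 4^-1 * (q 0 o0 * q 0 o0 + q 0 o1 * q 0 o1) - 2^-1 : R).
    apply: smoothB; [exact: openT| |exact: smooth_cst].
    apply: smoothM; [exact: openT|exact: smooth_cst|].
    by apply: smoothD; [exact: openT| |]; apply: smoothM => //; exact: openT.
  move=> i; apply: ord3P; rewrite ord1 /potential.
  - under eq_fun do rewrite vec0.
    by apply: smoothN; [exact: openT|apply: smoothM; [exact: openT| |]].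
  - by under eq_fun do rewrite vec1; apply: smoothM; [exact: openT| |].
  - by under eq_fun do rewrite vec2; exact: smooth_cst.
by move=> q Sq; split => //=; rewrite /tangent /= dotE !vecE; ring.
Qed.

Lemma potential_primitive : primitive potential magnetic.
Proof.
move=> q Sq u v Tu Tv; rewrite bil_magnetic.
have [dpot _] := potential_one_form.1 1%N.
have dE w i : ('D_w potential q) 0 i = 'D_w (fun q => potential q 0 i) q.
  by rewrite derive_mx ?mxE//; apply: diff_derivable; exact: dpot.
have D0 w : is_derive q w (fun q : E => vec (- ((4^-1 * (q 0 o0 * q 0 o0 + q 0 o1 * q 0 o1) - 2^-1) * q 0 o1))
   ((4^-1 * (q 0 o0 * q 0 o0 + q 0 o1 * q 0 o1) - 2^-1) * q 0 o0) 0 0 o0 : R)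
   (- ((4^-1 * (2 * q 0 o0 * w 0 o0 + 2 * q 0 o1 * w 0 o1)) * q 0 o1 +
    (4^-1 * (q 0 o0 * q 0 o0 + q 0 o1 * q 0 o1) - 2^-1) * w 0 o1)).
  under eq_fun do rewrite vec0.
  by apply: is_derive_eq; rewrite /GRing.scale/=; ring.
have D1 w : is_derive q w (fun q : E => vec (- ((4^-1 * (q 0 o0 * q 0 o0 + q 0 o1 * q 0 o1) - 2^-1) * q 0 o1))
   ((4^-1 * (q 0 o0 * q 0 o0 + q 0 o1 * q 0 o1) - 2^-1) * q 0 o0) 0 0 o1 : R)
   (((4^-1 * (2 * q 0 o0 * w 0 o0 + 2 * q 0 o1 * w 0 o1)) * q 0 o0 +
    (4^-1 * (q 0 o0 * q 0 o0 + q 0 o1 * q 0 o1) - 2^-1) * w 0 o0)).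
  under eq_fun do rewrite vec1.
  by apply: is_derive_eq; rewrite /GRing.scale/=; ring.
have D2 w : is_derive q w (fun q : E => vec (- ((4^-1 * (q 0 o0 * q 0 o0 + q 0 o1 * q 0 o1) - 2^-1) * q 0 o1))
   ((4^-1 * (q 0 o0 * q 0 o0 + q 0 o1 * q 0 o1) - 2^-1) * q 0 o0) 0 0 o2 : R) 0.
  by under eq_fun do rewrite vec2; exact: is_derive_cst.
have Dpot w : 'D_w potential q =
   vec (- ((4^-1 * (2 * q 0 o0 * w 0 o0 + 2 * q 0 o1 * w 0 o1)) * q 0 o1 +
    (4^-1 * (q 0 o0 * q 0 o0 + q 0 o1 * q 0 o1) - 2^-1) * w 0 o1))
   (((4^-1 * (2 * q 0 o0 * w 0 o0 + 2 * q 0 o1 * w 0 o1)) * q 0 o0 +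
    (4^-1 * (q 0 o0 * q 0 o0 + q 0 o1 * q 0 o1) - 2^-1) * w 0 o0)) 0.
  apply: ext3; rewrite vecE (dE w).
  - by have [_] := D0 w.
  - by have [_] := D1 w.
  - by have [_] := D2 w.
rewrite !Dpot !dotE !vecE.
move: Sq; rewrite /sphere /= dotE => /(canRL (addKr _)).
rewrite addrC -expr2 => ->.
by field.
Qed.

Lemma magnetic_exact : exact_two_form magnetic.
Proof.
split; first exact: magnetic_two_form.
by exists potential; split; [exact: potential_one_form|exact: potential_primitive].
Qed.

(** Cauchy-Schwarz bounds the supremum, and it is attained at [p] divided by its norm, or at 0 when
    [p = 0]. *)
Lemma conorm_round q p : tangent q p -> conorm round_metric q p = Num.sqrt (dot p p).
Proof.
move=> Tp; rewrite /conorm; set S := (X in sup X).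
have ubS : ubound S (Num.sqrt (dot p p)).
  move=> r [v [Tv]]; rewrite bil_round => vv <-.
  apply: le_trans (ler_norm _) _; rewrite -sqrtr_sqr ler_wsqrtr//.
  by apply: le_trans (dot_CS _ _) _; rewrite ler_piMr// dot_ge0.
apply/eqP; rewrite eq_le; apply/andP; split.
  apply: ge_sup => //; exists 0; exists 0; last by rewrite dotE !mxE; ring.
  by split; rewrite ?bil_round /tangent/= dotE !mxE; [ring|rewrite !mulr0 !addr0].
have [p0|p0] := eqVneq p 0.
  apply: ub_le_sup; first by exists (Num.sqrt (dot p p)); move: ubS; rewrite /S p0.
  rewrite p0 (_ : dot 0 0 = 0) ?sqrtr0; last by rewrite dotE !mxE; ring.
  exists 0; last by rewrite dotE !mxE; ring.
  by split; rewrite ?bil_round /tangent/= dotE !mxE; [ring|rewrite !mulr0 !addr0].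
apply: ub_le_sup; first by exists (Num.sqrt (dot p p)).
set n := Num.sqrt (dot p p).
have n0 : 0 < n by rewrite sqrtr_gt0 dot_gt0.
have nn : n * n = dot p p by rewrite -expr2 sqr_sqrtr ?dot_ge0.
exists (n^-1 *: p).
  split; first by rewrite /tangent/= dotE !mxE; move: Tp; rewrite /tangent/= dotE => h;
    rewrite -[RHS](mulr0 n^-1) -h; ring.
  rewrite bil_round (_ : dot _ _ = n^-1 * n^-1 * dot p p); last by rewrite !dotE !mxE; ring.
  by rewrite -nn mulrACA !mulVf ?mul1r// lt0r_neq0.
rewrite (_ : dot _ _ = n^-1 * dot p p); last by rewrite !dotE !mxE; ring.
by rewrite -nn mulKf// lt0r_neq0.
Qed.

Lemma hamiltonian_round x : cotangent_bundle x -> hamiltonian round_metric x = 2^-1 * dot x.2 x.2.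
Proof.
by move=> [_ Tp]; rewrite /hamiltonian conorm_round// sqr_sqrtr// dot_ge0.
Qed.

Lemma mane_le : mane_critical_value round_metric magnetic <= 20^-1.
Proof.
rewrite /mane_critical_value; set S := (X in inf X).
apply: (@le_trans _ _ (sup [set hamiltonian round_metric (q, potential q) | q in sphere])).
  apply: ge_inf.
    exists 0 => _ [theta _ <-].
    have [[[x Ax] hs]|hs] := pselect (has_sup [set hamiltonian round_metric (q, theta q) | q in sphere]).
      apply: le_trans (ub_le_sup hs Ax); case: Ax => q _ <-.
      by rewrite mulr_ge0 ?invr_ge0// sqr_ge0.
    (* The supremum of an unbounded set is 0 by convention, so 0 is a lower bound for these
       primitives too. *)
    by rewrite sup_out.
  by exists potential => //; split; [exact: potential_one_form|exact: potential_primitive].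
apply: ge_sup.
  exists (hamiltonian round_metric (vec 0 0 1, potential (vec 0 0 1))); exists (vec 0 0 1) => //.
  by rewrite /sphere /= dotE !vecE; ring.
move=> _ [q Sq <-]; rewrite hamiltonian_round; last exact: potential_one_form.2.
rewrite /= dotE /potential !vecE.
move: Sq; rewrite /sphere /= dotE.
move: (q 0 o0) (q 0 o1) (q 0 o2) => x y z h.
have : x * x + y * y <= 1 by have := sqr_ge0 z; rewrite expr2; lra.
have : 0 <= x * x + y * y by rewrite -!expr2 addr_ge0 ?sqr_ge0.
set rho := x * x + y * y => r0 r1.
rewrite (_ : 2^-1 * _ = 32^-1 * (rho * (2 - rho) ^+ 2)); last by rewrite /rho; field.
(* On [[0, 1]] this cubic is largest at [rho = 2/3], with value [32/27]; the rounder bound [32/20]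
   still lies below the energy reached at [r = 4/7]. *)
suff : rho * (2 - rho) ^+ 2 <= 32 / 20 by lra.
have := sqr_ge0 (rho - 2 / 3); have := sqr_ge0 (rho - 2/3 + 1); nra.
Qed.

End Geometry.

(** * Ordinary differential equations *)

Section Monotone.
Context {R : realType}.
Implicit Types (f g df : R -> R) (a b : R).

Lemma derive_ge0_le f df a b : a <= b ->
  (forall x, a <= x <= b -> is_derive x (1 : R) f (df x)) ->
  (forall x, a <= x <= b -> 0 <= df x) -> f a <= f b.
Proof.
move=> ab fdf df0.
have fd x : x \in `]a, b[ -> is_derive x (1 : R) f (df x).
  by rewrite in_itv/= => /andP[/ltW ax /ltW xb]; apply: fdf; rewrite ax xb.
have cf : {within `[a, b], continuous f}.
  apply: derivable_within_continuous => x; rewrite in_itv/= => xab.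
  by have [] := fdf x xab.
have [c cab h] := MVT_segment ab fd cf.
rewrite -subr_ge0 h mulr_ge0 ?subr_ge0// df0//.
Qed.

Lemma derive_eq0_cst f a b : a <= b ->
  (forall x, a <= x <= b -> is_derive x (1 : R) f 0) -> f b = f a.
Proof.
move=> ab f0; apply/eqP; rewrite eq_le; apply/andP; split.
  rewrite -lerN2; apply: (@derive_ge0_le (fun x => - f x) (fun=> 0)) => // x xab.
  by rewrite -oppr0; apply: is_deriveN; exact: f0.
exact: (@derive_ge0_le f (fun=> 0)).
Qed.

(** The function [b t - f t * exp (- a t)] is nondecreasing, since its derivative is at least
    [b * (1 - exp (- a t))]. *)
Lemma gronwall f df a b (T : R) : 0 <= T -> 0 <= b -> 0 <= a ->
  (forall t, 0 <= t <= T -> is_derive t (1 : R) f (df t)) ->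
  (forall t, 0 <= t <= T -> df t <= a * f t + b) ->
  f T <= (f 0 + b * T) * expR (a * T).
Proof.
move=> T0 b0 a0 fdf dfab.
pose h t := b * t - f t * expR (- (a * t)).
pose dh t := b - (df t * expR (- (a * t)) - f t * (a * expR (- (a * t)))).
have : h 0 <= h T.
  apply: (@derive_ge0_le h dh) => // t tT.
    have e1 := fdf t tT; rewrite /h /dh.
    have e2 : is_derive t (1 : R) (fun t => expR (- (a * t))) (- a * expR (- (a * t))).
      by apply: is_derive_eq; rewrite /GRing.scale/=; ring.
    by apply: is_derive_eq; rewrite /GRing.scale/=; ring.
  rewrite /dh; have e0 := expR_gt0 (- (a * t)).
  have e1 : expR (- (a * t)) <= 1.
    by rewrite expR_le1 oppr_le0 mulr_ge0//; case/andP: tT.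
  have := dfab t tT; set e := expR _ in e0 e1 *; move=> h1.
  have : df t * e <= (a * f t + b) * e by rewrite ler_wpM2r// ltW.
  by nra.
rewrite /h !mulr0 oppr0 expR0 mulr1 sub0r => h0.
have h1 : f T * expR (- (a * T)) <= f 0 + b * T by lra.
have := ler_wpM2r (ltW (expR_gt0 (a * T))) h1.
by rewrite -mulrA -expRD addNr expR0 mulr1.
Qed.

(** Comparison with [c / K * (exp (K t) - exp (- K t))], whose derivative is the assumed bound. The
    weight is even so that one estimate covers both directions of time. *)
Lemma growth_bound f df c K : 0 < K -> 0 <= c -> f 0 = 0 ->
  (forall t, is_derive t (1 : R) f (df t)) ->
  (forall t, `|df t| <= c * (expR (K * t) + expR (- (K * t)))) ->
  forall t, `|f t| <= c / K * (expR (K * t) + expR (- (K * t))).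
Proof.
move=> K0 c0 f0 fdf dfc t.
pose g t := c / K * (expR (K * t) - expR (- (K * t))).
have dg t' : is_derive t' (1 : R) g (c * (expR (K * t') + expR (- (K * t')))).
  have e1 : is_derive t' (1 : R) (fun t => expR (- (K * t))) (- K * expR (- (K * t'))).
    by apply: is_derive_eq; rewrite /GRing.scale/=; ring.
  have e2 : is_derive t' (1 : R) (fun t => expR (K * t)) (K * expR (K * t')).
    by apply: is_derive_eq; rewrite /GRing.scale/=; ring.
  by rewrite /g; apply: is_derive_eq; rewrite /GRing.scale/=; field; exact: lt0r_neq0.
have g0 : g 0 = 0 by rewrite /g !mulr0 oppr0 subrr mulr0.
have hp a b : a <= b -> g a + f a <= g b + f b.
  move=> ab; apply: (@derive_ge0_le (fun x => g x + f x) _ _ _ ab).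
  by move=> x _; have := dfc x; rewrite ler_norml => /andP[]; lra.
have hm a b : a <= b -> g a - f a <= g b - f b.
  move=> ab; apply: (@derive_ge0_le (fun x => g x - f x) _ _ _ ab).
  by move=> x _; have := dfc x; rewrite ler_norml => /andP[]; lra.
have gW s : g s <= c / K * (expR (K * s) + expR (- (K * s))).
  rewrite /g; apply: ler_wpM2l; first by rewrite divr_ge0// ltW.
  by have := expR_ge0 (- (K * s)); lra.
have gW' s : - g s <= c / K * (expR (K * s) + expR (- (K * s))).
  rewrite /g -mulrN; apply: ler_wpM2l; first by rewrite divr_ge0// ltW.
  by have := expR_ge0 (K * s); lra.
rewrite ler_norml; have [t0|t0] := leP 0 t.
  have := hp _ _ t0; have := hm _ _ t0; rewrite g0 f0.
  by have := gW t; lra.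
have := hp _ _ (ltW t0); have := hm _ _ (ltW t0); rewrite g0 f0.
by have := gW' t; lra.
Qed.

(** The intervals of radius [2 C / 2^k] around [s k] are nested; [l] is the supremum of their left
    ends. *)
Lemma geometric_limit (s : nat -> R) C :
  (forall k, `|s k.+1 - s k| <= C / 2 ^+ k) -> exists l, forall k, `|l - s k| <= 2 * C / 2 ^+ k.
Proof.
move=> h.
have C0 : 0 <= C by have := h 0%N; rewrite expr0 divr1; exact: le_trans.
pose a k := s k - 2 * C / 2 ^+ k; pose b k := s k + 2 * C / 2 ^+ k.
have e k : 2 * C / 2 ^+ k.+1 = C / 2 ^+ k by rewrite exprS; field; rewrite expf_neq0.
have e' k : 2 * C / 2 ^+ k = C / 2 ^+ k + C / 2 ^+ k by field; rewrite expf_neq0.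
have aS k : a k <= a k.+1.
  by rewrite /a e e'; have := h k; rewrite ler_norml => /andP[]; lra.
have bS k : b k.+1 <= b k.
  by rewrite /b e e'; have := h k; rewrite ler_norml => /andP[]; lra.
have am k m : a k <= a (k + m)%N.
  by elim: m => [|m ih]; rewrite ?addn0// addnS (le_trans ih).
have bm k m : b (k + m)%N <= b k.
  by elim: m => [|m ih]; rewrite ?addn0// addnS (le_trans _ ih).
have ab k m : a k <= b m.
  apply: (le_trans (am k m)); rewrite addnC; apply: le_trans (bm m k).
  have p : 0 <= 2 * C / 2 ^+ (m + k) by rewrite divr_ge0 ?mulr_ge0// exprn_ge0.
  by rewrite /a /b; lra.
exists (sup (range a)) => k.
have S0 : range a !=set0 by exists (a 0%N); exists 0%N.
have h1 : a k <= sup (range a).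
  by apply: ub_le_sup; [exists (b 0%N) => _ [j _ <-]|exists k].
have h2 : sup (range a) <= b k by apply: ge_sup => // _ [j _ <-].
by rewrite ler_norml; move: h1 h2; rewrite /a /b; lra.
Qed.

Lemma le_geometric0 (x C : R) : (forall k, x <= C / 2 ^+ k) -> x <= 0.
Proof.
move=> h; apply: (@archi_le0 _ _ `|C|) => n; apply: (le_trans (h n)).
apply: (@le_trans _ _ (`|C| / 2 ^+ n)).
  by rewrite ler_wpM2r ?invr_ge0 ?exprn_ge0// ler_norm.
rewrite ler_wpM2l// lef_pV2 ?posrE ?exprn_gt0// -natrX ler_nat.
exact: ltn_expl.
Qed.

Lemma exists_primitive f : continuous f ->
  exists G : R -> R, G 0 = 0 /\ forall t, is_derive t (1 : R) G (f t).
Proof.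
move=> cf.
pose J a x := Rintegral (@lebesgue_measure R) `[a, x] f.
have iJ a x : (@lebesgue_measure R).-integrable `[a, x] (EFin \o f).
  apply: continuous_compact_integrable; first exact: segment_compact.
  exact: continuous_subspaceT.
have JD a b c : a <= b -> b <= c -> J a c = J a b + J b c.
  move=> ab bc; apply/eqP; rewrite addrC -subr_eq; apply/eqP.
  rewrite /J Rintegral_itvB//.
  apply: Rintegral_itv_obnd_cbnd; apply: integrableS (iJ b c) => //.
  by move=> x /=; rewrite !in_itv/= => /andP[/ltW -> ->].
have dJ a x : a < x -> is_derive x (1 : R) (J a) (f x).
  move=> ax; have xx1 : x < x + 1 by rewrite ltrDl.
  have [d1 d2] := continuous_FTC1_closed xx1 (iJ a (x + 1)) ax (cf x).
  by split; [exact: d1|rewrite -d2 derive1E].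
exists (fun x => if 0 <= x then J 0 x else - J x 0); split.
  by rewrite lexx /J set_itv1 Rintegral_set1.
(* Seen from a base point to the left of both 0 and [t], the two branches of the formula are one and
   the same integral near [t]. *)
move=> t; pose a := - (`|t| + 1).
have a0 : a < 0 by rewrite oppr_lt0 ltr_wpDl.
have at_ : a < t by rewrite ltrNl; have := ler_norm (- t); rewrite normrN; lra.
have : is_derive t (1 : R) (fun x => J a x - J a 0) (f t).
  have d1 := dJ _ _ at_.
  by apply: is_derive_eq; rewrite subr0.
apply: near_eq_is_derive; near=> x.
have ax : a < x by near: x; exact: lt_nbhsr.
case: ifPn => [x0|]; first by rewrite (JD a 0 x (ltW a0) x0); ring.
by rewrite -ltNge => /ltW x0; rewrite (JD a x 0 (ltW ax) x0); ring.
Unshelve. all: by end_near. Qed.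

End Monotone.

(** * Global solutions for a globally Lipschitz field *)

Section Picard.
Context {R : realType} {n : nat}.
Local Notation V := 'rV[R]_n.
Implicit Types (F : V -> V) (x y : R -> V) (a b : V).

Lemma coord_le_norm a i : `|a 0 i| <= `|a|.
Proof.
rewrite [leRHS]/Num.Def.normr/= mx_normrE.
exact: (le_bigmax _ (fun ij => `|a ij.1 ij.2|) (0, i)).
Qed.

Lemma norm_le_coord a c : 0 <= c -> (forall i, `|a 0 i| <= c) -> `|a| <= c.
Proof.
move=> c0 h; rewrite [leLHS]/Num.Def.normr/= mx_normrE.
by apply: bigmax_le => // -[i j] _ /=; rewrite ord1.
Qed.

Definition solution F x := forall t i,
  is_derive t (1 : R) (fun s => x s 0 i : R) (F (x t) 0 i).

Lemma continuous_lipschitz F K x i : 0 < K ->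
  (forall a b, `|F a - F b| <= K * `|a - b|) ->
  (forall j, continuous (fun t => x t 0 j : R)) -> continuous (fun t => F (x t) 0 i : R).
Proof.
move=> K0 FK cx t; apply/cvgrPdist_le => e e0.
near=> s.
have -> : F (x t) 0 i - F (x s) 0 i = (F (x t) - F (x s)) 0 i by rewrite !mxE.
apply: (le_trans (coord_le_norm _ _)); apply: (le_trans (FK _ _)).
rewrite -ler_pdivlMl//; apply: norm_le_coord; first by rewrite mulr_ge0 ?invr_ge0 ?ltW.
near: s; apply: filter_forall => j.
have /cvgrPdist_le/(_ (K^-1 * e)) := cx j t.
rewrite mulr_gt0 ?invr_gt0// => /(_ erefl); apply: filterS => s.
by rewrite !mxE.
Unshelve. all: by end_near. Qed.

(** Distances between curves are measured relative to the weight [W t = exp (L t) + exp (- L t)]. By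
    [growth_bound] the Picard operator then contracts by [K / L = 1/2] on the whole line at once, so
    no local solutions have to be glued. *)
Lemma picard_lindelof F K (x0 : V) : 0 < K ->
  (forall a b, `|F a - F b| <= K * `|a - b|) ->
  exists x, x 0 = x0 /\ solution F x.
Proof.
move=> K0 FK; have K0' := ltW K0.
pose prim f : R -> R := get [set G : R -> R | G 0 = 0 /\ forall t : R, is_derive t (1 : R) G (f t)].
have primP f : continuous f -> prim f 0 = 0 /\ forall t : R, is_derive t (1 : R) (prim f) (f t).
  move=> cf; apply: (@getPex _ [set G : R -> R | G 0 = 0 /\ forall t : R, is_derive t (1 : R) G (f t)]).
  exact: exists_primitive.
have dcont (f df : R -> R) : (forall t : R, is_derive t (1 : R) f (df t)) -> continuous f.
  by move=> h t; exact: derive_continuous (h t).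
pose it k := iter k (fun x t => x0 + \row_i prim (fun s => F (x s) 0 i) t) (fun=> x0).
pose L := 2 * K; have L0 : 0 < L by rewrite mulr_gt0.
pose W t : R := expR (L * t) + expR (- (L * t)).
have it0 t i : it 0%N t 0 i = x0 0 i by [].
have itS k t i : it k.+1 t 0 i = x0 0 i + prim (fun s => F (it k s) 0 i) t.
  by rewrite /it iterS !mxE.
have cit k j : continuous (fun t => it k t 0 j : R).
  elim: k j => [|k ih] j; first by move=> t; exact: cst_continuous.
  under eq_fun do rewrite itS.
  have cF : continuous (fun s => F (it k s) 0 j) by exact: (continuous_lipschitz K0 FK).
  move=> t; apply: cvgD; first exact: cvg_cst.
  exact: (dcont _ _ (primP _ cF).2).
have cFit k i : continuous (fun s => F (it k s) 0 i) by exact: (continuous_lipschitz K0 FK).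
pose A := `|F x0| / L.
have A0 : 0 <= A by rewrite divr_ge0// ltW.
have W1 t : 1 <= W t.
  by rewrite /W; have := expR_ge1Dx (L * t); have := expR_ge1Dx (- (L * t)); lra.
have W0 t : 0 <= W t by rewrite (le_trans _ (W1 t)).
have diff k t i : `|it k.+1 t 0 i - it k t 0 i| <= A / 2 ^+ k * W t.
  elim: k t i => [|k ih] t i.
    rewrite itS it0 addrAC subrr add0r expr0 divr1 /A.
    have [p0 dp] := primP _ (cFit 0%N i).
    apply: (@growth_bound _ _ (fun=> F x0 0 i)) => // s.
    by rewrite -[leLHS]mulr1 ler_pM// ?coord_le_norm// W1.
  rewrite !itS opprD addrACA subrr add0r.
  have [p0 dp] := primP _ (cFit k i); have [p0' dp'] := primP _ (cFit k.+1 i).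
  rewrite (_ : A / 2 ^+ k.+1 = (K * (A / 2 ^+ k)) / L); last first.
    by rewrite /L exprS; field; rewrite expf_neq0//= lt0r_neq0.
  pose dd t := F (it k.+1 t) 0 i - F (it k t) 0 i.
  apply: (@growth_bound _ (fun t => prim (fun s => F (it k.+1 s) 0 i) t - prim (fun s => F (it k s) 0 i) t) dd) => //.
  - by rewrite mulr_ge0// divr_ge0// exprn_ge0.
  - by rewrite p0 p0' subrr.
  - move=> s; rewrite /dd (_ : _ - _ = (F (it k.+1 s) - F (it k s)) 0 i); last by rewrite !mxE.
    apply: (le_trans (coord_le_norm _ _)); apply: (le_trans (FK _ _)).
    rewrite -mulrA ler_wpM2l//; apply: norm_le_coord.
      by rewrite mulr_ge0// divr_ge0// exprn_ge0.
    by move=> j; have := ih s j; rewrite !mxE.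
have A2 k : 0 <= 2 * A / 2 ^+ k by apply: divr_ge0; [exact: mulr_ge0|exact: exprn_ge0].
have lim t i : exists l : R, forall k, `|l - it k t 0 i| <= 2 * (A * W t) / 2 ^+ k.
  by apply: geometric_limit => k; rewrite mulrAC.
pose x t : V := \row_i get [set l : R | forall k, `|l - it k t 0 i| <= 2 * (A * W t) / 2 ^+ k].
have xP t i k : `|x t 0 i - it k t 0 i| <= 2 * (A * W t) / 2 ^+ k.
  by rewrite mxE; exact: (@getPex _ [set l : R | forall k, `|l - it k t 0 i| <= 2 * (A * W t) / 2 ^+ k] (lim t i) k).
have cW : continuous W.
  move=> t; apply: cvgD; apply: continuous_comp; try exact: continuous_expR.
    by apply: cvgM; [exact: cvg_cst|exact: cvg_id].
  by apply: cvgN; apply: cvgM; [exact: cvg_cst|exact: cvg_id].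
have cx i : continuous (fun t => x t 0 i : R).
  move=> t; apply/cvgrPdist_le => e e0.
  pose C := 2 * (A * (W t + 1)).
  have C0 : 0 <= C by apply: mulr_ge0 => //; apply: mulr_ge0 => //; have := W0 t; lra.
  have [k hk] : exists k, C / 2 ^+ k <= e / 3.
    apply: contrapT => /forallNP h.
    suff : e / 3 <= 0 by rewrite leNgt divr_gt0.
    apply: (@le_geometric0 _ _ C) => k; rewrite ltW// ltNge; exact/negP/h.
  near=> s.
  have Ws : W s <= W t + 1.
    near: s; have /cvgrPdist_le/(_ 1 ltr01) := cW t; apply: filterS => s.
    by rewrite distrC ler_norml => /andP[_]; lra.
  have h1 : `|x t 0 i - it k t 0 i| <= e / 3.
    apply: (le_trans (xP t i k)); apply: (le_trans _ hk); rewrite ler_wpM2r ?invr_ge0 ?exprn_ge0//.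
    by rewrite /C ler_wpM2l// ler_wpM2l// lerDl.
  have h2 : `|x s 0 i - it k s 0 i| <= e / 3.
    apply: (le_trans (xP s i k)); apply: (le_trans _ hk); rewrite ler_wpM2r ?invr_ge0 ?exprn_ge0//.
    by rewrite /C ler_wpM2l// ler_wpM2l.
  have h3 : `|it k t 0 i - it k s 0 i| <= e / 3.
    by near: s; have /cvgrPdist_le/(_ (e / 3)) := cit k i t; apply; rewrite divr_gt0.
  move: h1 h2 h3; rewrite !ler_norml => /andP[a1 a2] /andP[b1 b2] /andP[c1 c2].
  by apply/andP; split; move: a1 a2 b1 b2 c1 c2; clear; lra.
have cFx i : continuous (fun s => F (x s) 0 i) by exact: (continuous_lipschitz K0 FK).
have xE t i : x t 0 i = x0 0 i + prim (fun s => F (x s) 0 i) t.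
  apply/eqP; rewrite -subr_eq0 -normr_le0.
  apply: (@le_geometric0 _ _ (2 * (A * W t))) => k.
  rewrite (_ : _ - _ = (x t 0 i - it k.+1 t 0 i) - (prim (fun s => F (x s) 0 i) t - prim (fun s => F (it k s) 0 i) t)); last first.
    by rewrite itS; ring.
  apply: (le_trans (ler_normB _ _)).
  have h1 := xP t i k.+1.
  have [p0 dp] := primP _ (cFit k i); have [p0' dp'] := primP _ (cFx i).
  have h2 : `|prim (fun s => F (x s) 0 i) t - prim (fun s => F (it k s) 0 i) t| <= (K * (2 * A / 2 ^+ k)) / L * W t.
    pose dd t := F (x t) 0 i - F (it k t) 0 i.
    apply: (@growth_bound _ (fun t => prim (fun s => F (x s) 0 i) t - prim (fun s => F (it k s) 0 i) t) dd) => //.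
    - exact: mulr_ge0.
    - by rewrite p0 p0' subrr.
    - move=> s; rewrite /dd (_ : _ - _ = (F (x s) - F (it k s)) 0 i); last by rewrite !mxE.
      apply: (le_trans (coord_le_norm _ _)); apply: (le_trans (FK _ _)).
      rewrite -mulrA ler_wpM2l//; apply: norm_le_coord.
        exact: mulr_ge0.
      move=> j; rewrite (_ : (x s - it k s) 0 j = x s 0 j - it k s 0 j); last first.
        by rewrite mxE [X in _ + X]mxE.
      by rewrite (_ : 2 * A / 2 ^+ k * W s = 2 * (A * W s) / 2 ^+ k) ?xP//; ring.
  have e1 : 2 * (A * W t) / 2 ^+ k.+1 = A * W t / 2 ^+ k by rewrite exprS; field; rewrite expf_neq0.
  have e2 : K * (2 * A / 2 ^+ k) / L * W t = A * W t / 2 ^+ k.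
    by rewrite /L; field; rewrite expf_neq0//= lt0r_neq0.
  have e3 : 2 * (A * W t) / 2 ^+ k = A * W t / 2 ^+ k + A * W t / 2 ^+ k by field; rewrite expf_neq0.
  by move: h1 h2; rewrite e1 e2 e3; lra.
exists x; split.
  by apply/rowP => i; rewrite xE (primP _ (cFx i)).1 addr0.
move=> t i; under eq_fun do rewrite xE.
have d := (primP _ (cFx i)).2 t.
by have := is_deriveD (is_derive_cst (x0 0 i : R) t (1 : R)) d; rewrite add0r.
Unshelve. all: by end_near. Qed.

End Picard.

(** * Global solutions for a locally Lipschitz field under an a priori bound *)

Section Continuation.
Context {R : realType} {n : nat}.
Local Notation V := 'rV[R]_n.
Implicit Types (F : V -> V) (x y : R -> V) (a b : V).

Lemma first_exit (h : R -> R) (M t : R) : continuous h -> h 0 < M -> 0 <= t -> M <= h t ->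
  exists b : R, [/\ 0 <= b, M <= h b & forall s, 0 <= s <= b -> h s <= M].
Proof.
move=> ch h0 t0 ht.
pose S := [set s : R | 0 <= s /\ M <= h s].
have St : S t by [].
have lS : lbound S 0 by move=> s [].
have hiS : has_inf S by split; [exists t|exists 0].
set b := inf S.
have b0 : 0 <= b by apply: lb_le_inf; [exists t|].
have below s : 0 <= s -> s < b -> h s < M.
  move=> s0 sb; rewrite ltNge; apply/negP => Ms.
  by have := ge_inf hiS.2 (conj s0 Ms : S s); rewrite leNgt sb.
have hb : M <= h b.
  rewrite leNgt; apply/negP => hbM.
  have /cvgrPdist_lt/(_ (M - h b)) := ch b.
  rewrite subr_gt0 => /(_ hbM) /nbhs_ballP[d /= d0 hd].
  suff : b + d <= b by rewrite gerDl leNgt d0.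
  apply: lb_le_inf; first by exists t.
  move=> s [s0 Ms]; rewrite leNgt; apply/negP => sbd.
  have bs : b <= s by exact: (ge_inf hiS.2).
  have : ball b d s by rewrite /ball/= ler0_norm; lra.
  by move=> /hd /=; rewrite ltr_norml => /andP[+ _]; lra.
have hb' : h b <= M.
  rewrite leNgt; apply/negP => hbM.
  have b00 : 0 < b.
    by rewrite lt_neqAle b0 andbT; apply: contraTneq hbM => <-; rewrite -leNgt ltW.
  have /cvgrPdist_lt/(_ (h b - M)) := ch b.
  rewrite subr_gt0 => /(_ hbM) /nbhs_ballP[d /= d0 hd].
  pose s := Num.max 0 (b - d / 2).
  have s0 : 0 <= s by rewrite le_max lexx.
  have sb : s < b by rewrite gt_max b00/=; lra.
  have : ball b d s.
    by rewrite /ball/= ger0_norm; [have : b - d / 2 <= s by rewrite le_max lexx orbT|]; lra.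
  move=> /hd /=; rewrite ltr_norml => /andP[_]; have := below s s0 sb; lra.
exists b; split=> // s /andP[s0]; rewrite le_eqVlt => /predU1P[->//|sb].
exact/ltW/below.
Qed.

Definition clamp (M x : R) := Num.max (- M) (Num.min M x).

Lemma clamp_id (M x : R) : `|x| <= M -> clamp M x = x.
Proof.
by rewrite ler_norml => /andP[h1 h2]; rewrite /clamp (min_idPr h2) (max_idPr h1).
Qed.

Lemma clamp_le (M x : R) : 0 <= M -> `|clamp M x| <= M.
Proof.
move=> M0; rewrite ler_norml /clamp le_max lexx/= ge_max ge_min lexx/= andbT.
by lra.
Qed.

Lemma max_lipschitz (c x y : R) : `|Num.max c x - Num.max c y| <= `|x - y|.
Proof.
have [h1|h1] := leP c x; have [h2|h2] := leP c y => //; last by rewrite subrr normr0.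
  by rewrite !ger0_norm; lra.
by rewrite !ler0_norm; lra.
Qed.

Lemma min_lipschitz (c x y : R) : `|Num.min c x - Num.min c y| <= `|x - y|.
Proof.
have [h1|h1] := leP c x; have [h2|h2] := leP c y => //; first by rewrite subrr normr0.
  by rewrite !ger0_norm; lra.
by rewrite !ler0_norm; lra.
Qed.

Lemma clamp_lipschitz (M x y : R) : `|clamp M x - clamp M y| <= `|x - y|.
Proof. exact: le_trans (max_lipschitz _ _ _) (min_lipschitz _ _ _). Qed.

(** Truncating the coordinates by [clamp] makes the field globally Lipschitz without changing it on
    the ball. The solution of the truncated equation solves the original one as long as it stays in
    the ball, and at a first exit time the last hypothesis is contradicted. The sign [e] runs time
    in either direction. *)
Lemma solution_exists F (M K : R) (x0 : V) : 0 < K -> 0 < M ->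
  (forall a b, `|a| <= M -> `|b| <= M -> `|F a - F b| <= K * `|a - b|) ->
  `|x0| < M ->
  (forall (x : R -> V) (e t : R), `|e| = 1 -> 0 <= t -> x 0 = x0 ->
     (forall s, 0 <= s <= t -> `|x (e * s)| <= M /\
        forall i, is_derive s (1 : R) (fun r => x (e * r) 0 i : R) (e * F (x (e * s)) 0 i)) ->
     `|x (e * t)| < M) ->
  exists x, x 0 = x0 /\ solution F x.
Proof.
move=> K0 M0 FK x0M inv.
pose cl (a : V) : V := \row_i clamp M (a 0 i).
have clM a : `|cl a| <= M by apply: norm_le_coord; [exact: ltW|move=> i; rewrite mxE clamp_le// ltW].
have clid a : `|a| <= M -> cl a = a.
  by move=> aM; apply/rowP => i; rewrite mxE clamp_id// (le_trans (coord_le_norm _ _)).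
have clL a b : `|cl a - cl b| <= `|a - b|.
  apply: norm_le_coord => // i; rewrite !mxE.
  apply: (le_trans (clamp_lipschitz _ _ _)).
  by have := coord_le_norm (a - b) i; rewrite !mxE.
have [x [x0E sx]] := @picard_lindelof R n (F \o cl) K x0 K0
  (fun a b => le_trans (FK _ _ (clM a) (clM b)) (ler_wpM2l (ltW K0) (clL a b))).
exists x; split=> //.
have dx i t : {for t, continuous (fun s => x s 0 i : R)} by exact: derive_continuous (sx t i).
have cn (e : R) : continuous (fun s => `|x (e * s)|).
  move=> s; apply/cvgrPdist_le => d d0; near=> r.
  apply: (le_trans (ler_dist_dist _ _)); apply: norm_le_coord; first exact: ltW.
  near: r; apply: filter_forall => i.
  have : {for s, continuous (fun s => x (e * s) 0 i : R)}.
    apply: (@continuous_comp _ _ _ (fun r => e * r) (fun r => x r 0 i : R)); last exact: dx.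
    by apply: cvgM; [exact: cvg_cst|exact: cvg_id].
  by move=> /cvgrPdist_le/(_ d d0); apply: filterS => r; rewrite !mxE.
have bnd (e : R) t : `|e| = 1 -> 0 <= t -> `|x (e * t)| < M.
  move=> e1 t0; rewrite ltNge; apply/negP => Mt.
  have h0 : `|x (e * 0)| < M by rewrite mulr0 x0E.
  have [b [b0 Mb hb]] := first_exit (cn e) h0 t0 Mt.
  suff : `|x (e * b)| < M by rewrite ltNge Mb.
  apply: (inv x e b e1 b0 x0E) => s sb; split; first exact: hb.
  move=> i; have := sx (e * s) i; rewrite /= clid; last exact: hb.
  move=> d.
  have de : is_derive s (1 : R) (fun r : R => e * r) e.
    by apply: is_derive_eq; rewrite /GRing.scale/=; ring.
  by have := @is_derive1_comp _ (fun r => x r 0 i : R) (fun r : R => e * r) s _ _ d de;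
    rewrite mulrC.
move=> t i.
have xtM : `|x t| <= M.
  have [t0|t0] := leP 0 t; first by have := bnd 1 t; rewrite normr1 mul1r => /(_ erefl t0)/ltW.
  have := bnd (-1) (- t); rewrite normrN normr1 mulrNN mul1r => /(_ erefl)/(_ _)/ltW; apply.
  by rewrite oppr_ge0 ltW.
by have := sx t i; rewrite /= clid.
Unshelve. all: by end_near. Qed.

End Continuation.

(** * Differentiability of solutions with respect to the initial point *)

Section DependenceOnInitialConditions.
Context {R : realType}.

Lemma is_derive_errorP (f : R -> R) (t l : R) : is_derive t (1 : R) f l <->
  forall e, 0 < e -> \forall h \near (0 : R), `|f (t + h) - f t - h * l| <= e * `|h|.
Proof.
split=> [[df <-] e e0|h].
  have /cvgrPdist_le/(_ e e0) : h^-1 *: (f (h *: (1 : R) + t) - f t) @[h --> 0^'] --> 'D_1 f t by exact: df.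
  rewrite near_withinE; apply: filterS => h.
  have [->|h0 /(_ isT)] := eqVneq h 0.
    by move=> _; rewrite addr0 subrr mul0r subr0 normr0 mulr0.
  rewrite /GRing.scale/= mulr1 (addrC h t) => hh.
  rewrite -(ler_pM2l (x := `|h|^-1)) ?invr_gt0 ?normr_gt0//.
  rewrite mulrCA mulVf ?normr_eq0// mulr1 -normfV -normrM.
  move: hh; rewrite distrC => hh.
  by rewrite (_ : _ * _ = h^-1 * (f (t + h) - f t) - 'D_1 f t)//; field.
have hl : h^-1 *: (f (h *: (1 : R) + t) - f t) @[h --> 0^'] --> l.
  apply/cvgrPdist_le => e e0; rewrite near_withinE; apply: filterS (h e e0) => s hs s0.
  rewrite /GRing.scale/= mulr1 (addrC s t).
  rewrite -(ler_pM2l (x := `|s|)) ?normr_gt0// -normrM mulrC (mulrC `|s|).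
  move: hs; rewrite distrC => hs.
  by rewrite (_ : _ * s = s * l - (f (t + s) - f t))//; field.
by split; [apply/cvg_ex; exists l|exact: cvg_lim hl].
Qed.

Context {n : nat}.
Local Notation V := 'rV[R]_n.
Variable M : R.
Hypothesis M0 : 0 <= M.

(** First-order Taylor expansion with a quadratic remainder, uniform on the ball of radius [M]. This
    is all that the error estimate for the flow consumes, and it is stable under sums and products,
    hence immediate for polynomial fields. *)
Definition C11 (f : V -> R) (df : V -> V -> R) := exists K, 0 <= K /\
  forall a, `|a| <= M -> [/\ `|f a| <= K, forall v, `|df a v| <= K * `|v| &
    forall b, `|b| <= M -> `|f b - f a - df a (b - a)| <= K * `|b - a| ^+ 2].

Lemma C11_coord i : C11 (fun x => x 0 i) (fun _ v => v 0 i).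
Proof.
exists (M + 1); split; first by rewrite addr_ge0.
move=> a aM; split.
- by apply: le_trans (coord_le_norm _ _) _; rewrite (le_trans aM)// lerDl.
- move=> v; apply: le_trans (coord_le_norm _ _) _.
  by rewrite ler_peMl// lerDr.
- by move=> b bM; rewrite !mxE subrr normr0 mulr_ge0 ?addr_ge0// exprn_ge0.
Qed.

Lemma C11_cst (c : R) : C11 (fun _ => c) (fun _ _ => 0).
Proof.
exists `|c|; split=> // a aM; split=> //.
- by move=> v; rewrite normr0 mulr_ge0.
- by move=> b bM; rewrite !subrr normr0 mulr_ge0// exprn_ge0.
Qed.

Lemma C11D f df g dg : C11 f df -> C11 g dg ->
  C11 (fun x => f x + g x) (fun x v => df x v + dg x v).
Proof.
move=> [K [K0 hf]] [L [L0 hg]]; exists (K + L); split; first exact: addr_ge0.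
move=> a aM; have [f1 f2 f3] := hf a aM; have [g1 g2 g3] := hg a aM; split.
- by apply: le_trans (ler_normD _ _) _; exact: lerD.
- by move=> v; apply: le_trans (ler_normD _ _) _; rewrite mulrDl lerD.
- move=> b bM; rewrite mulrDl.
  rewrite (_ : _ - _ = (f b - f a - df a (b - a)) + (g b - g a - dg a (b - a))); last by ring.
  by apply: le_trans (ler_normD _ _) _; rewrite lerD ?f3 ?g3.
Qed.

Lemma C11_lipschitz f df : C11 f df -> exists K, 0 <= K /\
  forall a b, `|a| <= M -> `|b| <= M -> `|f b - f a| <= K * `|b - a|.
Proof.
move=> [K [K0 hf]]; exists (K * (2 * M + 1)); split.
  by rewrite mulr_ge0// addr_ge0// mulr_ge0.
move=> a b aM bM; have [_ f2 f3] := hf a aM.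
rewrite -(subrK (df a (b - a)) (f b - f a)) mulrDr mulrDl mulr1.
apply: le_trans (ler_normD _ _) _; rewrite lerD//.
apply: le_trans (f3 b bM) _; rewrite -mulrA ler_wpM2l// expr2 ler_wpM2r//.
by apply: le_trans (ler_normB _ _) _; lra.
Qed.

Lemma C11M f df g dg : C11 f df -> C11 g dg ->
  C11 (fun x => f x * g x) (fun x v => f x * dg x v + g x * df x v).
Proof.
move=> hf' hg'; have [K' [K'0 hK']] := C11_lipschitz hf'.
move: hf' hg' => [K [K0 hf]] [L [L0 hg]].
exists (2 * K * L + K' * L); split.
  by rewrite addr_ge0 ?mulr_ge0.
move=> a aM; have [f1 f2 f3] := hf a aM; have [g1 g2 g3] := hg a aM.
have KL : 0 <= K * L by exact: mulr_ge0.
have K'L : 0 <= K' * L by exact: mulr_ge0.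
split.
- rewrite normrM; apply: (@le_trans _ _ (K * L)); first by rewrite ler_pM.
  by lra.
- move=> v; apply: le_trans (ler_normD _ _) _; rewrite !normrM.
  have h1 : `|f a| * `|dg a v| <= K * (L * `|v|) by rewrite ler_pM.
  have h2 : `|g a| * `|df a v| <= L * (K * `|v|) by rewrite ler_pM.
  have := mulr_ge0 K'L (normr_ge0 v); lra.
- move=> b bM; have [fb1 _ _] := hf b bM.
  rewrite (_ : _ - _ = f b * (g b - g a - dg a (b - a)) + (f b - f a) * dg a (b - a)
     + g a * (f b - f a - df a (b - a))); last by ring.
  apply: le_trans (ler_normD _ _) _.
  have h1 : `|f b * (g b - g a - dg a (b - a))| <= K * (L * `|b - a| ^+ 2).
    by rewrite normrM ler_pM ?g3.
  have h2 : `|(f b - f a) * dg a (b - a)| <= K' * `|b - a| * (L * `|b - a|).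
    by rewrite normrM ler_pM ?hK'.
  have h3 : `|g a * (f b - f a - df a (b - a))| <= L * (K * `|b - a| ^+ 2).
    by rewrite normrM ler_pM ?f3.
  have h4 := ler_normD (f b * (g b - g a - dg a (b - a))) ((f b - f a) * dg a (b - a)).
  by rewrite expr2 in h1 h3 *; lra.
Qed.

Lemma C11_ext f df g dg : (forall x, f x = g x) -> (forall x v, df x v = dg x v) ->
  C11 f df -> C11 g dg.
Proof.
move=> fg dfg; have -> : f = g by exact/funext.
by have -> : df = dg by apply/funext => x; exact/funext.
Qed.

(** Row vectors carry the maximum norm, which is not differentiable; Gronwall is applied to the
    squared Euclidean norm instead. *)
Definition sqn (a : V) := \sum_i a 0 i ^+ 2.

Lemma sqn_ge0 a : 0 <= sqn a.
Proof. by apply: sumr_ge0 => i _; exact: sqr_ge0. Qed.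

Lemma coord_sqn (a : V) i : a 0 i ^+ 2 <= sqn a.
Proof.
rewrite /sqn (bigD1 i)//= lerDl; apply: sumr_ge0 => j _; exact: sqr_ge0.
Qed.

Lemma norm_sqn a : `|a| ^+ 2 <= sqn a.
Proof.
have -> : sqn a = Num.sqrt (sqn a) ^+ 2 by rewrite sqr_sqrtr ?sqn_ge0.
rewrite ler_pXn2r ?nnegrE ?sqrtr_ge0//; apply: norm_le_coord => // i.
by rewrite -sqrtr_sqr ler_wsqrtr// coord_sqn.
Qed.

Lemma is_derive_sqn (x : R -> V) (dx : V) t :
  (forall i, is_derive t (1 : R) (fun s => x s 0 i : R) (dx 0 i)) ->
  is_derive t (1 : R) (fun s => sqn (x s)) (\sum_i 2 * x t 0 i * dx 0 i).
Proof.
move=> h; rewrite /sqn.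
have -> : (fun s => \sum_i x s 0 i ^+ 2) = \sum_i (fun s => x s 0 i ^+ 2).
  by apply/funext => s; rewrite fct_sumE.
apply: is_derive_sum => i; have hi := h i.
by apply: is_derive_eq; rewrite /GRing.scale/=; ring.
Qed.

Variables (F : V -> V) (dF : V -> V -> V).
Hypothesis CF : forall i, C11 (fun x => F x 0 i) (fun x v => dF x v 0 i).
Hypothesis dFlin : forall a, linear (dF a).

Lemma C11_uniform : exists K, [/\ 0 <= K,
  forall a b, `|a| <= M -> `|b| <= M -> `|F b - F a| <= K * `|b - a|,
  forall a v, `|a| <= M -> `|dF a v| <= K * `|v| &
  forall a b, `|a| <= M -> `|b| <= M -> `|F b - F a - dF a (b - a)| <= K * `|b - a| ^+ 2].
Proof.
have CF' i : exists K, 0 <= K /\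
  forall a, `|a| <= M -> [/\ `|F a 0 i| <= K, forall v, `|dF a v 0 i| <= K * `|v| &
    forall b, `|b| <= M -> `|F b 0 i - F a 0 i - dF a (b - a) 0 i| <= K * `|b - a| ^+ 2] := CF i.
have [K hK] := choice CF'.
have [L hL] := choice (fun i => C11_lipschitz (CF i)).
pose KK := \sum_i (K i + L i).
have KK0 : 0 <= KK by apply: sumr_ge0 => i _; rewrite addr_ge0 ?(hK i).1 ?(hL i).1.
have KKi i : K i + L i <= KK.
  rewrite /KK (bigD1 i)//= lerDl; apply: sumr_ge0 => j _.
  by rewrite addr_ge0 ?(hK j).1 ?(hL j).1.
have KiK i : K i <= KK by apply: le_trans (KKi i); rewrite lerDl (hL i).1.
have LiK i : L i <= KK by apply: le_trans (KKi i); rewrite lerDr (hK i).1.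
exists KK; split => //.
- move=> a b aM bM; apply: norm_le_coord; first exact: mulr_ge0.
  move=> i; rewrite !mxE; apply: le_trans ((hL i).2 a b aM bM) _.
  by rewrite ler_wpM2r.
- move=> a v aM; apply: norm_le_coord; first exact: mulr_ge0.
  move=> i; have [_ h _] := (hK i).2 a aM; apply: le_trans (h v) _.
  by rewrite ler_wpM2r.
- move=> a b aM bM; apply: norm_le_coord; first by rewrite mulr_ge0// exprn_ge0.
  move=> i; rewrite !mxE; have [_ _ h] := (hK i).2 a aM; apply: le_trans (h b bM) _.
  by rewrite ler_wpM2r// exprn_ge0.
Qed.

Lemma sum_coord_le (a b : V) : \sum_i 2 * a 0 i * b 0 i <= n%:R * (2 * `|a| * `|b|).
Proof.
rewrite (_ : n%:R * _ = \sum_(i < n) (2 * `|a| * `|b|)); last first.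
  by rewrite sumr_const card_ord -[RHS]mulr_natl.
apply: ler_sum => i _; apply: le_trans (ler_norm _) _.
rewrite !normrM ger0_norm//; apply: ler_pM => //; last exact: coord_le_norm.
by apply: ler_pM => //; exact: coord_le_norm.
Qed.

(** Two applications of Gronwall. The first bounds [d = x - y] by its initial value. The second is
    for [e = d - s z], which satisfies the linearized equation up to a Taylor remainder of order
    [|d|^2]. In squared norm the error is thus of fourth order in the initial distance, plus the
    initial error. *)
Lemma flow_error : exists a C, 0 <= a /\ 0 <= C /\
  forall (x y z : R -> V) (s T : R), 0 <= T ->
  solution F x -> solution F y ->
  (forall t i, is_derive t (1 : R) (fun r => z r 0 i : R) (dF (y t) (z t) 0 i)) ->
  (forall t, `|x t| <= M) -> (forall t, `|y t| <= M) ->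
  sqn (x T - y T - s *: z T) <=
  (sqn (x 0 - y 0 - s *: z 0) + C * (sqn (x 0 - y 0) * expR (a * T)) ^+ 2 * T) * expR (a * T).
Proof.
have [K [K0 FL dFK Frem]] := C11_uniform.
pose N := n%:R : R; have N0 : 0 <= N by exact: ler0n.
pose a := N * (1 + 2 * K).
have a0 : 0 <= a by rewrite mulr_ge0// addr_ge0// mulr_ge0.
exists a, (N * K ^+ 2); split => //; split; first by rewrite mulr_ge0// sqr_ge0.
move=> x y z s T T0 sx sy sz xM yM.
pose d t := x t - y t.
have h1 t : 0 <= t -> sqn (d t) <= sqn (d 0) * expR (a * t).
  move=> t0.
  have := @gronwall R (fun t => sqn (d t)) (fun t => \sum_i 2 * d t 0 i * (F (x t) - F (y t)) 0 i) a 0 t t0 (lexx _) a0.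
  rewrite mul0r addr0; apply.
    move=> r _; apply: is_derive_sqn => i; rewrite [(F (x r) - F (y r)) 0 i]mxE [X in _ + X]mxE.
    rewrite /d; under eq_fun do rewrite mxE [X in _ + X]mxE.
    by apply: is_deriveB; [exact: sx|exact: sy].
  move=> r _; rewrite addr0; apply: le_trans (sum_coord_le _ _) _.
  have := FL _ _ (yM r) (xM r); rewrite -/(d r) => hL.
  rewrite (_ : a * _ = N * ((1 + 2 * K) * sqn (d r))); last by rewrite /a mulrA.
  apply: ler_wpM2l => //.
  have := norm_sqn (d r); have := sqn_ge0 (d r).
  have := ler_wpM2l (normr_ge0 (d r)) hL; nra.
pose e t := d t - s *: z t.
pose b := N * K ^+ 2 * (sqn (x 0 - y 0) * expR (a * T)) ^+ 2.
have b0 : 0 <= b by rewrite mulr_ge0 ?sqr_ge0// mulr_ge0// sqr_ge0.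
have := @gronwall R (fun t => sqn (e t)) (fun t => \sum_i 2 * e t 0 i * (F (x t) - F (y t) - s *: dF (y t) (z t)) 0 i) a b T T0 b0 a0.
apply.
  move=> t _; apply: is_derive_sqn => i.
  have -> : (F (x t) - F (y t) - s *: dF (y t) (z t)) 0 i = F (x t) 0 i - F (y t) 0 i - s * dF (y t) (z t) 0 i.
    by rewrite !mxE.
  rewrite /e /d.
  have -> : (fun s0 : R => (x s0 - y s0 - s *: z s0) 0 i) = (fun s0 : R => x s0 0 i - y s0 0 i - s * z s0 0 i).
    by apply/funext => r; rewrite !mxE.
  have d1 := sx t i; have d2 := sy t i; have d3 := sz t i.
  by apply: is_derive_eq; rewrite /GRing.scale/=; ring.
move=> t /andP[t0 tT]; apply: le_trans (sum_coord_le _ _) _.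
pose rem := F (x t) - F (y t) - dF (y t) (d t).
have -> : F (x t) - F (y t) - s *: dF (y t) (z t) = rem + dF (y t) (e t).
  have hl : dF (y t) (e t) = dF (y t) (d t) - s *: dF (y t) (z t).
    rewrite /e addrC -scaleNr (dFlin (y t) (- s) (z t) (d t)) addrC.
    by rewrite scaleNr.
  by rewrite hl /rem addrA subrK.
have hr : `|rem| <= K * `|d t| ^+ 2 by exact: Frem.
have he : `|dF (y t) (e t)| <= K * `|e t| by exact: dFK.
have h2 : `|rem + dF (y t) (e t)| <= K * `|d t| ^+ 2 + K * `|e t|.
  by apply: le_trans (ler_normD _ _) _; exact: lerD.
have hd : `|d t| ^+ 2 <= sqn (d 0) * expR (a * T).
  apply: le_trans (norm_sqn _) _; apply: le_trans (h1 t t0) _.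
  by rewrite ler_wpM2l ?sqn_ge0// ler_expR ler_wpM2l.
have hN : N * (2 * `|e t| * `|rem + dF (y t) (e t)|) <= N * (2 * `|e t| * (K * `|d t| ^+ 2 + K * `|e t|)).
  by rewrite ler_wpM2l// ler_wpM2l// mulr_ge0.
apply: le_trans hN _.
have -> : a * sqn (e t) + b = N * ((1 + 2 * K) * sqn (e t) +
    K ^+ 2 * (sqn (d 0) * expR (a * T)) ^+ 2) by rewrite /b -/(d 0) /a; ring.
apply: ler_wpM2l => //.
have hd2 : (K * `|d t| ^+ 2) ^+ 2 <= K ^+ 2 * (sqn (d 0) * expR (a * T)) ^+ 2.
  rewrite exprMn ler_wpM2l ?sqr_ge0// ler_pXn2r ?nnegrE ?sqr_ge0//.
  by rewrite mulr_ge0 ?sqn_ge0 ?expR_ge0.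
have := norm_sqn (e t); have := sqr_ge0 (`|e t| - K * `|d t| ^+ 2).
by rewrite sqrrB; have := normr_ge0 (e t); nra.
Qed.

Lemma sqn_le (a : V) c : 0 <= c -> (forall i, `|a 0 i| <= c) -> sqn a <= n%:R * c ^+ 2.
Proof.
move=> c0 h; rewrite (_ : n%:R * c ^+ 2 = \sum_(i < n) c ^+ 2); last first.
  by rewrite sumr_const card_ord -[RHS]mulr_natl.
by apply: ler_sum => i _; rewrite -(real_normK (num_real (a 0 i))) ler_pXn2r ?nnegrE.
Qed.

Lemma exists_small (a c : R) : 0 <= a -> 0 < c -> exists d, [/\ 0 < d, d <= 1 & a * d <= c].
Proof.
move=> a0 c0; exists (Num.min 1 (c / (a + 1))).
have a1 : 0 < a + 1 by rewrite ltr_wpDl.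
split; first by rewrite lt_min ltr01 divr_gt0.
  by rewrite ge_min lexx.
apply: (@le_trans _ _ (a * (c / (a + 1)))); first by rewrite ler_wpM2l// ge_min lexx orbT.
by rewrite mulrA ler_pdivrMr//; nra.
Qed.

(** The derivative of the time [T] map along a curve of initial points is the solution of the
    linearized equation. The solutions [X s] may be chosen arbitrarily; [flow_error] with [s = 0]
    already forces [X 0 T = y T]. *)
Lemma solution_is_derive (X : R -> R -> V) (y z : R -> V) T : 0 <= T ->
  (\forall s \near (0 : R), solution F (X s) /\ forall t, `|X s t| <= M) ->
  solution F y -> (forall t, `|y t| <= M) ->
  (forall t i, is_derive t (1 : R) (fun r => z r 0 i : R) (dF (y t) (z t) 0 i)) ->
  X 0 0 = y 0 ->
  (forall i, is_derive (0 : R) (1 : R) (fun s => X s 0 0 i : R) (z 0 0 i)) ->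
  forall i, is_derive (0 : R) (1 : R) (fun s => X s T 0 i : R) (z T 0 i).
Proof.
move=> T0 nX sy yM sz X0 dX i.
have [a [C [a0 [C0 err]]]] := flow_error.
have X0T : X 0 T = y T.
  have [sX XM] := nbhs_singleton nX.
  have := err (X 0) y z 0 T T0 sX sy sz XM yM.
  rewrite X0 !scale0r !subr0 subrr (_ : sqn 0 = 0); last first.
    by rewrite /sqn big1// => j _; rewrite mxE expr0n.
  rewrite mul0r expr0n/= mulr0 mul0r addr0 mul0r => h.
  have : `|X 0 T - y T| ^+ 2 <= 0 by exact: le_trans (norm_sqn _) h.
  by rewrite real_exprn_even_le0 ?num_real//= normr_eq0 subr_eq0 => /eqP.
apply/is_derive_errorP => e e0; rewrite X0T.
set E := expR (a * T) in err; have E0 : 0 < E by exact: expR_gt0.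
have E0' := ltW E0.
pose B := n%:R * (1 + `|z 0|) ^+ 2.
have B0 : 0 <= B by rewrite mulr_ge0// sqr_ge0.
have e20 : 0 < e ^+ 2 / 2 by rewrite divr_gt0// exprn_gt0.
(* [d1] and [d2] make the initial error and the quadratic remainder each at most [e^2 / 2 * s^2] in
   squared norm. *)
have [d1 [d10 d11 hd1]] := @exists_small (n%:R * E) _ (mulr_ge0 (ler0n _ _) (ltW E0)) e20.
have CB0 : 0 <= C * (B * E) ^+ 2 * T * E.
  by rewrite !mulr_ge0// ?sqr_ge0// ltW.
have [d2 [d20 d21 hd2]] := @exists_small _ _ CB0 e20.
near=> s; rewrite add0r.
have [sX XM] : solution F (X s) /\ forall t, `|X s t| <= M by near: s.
have hs : `|s| <= d2.
  by near: s; apply/nbhs_ballP; exists d2 => //= r; rewrite /ball/= sub0r normrN => /ltW.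
have h0 : forall j, `|X s 0 0 j - y 0 0 j - s * z 0 0 j| <= d1 * `|s|.
  near: s; apply: filter_forall => j; have /is_derive_errorP/(_ d1 d10) := dX j.
  by apply: filterS => s; rewrite add0r X0.
have hE0 : sqn (X s 0 - y 0 - s *: z 0) <= n%:R * (d1 * `|s|) ^+ 2.
  by apply: sqn_le => [|j]; [rewrite mulr_ge0// ltW|have := h0 j; rewrite !mxE].
have hD0 : sqn (X s 0 - y 0) <= B * s ^+ 2.
  rewrite /B -mulrA -(real_normK (num_real s)) -exprMn; apply: sqn_le => [|j].
    by rewrite mulr_ge0// addr_ge0.
  rewrite !mxE -(subrK (s * z 0 0 j) (_ - _)) mulrDl mul1r.
  apply: le_trans (ler_normD _ _) _; apply: lerD.
    by apply: le_trans (h0 j) _; rewrite ler_piMl.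
  by rewrite normrM mulrC ler_wpM2r// coord_le_norm.
have hfin : sqn (X s T - y T - s *: z T) <= (e * `|s|) ^+ 2.
  apply: le_trans (err _ y z s T T0 sX sy sz XM yM) _.
  have e1 : sqn (X s 0 - y 0 - s *: z 0) * E <= e ^+ 2 / 2 * s ^+ 2.
    apply: (@le_trans _ _ (n%:R * (d1 * `|s|) ^+ 2 * E)); first by rewrite ler_wpM2r// ltW.
    rewrite exprMn real_normK ?num_real// (_ : _ * E = n%:R * E * d1 ^+ 2 * s ^+ 2); last by ring.
    rewrite ler_wpM2r ?sqr_ge0//; apply: le_trans hd1; apply: ler_wpM2l; first exact: mulr_ge0.
    by rewrite expr2 ler_piMl// ltW.
  have e2 : C * (sqn (X s 0 - y 0) * E) ^+ 2 * T * E <= e ^+ 2 / 2 * s ^+ 2.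
    have hh : (sqn (X s 0 - y 0) * E) ^+ 2 <= (B * E) ^+ 2 * d2 * s ^+ 2.
      apply: (@le_trans _ _ ((B * s ^+ 2 * E) ^+ 2)).
        have sE : 0 <= sqn (X s 0 - y 0) * E by rewrite mulr_ge0 ?sqn_ge0// ltW.
        have sB : 0 <= B * s ^+ 2 * E by rewrite mulr_ge0// mulr_ge0// sqr_ge0.
        by rewrite ler_pXn2r ?nnegrE// ler_wpM2r.
      rewrite (_ : (B * s ^+ 2 * E) ^+ 2 = (B * E) ^+ 2 * s ^+ 2 * s ^+ 2); last by ring.
      rewrite ler_wpM2r ?sqr_ge0// ler_wpM2l ?sqr_ge0// -(real_normK (num_real s)) expr2.
      by apply: le_trans (_ : `|s| * 1 <= _); [rewrite ler_wpM2l// (le_trans hs)|rewrite mulr1].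
    apply: (@le_trans _ _ (C * ((B * E) ^+ 2 * d2 * s ^+ 2) * T * E)).
      by rewrite ler_wpM2r// ler_wpM2r// ler_wpM2l.
    rewrite (_ : _ * E = C * (B * E) ^+ 2 * T * E * d2 * s ^+ 2); last by ring.
    by rewrite ler_wpM2r ?sqr_ge0.
  apply: (@le_trans _ _ (e ^+ 2 / 2 * s ^+ 2 + e ^+ 2 / 2 * s ^+ 2)); first by rewrite mulrDl lerD.
  by rewrite exprMn real_normK ?num_real// -mulrDl -splitr.
have := le_trans (coord_sqn (X s T - y T - s *: z T) i) hfin.
rewrite -(real_normK (num_real (_ 0 i))) ler_pXn2r ?nnegrE//; last first.
  by rewrite mulr_ge0// ltW.
by rewrite !mxE.
Unshelve. all: by end_near. Qed.

End DependenceOnInitialConditions.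

(** * The magnetic flow *)

Section Components.
Context {R : realType}.
Local Notation E := 'rV[R]_3.

Lemma is_derive_comp_linear (V W : normedModType R) (f : {linear V -> W}) (c : R -> V) t v :
  continuous f -> is_derive t (1 : R) c v -> is_derive t (1 : R) (fun s => f (c s)) (f v).
Proof.
move=> cf [dc <-].
have h : h^-1 *: (f (c (h *: (1 : R) + t)) - f (c t)) @[h --> 0^'] --> f ('D_1 c t).
  have -> : (fun h : R => h^-1 *: (f (c (h *: (1 : R) + t)) - f (c t))) =
      f \o (fun h : R => h^-1 *: (c (h *: (1 : R) + t) - c t)).
    by apply/funext => h; rewrite /= linearZZ (raddfB f).
  exact: continuous_cvg (cf _) dc.
by split; [apply/cvg_ex; eexists; exact: h|exact: cvg_lim h].
Qed.

Lemma is_derive_coordinate n (c : R -> 'rV[R]_n) t v i :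
  is_derive t (1 : R) c v -> is_derive t (1 : R) (fun s => c s 0 i : R) (v 0 i).
Proof.
have @f : {linear 'rV[R]_n -> R}.
  by exists (fun N : 'rV[R]_n => N 0 i); do 2![eexists]; do ?[constructor];
     rewrite ?mxE// => ? *; rewrite ?mxE//; move=> ?; rewrite !mxE.
by apply: (@is_derive_comp_linear _ _ f); exact: coord_continuous.
Qed.

Lemma is_derive_rV n (c : R -> 'rV[R]_n) t (v : 'rV[R]_n) :
  (forall i, is_derive t (1 : R) (fun s => c s 0 i : R) (v 0 i)) -> is_derive t (1 : R) c v.
Proof.
move=> h; have dc : derivable c t 1.
  by apply/derivable_mxP => i j; rewrite ord1; case: (h j).
by split=> //; rewrite derive_mx//; apply/rowP => j; rewrite mxE; case: (h j).
Qed.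

Lemma is_derive_pairP (c : R -> E * E) t v : is_derive t (1 : R) c v <->
  (forall i, is_derive t (1 : R) (fun s => (c s).1 0 i : R) (v.1 0 i)) /\
  (forall i, is_derive t (1 : R) (fun s => (c s).2 0 i : R) (v.2 0 i)).
Proof.
split=> [h|[h1 h2]].
  split=> i; apply: is_derive_coordinate.
    by apply: (@is_derive_comp_linear _ _ fst) h => x; exact: cvg_fst.
  by apply: (@is_derive_comp_linear _ _ snd) h => x; exact: cvg_snd.
have [d1 e1] := is_derive_rV h1; have [d2 e2] := is_derive_rV h2.
have := derive_pair d1 d2; rewrite e1 e2 -surjective_pairing.
by under eq_fun do rewrite -surjective_pairing.
Qed.

Lemma is_derive_dot (a b : R -> E) t (u v : E) :
  (forall i, is_derive t (1 : R) (fun s => a s 0 i : R) (u 0 i)) ->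
  (forall i, is_derive t (1 : R) (fun s => b s 0 i : R) (v 0 i)) ->
  is_derive t (1 : R) (fun s => dot (a s) (b s)) (dot u (b t) + dot (a t) v).
Proof.
move=> ha hb; under eq_fun do rewrite dotE.
have a0 := ha o0; have a1 := ha o1; have a2 := ha o2.
have b0 := hb o0; have b1 := hb o1; have b2 := hb o2.
by apply: is_derive_eq; rewrite !dotE /GRing.scale/=; ring.
Qed.

Lemma tangent_of_curve (c : R -> E * E) v : (forall s, cotangent_bundle (c s)) ->
  is_derive (0 : R) (1 : R) c v -> tangent_cotangent (c 0) v.
Proof.
move=> hc /is_derive_pairP[h1 h2]; split.
  have := is_derive_dot h1 h1.
  have -> : (fun s => dot (c s).1 (c s).1) = cst 1 by apply/funext => s; have [] := hc s.
  move=> [_]; rewrite derive_cst => h; rewrite dotC in h.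
  have : 2 * dot (c 0).1 v.1 = 0 by rewrite mulr2n mulrDl mul1r -h.
  by move/eqP; rewrite mulf_eq0 pnatr_eq0/= => /eqP.
have := is_derive_dot h1 h2.
have -> : (fun s => dot (c s).1 (c s).2) = cst 0 by apply/funext => s; have [_] := hc s.
by move=> [_]; rewrite derive_cst addrC (dotC v.1) => <-.
Qed.

End Components.

(** * The Hamiltonian vector field and its integral curves as an explicit equation *)

Section MagneticFlow.
Context {R : realType}.
Local Notation E := 'rV[R]_3.
Implicit Types (q p u v w : E) (x X z : E * E).

Definition cross q p : E := vec (q 0 o1 * p 0 o2 - q 0 o2 * p 0 o1)
  (q 0 o2 * p 0 o0 - q 0 o0 * p 0 o2) (q 0 o0 * p 0 o1 - q 0 o1 * p 0 o0).

(** The Lorentz force of strength [z^3], perpendicular to the velocity, and the normal reaction that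
    keeps the curve on the sphere when [kap = |p|^2]. *)
Definition force (kap : R) q p : E := q 0 o2 ^+ 3 *: cross q p - kap *: q.

Definition magnetic_field x : E * E := (x.2, force (dot x.2 x.2) x.1 x.2).

Lemma tangent_cotangent_magnetic_field x : cotangent_bundle x ->
  tangent_cotangent x (magnetic_field x).
Proof.
case: x => q p [/= Sq Tp]; split => //=.
rewrite /force /cross; move: Sq; rewrite /sphere /tangent /= !dotE !mxE /= => Sq.
apply: (@eq_trans _ _ ((p 0 o0 * p 0 o0 + p 0 o1 * p 0 o1 + p 0 o2 * p 0 o2) *
    (1 - (q 0 o0 * q 0 o0 + q 0 o1 * q 0 o1 + q 0 o2 * q 0 o2)))); first by ring.
by rewrite Sq subrr mulr0.
Qed.

Lemma omega_magnetic_field x z : cotangent_bundle x -> tangent_cotangent x z ->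
  omega magnetic x z (magnetic_field x) = dot x.2 z.2.
Proof.
case: x => q p [/= Sq Tp]; case: z => u w [/= Tu _].
rewrite /omega /= bil_magnetic /force /cross !dotE !mxE /=.
move: Sq Tp Tu; rewrite /sphere /tangent /= !dotE.
move: (q 0 o0) (q 0 o1) (q 0 o2) (p 0 o0) (p 0 o1) (p 0 o2) (u 0 o0) (u 0 o1) (u 0 o2).
move=> x y z p0 p1 p2 u0 u1 u2 Sq Tp Tu.
(* [m * |q|^2 - (q . m) q = - q x (q x m)] with [m = p x u], and [q x (p x u) = (q . u) p - (q . p) u]. *)
apply/eqP; rewrite -subr_eq0; apply/eqP.
apply: (@eq_trans _ _ ((p0 * p0 + p1 * p1 + p2 * p2) * (x * u0 + y * u1 + z * u2)
  + z ^+ 2 * (p0 * u1 - p1 * u0) * (1 - (x * x + y * y + z * z))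
  + z ^+ 2 * ((x * p0 + y * p1 + z * p2) * (x * u1 - y * u0) - (x * u0 + y * u1 + z * u2) * (x * p1 - y * p0)))).
  by ring.
by rewrite Sq Tp Tu; ring.
Qed.

Lemma hamiltonian_along (c : R -> E * E) (v : E * E) : (forall s, cotangent_bundle (c s)) ->
  is_derive (0 : R) (1 : R) c v ->
  is_derive (0 : R) (1 : R) (hamiltonian round_metric \o c) (dot (c 0).2 v.2).
Proof.
move=> hc /is_derive_pairP[_ h2].
have -> : hamiltonian round_metric \o c = fun s => 2^-1 * dot (c s).2 (c s).2.
  by apply/funext => s /=; rewrite hamiltonian_round.
have d := is_derive_dot h2 h2.
by apply: is_derive_eq; rewrite /GRing.scale/= (dotC v.2); field.
Qed.

Lemma magnetic_fieldP x : cotangent_bundle x ->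
  hamiltonian_vector round_metric magnetic x (magnetic_field x).
Proof.
move=> Bx; split; first exact: tangent_cotangent_magnetic_field.
move=> c v hc c0 dc; have tv := tangent_of_curve hc dc; rewrite c0 in tv.
by rewrite omega_magnetic_field// -c0; exact: hamiltonian_along.
Qed.

(* The test curves are the fibre lines (q, p + s w) and the orbits of the rotations
   about the coordinate axes, along which the Hamiltonian is affine and constant. *)
Lemma hamiltonian_vector_unique x X : cotangent_bundle x ->
  hamiltonian_vector round_metric magnetic x X -> X = magnetic_field x.
Proof.
move=> Bx [tX dX]; have := Bx; case: x Bx dX tX => q p Bx dX tX [/= Sq Tp].
have test (c : R -> E * E) (v : E * E) : (forall s, cotangent_bundle (c s)) -> c 0 = (q, p) ->
    is_derive (0 : R) (1 : R) c v -> omega magnetic (q, p) v X = dot p v.2.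
  move=> hc c0 dc; have [_ <-] := dX c v hc c0 dc.
  by have [_ ->] := hamiltonian_along hc dc; rewrite c0.
have tX1 : dot q X.1 = 0 by case: tX.
have vert w : tangent q w -> dot w X.1 = dot p w.
  move=> Tw; have := test (fun s => (q, p + s *: w)) (0, w).
  rewrite /omega /= bil_magnetic !mxE !mul0r subr0 mulr0 addr0.
  rewrite (_ : dot X.2 0 = 0) ?subr0; last by rewrite dotE !mxE; ring.
  apply.
  - move=> s; split => //; move: Tp Tw; rewrite /tangent/= !dotE !mxE => Tp Tw.
    apply: (@eq_trans _ _ ((q 0 o0 * p 0 o0 + q 0 o1 * p 0 o1 + q 0 o2 * p 0 o2) +
       s * (q 0 o0 * w 0 o0 + q 0 o1 * w 0 o1 + q 0 o2 * w 0 o2))); first by ring.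
    by rewrite Tp Tw; ring.
  - by rewrite scale0r addr0.
  - apply/is_derive_pairP; split=> i /=; first by rewrite mxE; exact: is_derive_cst.
    under eq_fun do rewrite !mxE.
    by apply: is_derive_eq; rewrite /GRing.scale/=; ring.
have dot0 u : dot u u = 0 -> u = 0.
  by move=> h; apply/eqP; apply: contraTT isT => /dot_gt0; rewrite h ltxx.
have X1 : X.1 = p.
  apply/eqP; rewrite -subr_eq0; apply/eqP/dot0.
  have Tw : tangent q (X.1 - p).
    move: Tp tX1; rewrite /tangent/= !dotE !mxE => Tp tX1.
    rewrite -[RHS](subrr 0) -{1}tX1 -Tp; ring.
  have := vert _ Tw; rewrite (dotC p) => h.
  have -> : dot (X.1 - p) (X.1 - p) = dot (X.1 - p) X.1 - dot (X.1 - p) p by rewrite !dotE !mxE; ring.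
  by rewrite h subrr.
pose D := X.2 - (magnetic_field (q, p)).2.
have testD (c : R -> E * E) (v : E * E) : (forall s, cotangent_bundle (c s)) -> c 0 = (q, p) ->
    is_derive (0 : R) (1 : R) c v -> dot D v.1 = 0.
  move=> hc c0 dc; have := test c v hc c0 dc.
  have tv := tangent_of_curve hc dc; rewrite c0 in tv.
  rewrite -(omega_magnetic_field Bx tv) /omega X1 /= => h.
  have -> : dot D v.1 = dot X.2 v.1 - dot (force (dot p p) q p) v.1.
    by rewrite /D /= !dotE !mxE; ring.
  by lra.
have qD : dot q D = 0.
  have [_ h1] := tX; have [_ h2] := tangent_cotangent_magnetic_field Bx; rewrite /= X1 in h1 h2.
  have -> : dot q D = dot q X.2 - dot q (force (dot p p) q p) by rewrite /D /= !dotE !mxE; ring.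
  by lra.
pose cs s := (cos s : R); pose sn s := (sin s : R).
have cs1 s : cs s * cs s + sn s * sn s = 1 by rewrite -!expr2 cos2Dsin2.
have dc s : is_derive s (1 : R) cs (- sn s) by exact: is_derive_cos.
have ds s : is_derive s (1 : R) sn (cs s) by exact: is_derive_sin.
have c00 : cs 0 = 1 by exact: cos0.
have s00 : sn 0 = 0 by exact: sin0.
have rotD i j : (i, j) \in [:: (o1, o2); (o2, o0); (o0, o1)] -> D 0 j * q 0 i - D 0 i * q 0 j = 0.
  move=> ij.
  pose rot s u : E := \row_k (if k == i then cs s * u 0 i - sn s * u 0 j else
    if k == j then sn s * u 0 i + cs s * u 0 j else u 0 k).
  pose A u : E := \row_k (if k == i then - u 0 j else if k == j then u 0 i else 0).
  have dot_rot s u v : dot (rot s u) (rot s v) = dot u v + (cs s * cs s + sn s * sn s - 1) * (u 0 i * v 0 i + u 0 j * v 0 j).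
    rewrite !dotE !mxE; move: ij; rewrite !inE => /or3P[] /eqP[-> ->] /=; ring.
  have rot0 u : rot 0 u = u.
    apply/rowP => k; rewrite mxE c00 s00; case: eqP => [->|_]; first by ring.
    by case: eqP => [->|//]; ring.
  have drot u k : is_derive (0 : R) (1 : R) (fun s => rot s u 0 k : R) (A u 0 k).
    under eq_fun do rewrite mxE; rewrite mxE; have d1 := dc 0; have d2 := ds 0.
    case: (k == i); first by apply: is_derive_eq; rewrite /GRing.scale/= c00 s00; ring.
    by case: (k == j); apply: is_derive_eq; rewrite /GRing.scale/= ?c00 ?s00; ring.
  have := testD (fun s => (rot s q, rot s p)) (A q, A p).
  have -> : dot D (A q, A p).1 = D 0 j * q 0 i - D 0 i * q 0 j.
    rewrite /= dotE !mxE; move: ij; rewrite !inE => /or3P[] /eqP[-> ->] /=; ring.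
  apply.
  - by move=> s; rewrite /cotangent_bundle /sphere /tangent /= !dot_rot cs1 subrr mul0r addr0 mul0r addr0.
  - by rewrite !rot0.
  - by apply/is_derive_pairP; split=> k; exact: drot.
have h0 := rotD o1 o2 isT; have h1 := rotD o2 o0 isT; have h2 := rotD o0 o1 isT.
rewrite [LHS]surjective_pairing X1; congr pair.
apply/eqP; rewrite -subr_eq0; apply/eqP/dot0; rewrite -/D.
move: Sq qD h0 h1 h2; rewrite /sphere /= !dotE.
move: (D 0 o0) (D 0 o1) (D 0 o2) (q 0 o0) (q 0 o1) (q 0 o2) => d0 d1 d2 x y z Sq qD h0 h1 h2.
(* |D|^2 |q|^2 = |D x q|^2 + (D . q)^2 *)
rewrite -[LHS]mulr1 -Sq.
apply: (@eq_trans _ _ ((d2 * y - d1 * z) ^+ 2 + (d0 * z - d2 * x) ^+ 2 + (d1 * x - d0 * y) ^+ 2 +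
  (x * d0 + y * d1 + z * d2) ^+ 2)); first by ring.
by rewrite h0 h1 h2 qD; ring.
Qed.

Lemma integral_curveP (y : R -> E * E) : integral_curve round_metric magnetic y <->
  (forall t, cotangent_bundle (y t)) /\ forall t, is_derive t (1 : R) y (magnetic_field (y t)).
Proof.
split=> -[By dy]; split=> // t.
  by have [X hX] := dy t; rewrite (hamiltonian_vector_unique (By t) hX).
by exists (magnetic_field (y t)) => //; exact: magnetic_fieldP.
Qed.

End MagneticFlow.

(** * The magnetic equation as a polynomial system on R^6 *)

Section MagneticCurves.
Context {R : realType}.
Local Notation E := 'rV[R]_3.
Local Notation S6 := 'rV[R]_(3 + 3).
Implicit Types (q p u v w : E) (x X : E * E) (z : S6).

(** Pairs of vectors are flattened to rows of length 6, the form in which differential equations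
    were solved above. *)
Definition pk x : S6 := row_mx x.1 x.2.
Definition upk z : E * E := (lsubmx z, rsubmx z).

Lemma pkK x : upk (pk x) = x.
Proof. by rewrite /upk /pk row_mxKl row_mxKr -surjective_pairing. Qed.

Lemma pkl x i : pk x 0 (lshift 3 i) = x.1 0 i. Proof. exact: row_mxEl. Qed.
Lemma pkr x i : pk x 0 (rshift 3 i) = x.2 0 i. Proof. exact: row_mxEr. Qed.
Lemma upkl z i : (upk z).1 0 i = z 0 (lshift 3 i). Proof. by rewrite mxE. Qed.
Lemma upkr z i : (upk z).2 0 i = z 0 (rshift 3 i). Proof. by rewrite mxE. Qed.

Lemma ord6P (P : 'I_(3 + 3) -> Prop) : (forall i, P (lshift 3 i)) -> (forall i, P (rshift 3 i)) ->
  forall i, P i.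
Proof. by move=> Pl Pr i; case: (split_ordP i) => j ->. Qed.

Lemma is_derive_pk (y : R -> E * E) t (v : E * E) : is_derive t (1 : R) y v <->
  forall i, is_derive t (1 : R) (fun s => pk (y s) 0 i : R) (pk v 0 i).
Proof.
split=> [/is_derive_pairP[h1 h2]|h].
  apply: ord6P => i.
    by rewrite pkl; under eq_fun do rewrite pkl; exact: h1.
  by rewrite pkr; under eq_fun do rewrite pkr; exact: h2.
apply/is_derive_pairP; split=> i.
  by have := h (lshift 3 i); rewrite pkl; under eq_fun do rewrite pkl.
by have := h (rshift 3 i); rewrite pkr; under eq_fun do rewrite pkr.
Qed.

Definition dforce (kap dkap : R) q p u w : E :=
  (3 * q 0 o2 ^+ 2 * u 0 o2) *: cross q p + q 0 o2 ^+ 3 *: (cross u p + cross q w)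
  - dkap *: q - kap *: u.

Variables (kap : E * E -> R) (dkap : E * E -> E * E -> R).

(** The coefficient [kap] is left open. A constant value gives a field with a conserved positive
    quadratic form, used for existence; [|p|^2] gives the true field, used for the linearization. *)
Definition field6 z : S6 := pk ((upk z).2, force (kap (upk z)) (upk z).1 (upk z).2).

Definition dfield6 (z v : S6) : S6 := pk ((upk v).2,
  dforce (kap (upk z)) (dkap (upk z) (upk v)) (upk z).1 (upk z).2 (upk v).1 (upk v).2).

Variable M : R.
Hypothesis M0 : 0 <= M.
Hypothesis Ckap : C11 M (fun z : S6 => kap (upk z)) (fun z (v : S6) => dkap (upk z) (upk v)).

Lemma C11_field6 i : C11 M (fun z : S6 => field6 z 0 i) (fun z v : S6 => dfield6 z v 0 i).
Proof.
move: i; apply: ord6P => i.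
  apply: (C11_ext _ _ (C11_coord M0 (rshift 3 i))) => [z|z v].
    by rewrite /field6 pkl upkr.
  by rewrite /dfield6 pkl upkr.
have cq j := C11_coord M0 (lshift 3 j : 'I_(3 + 3)).
have cp j := C11_coord M0 (rshift 3 j : 'I_(3 + 3)).
have cN f df : C11 M (f : S6 -> R) df -> C11 M (fun z => - f z) (fun z (v : S6) => - df z v).
  move=> h; have h2 := C11M M0 (C11_cst M (-1 : R)) h; apply: (C11_ext _ _ h2) => [z|z v]; ring.
have cr j k := C11D (C11M M0 (cq j) (cp k)) (cN _ _ (C11M M0 (cq k) (cp j))).
have cz := C11M M0 (C11M M0 (cq o2) (cq o2)) (cq o2).
have cf j k l := C11D (C11M M0 cz (cr j k)) (cN _ _ (C11M M0 Ckap (cq l))).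
move: i; apply: ord3P.
- apply: (C11_ext _ _ (cf o1 o2 o0)) => [z|z v].
    by rewrite /field6 pkr /= /force /cross !mxE /=; ring.
  by rewrite /dfield6 pkr /= /dforce /cross !mxE /=; ring.
- apply: (C11_ext _ _ (cf o2 o0 o1)) => [z|z v].
    by rewrite /field6 pkr /= /force /cross !mxE /=; ring.
  by rewrite /dfield6 pkr /= /dforce /cross !mxE /=; ring.
- apply: (C11_ext _ _ (cf o0 o1 o2)) => [z|z v].
    by rewrite /field6 pkr /= /force /cross !mxE /=; ring.
  by rewrite /dfield6 pkr /= /dforce /cross !mxE /=; ring.
Qed.

Hypothesis dkap_lin : forall x k z (v : S6),
  dkap x (upk (k *: z + v)) = k * dkap x (upk z) + dkap x (upk v).

Lemma dfield6_linear z : linear (dfield6 z).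
Proof.
move=> k u v; have e j (a b : S6) : (k *: a + b) 0 j = k * a 0 j + b 0 j by rewrite !mxE.
apply/rowP; apply: ord6P => i; rewrite e /dfield6; first by rewrite !pkl !upkr e.
have cl j : (upk (k *: u + v)).1 0 j = k * (upk u).1 0 j + (upk v).1 0 j by rewrite !mxE.
have cr j : (upk (k *: u + v)).2 0 j = k * (upk u).2 0 j + (upk v).2 0 j by rewrite !mxE.
rewrite !pkr dkap_lin /dforce.
move: (dkap (upk z) (upk u)) (dkap (upk z) (upk v)) => a b.
move: (upk z) => [q p]; move: (upk (k *: u + v)) (upk u) (upk v) cl cr => [w1 w2] [u1 u2] [v1 v2] /= cl cr.
move: i; apply: ord3P; rewrite /cross !mxE /= !cl !cr; ring.
Qed.

End MagneticCurves.

(** * Completeness of the magnetic flow off the zero section *)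

Section IntegralCurves.
Context {R : realType}.
Local Notation E := 'rV[R]_3.
Local Notation S6 := 'rV[R]_(3 + 3).

(** In R^6 the term [|p|^2] is replaced by its initial value [s2]. Then [W = |p|^2 + s2 |q|^2] is
    conserved, which confines solutions to a ball and makes them global. Once the constraints are
    known to persist, [|q| = 1] and the value [2 * s2] of [W] give back [|p|^2 = s2], so the
    solution is a magnetic curve. *)
Lemma integral_curve_exists (x : E * E) : cotangent_bundle x -> 0 < dot x.2 x.2 ->
  exists y, integral_curve round_metric magnetic y /\ y 0 = x.
Proof.
move=> [Sx Tx] s20; set s2 := dot x.2 x.2 in s20 *.
pose s := Num.sqrt s2; have s0 : 0 < s by rewrite sqrtr_gt0.
have ss : s ^+ 2 = s2 by rewrite sqr_sqrtr// ltW.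
pose M := 2 + 2 * s; have M0 : 0 < M by rewrite /M; lra.
have Ck : C11 M (fun z : S6 => (fun=> s2) (upk z)) (fun z (v : S6) => (fun _ _ => 0) (upk z) (upk v)).
  exact: C11_cst.
have dl : forall (x : E * E) k (z v : S6), (fun (_ _ : E * E) => 0 : R) x (upk (k *: z + v)) =
    k * (fun _ _ => 0) x (upk z) + (fun _ _ => 0) x (upk v) by move=> *; ring.
have [K [K0 FL _ _]] := C11_uniform (ltW M0) (@C11_field6 R (fun=> s2) (fun _ _ => 0) M (ltW M0) Ck).
pose F := field6 (fun=> s2).
pose W (z : S6) := dot (upk z).2 (upk z).2 + s2 * dot (upk z).1 (upk z).1.
have dW (z : R -> S6) e t : (forall i, is_derive t (1 : R) (fun r => z r 0 i : R) (e * F (z t) 0 i)) ->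
    is_derive t (1 : R) (fun r => W (z r)) 0.
  move=> dz.
  have d1 i : is_derive t (1 : R) (fun r => (upk (z r)).1 0 i : R) ((e *: (upk (z t)).2) 0 i).
    have -> : (e *: (upk (z t)).2) 0 i = e * F (z t) 0 (lshift 3 i) by rewrite /F /field6 pkl mxE.
    by under eq_fun do rewrite upkl; exact: dz.
  have d2 i : is_derive t (1 : R) (fun r => (upk (z r)).2 0 i : R) ((e *: force s2 (upk (z t)).1 (upk (z t)).2) 0 i).
    have -> : (e *: force s2 (upk (z t)).1 (upk (z t)).2) 0 i = e * F (z t) 0 (rshift 3 i).
      by rewrite /F /field6 pkr mxE.
    by under eq_fun do rewrite upkr; exact: dz.
  have e1 := is_derive_dot d1 d1; have e2 := is_derive_dot d2 d2.
  rewrite /W; apply: is_derive_eq; rewrite /GRing.scale/=.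
  move: (upk (z t)) => [q p]; rewrite /force /cross !dotE !mxE /=; ring.
have W0 : W (pk x) = 2 * s2.
  by rewrite /W pkK (_ : dot x.1 x.1 = 1)// -/s2; ring.
(* On this level of [W] one has [|q|^2 <= 2] and [|p|^2 <= 2 s^2], and [3/2] is a convenient bound
   for the square root of 2. *)
have small (z : S6) : W z = 2 * s2 -> `|z| < M.
  move=> Wz; apply: (@le_lt_trans _ _ (3 / 2 * (1 + s))); last by rewrite /M; lra.
  apply: norm_le_coord; first by rewrite mulr_ge0//; lra.
  have p0 := dot_ge0 (upk z).2; have q0 := dot_ge0 (upk z).1.
  have sq (a b : R) : 0 <= b -> a ^+ 2 <= b ^+ 2 -> `|a| <= b.
    by move=> b0 ab; rewrite -ler_sqr ?nnegrE// real_normK ?num_real.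
  have hc (v : E) i : v 0 i ^+ 2 <= dot v v.
    rewrite dotE; have := sqr_ge0 (v 0 o0); have := sqr_ge0 (v 0 o1); have := sqr_ge0 (v 0 o2).
    by move: i; apply: ord3P; rewrite !expr2; lra.
  apply: ord6P => i; apply: sq; try lra.
    rewrite -upkl; apply: (le_trans (hc _ _)).
    have : dot (upk z).1 (upk z).1 <= 2.
      by rewrite -(ler_pM2l s20); move: Wz; rewrite /W; lra.
    by nra.
  rewrite -upkr; apply: (le_trans (hc _ _)).
  have : dot (upk z).2 (upk z).2 <= 2 * s ^+ 2.
    by rewrite ss; move: Wz; rewrite /W; have := mulr_ge0 (ltW s20) q0; lra.
  by nra.
have [z [z0 sz]] : exists z, z 0 = pk x /\ solution F z.
  apply: (@solution_exists R _ F M (K + 1)) => //.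
  - by rewrite ltr_wpDl.
  - move=> a b aM bM; apply: le_trans (FL _ _ bM aM) _.
    by rewrite ler_wpM2r// lerDl.
  - exact: small.
  - move=> z e t e1 t0 z0 hz; apply: small; rewrite -W0 -z0.
    rewrite -[in RHS](mulr0 e).
    apply: (@derive_eq0_cst _ (fun r => W (z (e * r)))) => // r rt.
    apply: (dW (fun r => z (e * r)) e) => i.
    by have [_] := hz r rt.
have Wz t : W (z t) = 2 * s2.
  rewrite -W0 -z0.
  have d r : is_derive r (1 : R) (fun r => W (z r)) 0.
    by apply: (dW _ 1) => i; rewrite mul1r; exact: sz.
  have [t0|t0] := leP 0 t; first exact: (@derive_eq0_cst _ (fun r => W (z r))).
  exact/esym/(@derive_eq0_cst _ (fun r => W (z r)) t 0 (ltW t0)).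
pose y t := upk (z t).
have dy t : is_derive t (1 : R) y ((y t).2, force s2 (y t).1 (y t).2).
  apply/is_derive_pk => i; have := sz t i; rewrite /F /field6 /y.
  by rewrite (_ : (fun s => pk (upk (z s)) 0 i) = (fun s => z s 0 i))//; apply/funext => r; rewrite /pk hsubmxK.
have yz t : y t = upk (z t) by [].
clearbody y.
(* A sum of squares measuring the failure of both constraints. Its derivative is
   [2 (q . p) (W - 2 s2)], which vanishes on the level of [W] at hand. *)
have cons t : (dot (y t).1 (y t).2) ^+ 2 + s2 * (dot (y t).1 (y t).1 - 1) ^+ 2 = 0.
  pose c t := (dot (y t).1 (y t).2) ^+ 2 + s2 * (dot (y t).1 (y t).1 - 1) ^+ 2.
  have d r : is_derive r (1 : R) c 0.
    have /is_derive_pairP[d1 d2] := dy r.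
    have e1 := is_derive_dot d1 d1; have e2 := is_derive_dot d1 d2.
    rewrite /c; apply: is_derive_eq; rewrite /GRing.scale/=.
    have := Wz r; rewrite /W -yz.
    move: (y r) => [q p]; rewrite /force /cross !dotE !mxE /= => h.
    have {}h : p 0 o0 * p 0 o0 + p 0 o1 * p 0 o1 + p 0 o2 * p 0 o2 =
        2 * s2 - s2 * (q 0 o0 * q 0 o0 + q 0 o1 * q 0 o1 + q 0 o2 * q 0 o2) by rewrite -h; ring.
    apply: (@eq_trans _ _ (2 * (q 0 o0 * p 0 o0 + q 0 o1 * p 0 o1 + q 0 o2 * p 0 o2) *
      (p 0 o0 * p 0 o0 + p 0 o1 * p 0 o1 + p 0 o2 * p 0 o2 -
      (2 * s2 - s2 * (q 0 o0 * q 0 o0 + q 0 o1 * q 0 o1 + q 0 o2 * q 0 o2))))); first by ring.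
    by rewrite h subrr mulr0.
  have c0 : c 0 = 0.
    by rewrite /c yz z0 pkK Sx Tx subrr expr0n/= mulr0 addr0.
  rewrite -c0 -/(c t); have [t0|t0] := leP 0 t; first exact: derive_eq0_cst.
  by apply/esym/(derive_eq0_cst (ltW t0)).
have By t : cotangent_bundle (y t).
  have h1 := sqr_ge0 (dot (y t).1 (y t).2); have h2 := sqr_ge0 (dot (y t).1 (y t).1 - 1).
  have h3 := cons t; have h4 : s2 * (dot (y t).1 (y t).1 - 1) ^+ 2 = 0.
    by have := mulr_ge0 (ltW s20) h2; lra.
  split; apply/eqP; last by rewrite -sqrf_eq0; apply/eqP; lra.
  by move/eqP: h4; rewrite mulf_eq0 (negbTE (lt0r_neq0 s20))/= sqrf_eq0 subr_eq0.
exists y; split; last by rewrite yz z0 pkK.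
apply/integral_curveP; split=> // t.
have -> : magnetic_field (y t) = ((y t).2, force s2 (y t).1 (y t).2); last exact: dy.
rewrite /magnetic_field; congr (_, force _ _ _).
have := Wz t; rewrite /W -yz; have [-> _] := By t; lra.
Qed.

End IntegralCurves.

(** * Latitudes *)

Section Latitudes.
Context {R : realType}.
Local Notation E := 'rV[R]_3.
Local Notation S6 := 'rV[R]_(3 + 3).

Lemma field6_pk (x : E * E) :
  field6 (fun x : E * E => dot x.2 x.2) (pk x) = pk (magnetic_field x).
Proof. by rewrite /field6 pkK. Qed.

Lemma integral_curve_solution (y : R -> E * E) : integral_curve round_metric magnetic y ->
  solution (field6 (fun x : E * E => dot x.2 x.2)) (pk \o y).
Proof.
move=> /integral_curveP[_ dy] t i; rewrite /= field6_pk.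
by have /is_derive_pk := dy t.
Qed.

Lemma speed_conserved (y : R -> E * E) t : integral_curve round_metric magnetic y ->
  dot (y t).2 (y t).2 = dot (y 0).2 (y 0).2.
Proof.
move=> /integral_curveP[By dy].
have d r : is_derive r (1 : R) (fun r => dot (y r).2 (y r).2) 0.
  have /is_derive_pairP[d1 d2] := dy r.
  have dd := is_derive_dot d2 d2; apply: is_derive_eq.
  have [_] := By r; rewrite /tangent /=; move: (y r) => [q p] /=.
  rewrite /force /cross !dotE !mxE /= => h.
  apply: (@eq_trans _ _ (- 2 * (p 0 o0 * p 0 o0 + p 0 o1 * p 0 o1 + p 0 o2 * p 0 o2) *
   (q 0 o0 * p 0 o0 + q 0 o1 * p 0 o1 + q 0 o2 * p 0 o2))); first by ring.
  by rewrite h mulr0.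
have [t0|t0] := leP 0 t; first exact: derive_eq0_cst.
by apply/esym/(derive_eq0_cst (ltW t0)).
Qed.

Lemma coord_le_dot (v : E) (c : R) i : 0 <= c -> dot v v <= c ^+ 2 -> `|v 0 i| <= c.
Proof.
move=> c0 h; rewrite -ler_sqr ?nnegrE// real_normK ?num_real//; apply: le_trans h.
rewrite dotE; have := sqr_ge0 (v 0 o0); have := sqr_ge0 (v 0 o1); have := sqr_ge0 (v 0 o2).
by move: i; apply: ord3P; rewrite !expr2; lra.
Qed.

Lemma norm_pk_le (x : E * E) : cotangent_bundle x -> dot x.2 x.2 <= 2 ^+ 2 -> `|pk x| <= 2.
Proof.
move=> [Sx _] hx; apply: norm_le_coord => //; apply: ord6P => i.
  by rewrite pkl; apply: coord_le_dot => //; rewrite (_ : dot x.1 x.1 = 1)//; lra.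
by rewrite pkr; apply: coord_le_dot.
Qed.

Variables r z : R.
Hypothesis (r0 : 0 < r) (z0 : 0 < z) (rz : r ^+ 2 + z ^+ 2 = 1).

Definition latitude (t : R) : E * E :=
  (vec (r * cos (z ^+ 2 * t)) (r * sin (z ^+ 2 * t)) z,
   vec (- (r * z ^+ 2 * sin (z ^+ 2 * t))) (r * z ^+ 2 * cos (z ^+ 2 * t)) 0).

Let r2 : r ^+ 2 = 1 - z ^+ 2. Proof. by rewrite -rz addrK. Qed.

Lemma sin2 (x : R) : sin x ^+ 2 = 1 - cos x ^+ 2.
Proof. by rewrite -(cos2Dsin2 x) addrC addKr. Qed.

Lemma latitude_bundle t : cotangent_bundle (latitude t).
Proof.
have h := sin2 (z ^+ 2 * t).
by split; rewrite /sphere /tangent /= dotE !vecE; ring: h r2.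
Qed.

Lemma latitude_speed t : dot (latitude t).2 (latitude t).2 = (r * z ^+ 2) ^+ 2.
Proof. by have h := sin2 (z ^+ 2 * t); rewrite /= dotE !vecE; ring: h. Qed.

Lemma is_derive_cos_lin (w t : R) : is_derive t (1 : R) (fun t => cos (w * t)) (- (w * sin (w * t))).
Proof. by apply: is_derive_eq; rewrite /GRing.scale/=; ring. Qed.

Lemma is_derive_sin_lin (w t : R) : is_derive t (1 : R) (fun t => sin (w * t)) (w * cos (w * t)).
Proof. by apply: is_derive_eq; rewrite /GRing.scale/=; ring. Qed.

Lemma latitude_integral_curve : integral_curve round_metric magnetic latitude.
Proof.
apply/integral_curveP; split=> [|t]; first exact: latitude_bundle.
have h := sin2 (z ^+ 2 * t).
have dc := is_derive_cos_lin (z ^+ 2) t; have ds := is_derive_sin_lin (z ^+ 2) t.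
apply/is_derive_pairP; split; apply: ord3P; rewrite /= /force /cross ?mxE /=.
- under eq_fun do rewrite vec0; rewrite -[X in is_derive _ _ _ X](_ : - (r * (z ^+ 2 * sin (z ^+ 2 * t))) = _); last by rewrite mulrA.
  by apply: is_derive_eq; rewrite /GRing.scale/=; ring.
- under eq_fun do rewrite vec1; by apply: is_derive_eq; rewrite /GRing.scale/=; ring.
- under eq_fun do rewrite vec2; exact: is_derive_cst.
- under eq_fun do rewrite vec0; apply: is_derive_eq; rewrite /GRing.scale/= dotE !mxE /=; ring: h r2.
- under eq_fun do rewrite vec1; apply: is_derive_eq; rewrite /GRing.scale/= dotE !mxE /=; ring: h r2.
- under eq_fun do rewrite vec2; apply: is_derive_eq; rewrite /GRing.scale/= dotE !mxE /=; ring: h r2.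
Qed.

Lemma latitude_periodic t : latitude (t + 2 * pi / z ^+ 2) = latitude t.
Proof.
have e : z ^+ 2 * (t + 2 * pi / z ^+ 2) = z ^+ 2 * t + pi *+ 2.
  by rewrite -[pi *+ 2]mulr_natl; field; rewrite lt0r_neq0.
by rewrite /latitude e cosD2pi sinD2pi.
Qed.

Lemma latitude_closed_orbit :
  closed_orbit round_metric magnetic (2^-1 * (r * z ^+ 2) ^+ 2) latitude (2 * pi / z ^+ 2).
Proof.
split.
- by rewrite divr_gt0 ?mulr_gt0 ?pi_gt0 ?exprn_gt0.
- exact: latitude_integral_curve.
- exact: latitude_periodic.
- by move=> t; rewrite hamiltonian_round ?latitude_speed//; exact: latitude_bundle.
Qed.

Definition variational_field (x v : E * E) : E * E :=
  (v.2, dforce (dot x.2 x.2) (2 * dot x.2 v.2) x.1 x.2 v.1 v.2).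

(** * The linearized flow along a latitude and strong non-degeneracy *)

Section Jacobi.
Hypothesis r3 : 3 * r ^+ 2 < 1.

Let L := z ^+ 4 * (1 - 3 * r ^+ 2).
(** The condition [3 r^2 < 1] plays a double role: it makes the energy increase with [r], and it
    makes the transverse Jacobi equation an oscillator with this frequency. *)
Definition transverse_freq := z ^+ 2 * Num.sqrt (1 - 3 * r ^+ 2).
Local Notation Om := transverse_freq.

Let Om0 : 0 < Om.
Proof. by rewrite mulr_gt0 ?exprn_gt0// sqrtr_gt0 subr_gt0. Qed.

Let Om2 : Om ^+ 2 = L.
Proof. by rewrite /Om exprMn sqr_sqrtr ?subr_ge0 ?ltW// -exprM. Qed.

(** The oscillator [be' = al], [al' = - L * be], with initial values [y] for [be] and [x] for
    [al]. *)
Let al (x y t : R) := x * cos (Om * t) - Om * y * sin (Om * t).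
Let be (x y t : R) := y * cos (Om * t) + x / Om * sin (Om * t).

(* The infinitesimal deformations of [latitude]: along the flow ([a]), along the
   family of latitudes ([b]), and the oscillations across it ([x], [y]). *)
Definition jacobi (a b x y t : R) : E * E :=
  let c := cos (z ^+ 2 * t) in let s := sin (z ^+ 2 * t) in
  let A := al x y t in let B := be x y t in
  (vec (- (a * (r * z ^+ 2) * s) + b * (z * (c + 2 * r ^+ 2 * (t * s))) - z * A * c - z ^+ 3 * B * s)
       (a * (r * z ^+ 2) * c + b * (z * (s - 2 * r ^+ 2 * (t * c))) - z * A * s + z ^+ 3 * B * c)
       (r * A - b * r),
   vec (- (a * (r * z ^+ 4) * c) + b * (z * ((2 * r ^+ 2 - z ^+ 2) * s + 2 * r ^+ 2 * z ^+ 2 * (t * c)))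
         - 3 * r ^+ 2 * z ^+ 5 * B * c)
       (- (a * (r * z ^+ 4) * s) + b * (z * ((z ^+ 2 - 2 * r ^+ 2) * c + 2 * r ^+ 2 * z ^+ 2 * (t * s)))
         - 3 * r ^+ 2 * z ^+ 5 * B * s)
       (- (r * L * B))).

Lemma is_derive_jacobi a b x y t :
  is_derive t (1 : R) (jacobi a b x y) (variational_field (latitude t) (jacobi a b x y t)).
Proof.
have h := sin2 (z ^+ 2 * t).
have dc := is_derive_cos_lin (z ^+ 2) t; have ds := is_derive_sin_lin (z ^+ 2) t.
have dA : is_derive t (1 : R) (al x y) (- (L * be x y t)).
  have d1 := is_derive_cos_lin Om t; have d2 := is_derive_sin_lin Om t.
  rewrite /al; apply: is_derive_eq; rewrite /GRing.scale/= -Om2 /be; field; exact: lt0r_neq0.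
have dB : is_derive t (1 : R) (be x y) (al x y t).
  have d1 := is_derive_cos_lin Om t; have d2 := is_derive_sin_lin Om t.
  rewrite /be; apply: is_derive_eq; rewrite /GRing.scale/= /al; field; exact: lt0r_neq0.
rewrite /jacobi; move: (al x y) (be x y) dA dB => A B dA dB.
have r2' := r2.
apply/is_derive_pairP; split; apply: ord3P; rewrite /= /dforce /cross ?mxE /=.
- under eq_fun do rewrite vec0; apply: is_derive_eq; rewrite /GRing.scale/= /L; ring: h r2'.
- under eq_fun do rewrite vec1; apply: is_derive_eq; rewrite /GRing.scale/= /L; ring: h r2'.
- under eq_fun do rewrite vec2; apply: is_derive_eq; rewrite /GRing.scale/= /L; ring: h r2'.
- under eq_fun do rewrite vec0; apply: is_derive_eq; rewrite /GRing.scale/= !dotE !vecE /L; ring: h r2'.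
- under eq_fun do rewrite vec1; apply: is_derive_eq; rewrite /GRing.scale/= !dotE !vecE /L; ring: h r2'.
- under eq_fun do rewrite vec2; apply: is_derive_eq; rewrite /GRing.scale/= !dotE !vecE /L; ring: h r2'.
Qed.

Let d0 : 0 < 1 - 3 * r ^+ 2. Proof. by rewrite subr_gt0. Qed.
Let L0 : 0 < L. Proof. by rewrite mulr_gt0 ?exprn_gt0. Qed.
Local Notation T := (2 * pi / z ^+ 2).

(** The four parameters of the Jacobi field with initial value [v], solved from four of its six
    coordinates; tangency determines the other two. The formulas are linear in any pair [v], so
    [jacobi_of] provides a linear map on the ambient space, as [strongly_nondegenerate] requires. *)
Definition coef_b (v : E * E) := v.2 0 o1 / (z * (1 - 3 * r ^+ 2)).
Definition coef_y (v : E * E) := - (v.2 0 o2 / (r * L)).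
Definition coef_x (v : E * E) := v.1 0 o2 / r + coef_b v.
Definition coef_a (v : E * E) := (v.1 0 o1 - z ^+ 3 * coef_y v) / (r * z ^+ 2).

Definition jacobi_of (v : E * E) := jacobi (coef_a v) (coef_b v) (coef_x v) (coef_y v).

Lemma jacobi_of_linear t : linear (jacobi_of ^~ t).
Proof.
move=> k u v; rewrite /jacobi_of.
have eb : coef_b (k *: u + v) = k * coef_b u + coef_b v by rewrite /coef_b !mxE; ring.
have ey : coef_y (k *: u + v) = k * coef_y u + coef_y v by rewrite /coef_y !mxE; ring.
have ex : coef_x (k *: u + v) = k * coef_x u + coef_x v by rewrite /coef_x eb !mxE; ring.
have ea : coef_a (k *: u + v) = k * coef_a u + coef_a v by rewrite /coef_a ey !mxE; ring.
rewrite ea eb ex ey.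
move: (coef_a u) (coef_b u) (coef_x u) (coef_y u) (coef_a v) (coef_b v) (coef_x v) (coef_y v) => a b x y a' b' x' y'.
by rewrite /jacobi /al /be; congr pair; apply: ext3; rewrite /= !mxE /=; ring.
Qed.

Lemma jacobi_of0 v : tangent_cotangent (latitude 0) v -> jacobi_of v 0 = v.
Proof.
case: v => u w [/=]; rewrite !dotE !vecE !mulr0 cos0 sin0 => h1 h2.
have rn := lt0r_neq0 r0; have zn := lt0r_neq0 z0; have dn := lt0r_neq0 d0; have Ln := lt0r_neq0 L0.
have On := lt0r_neq0 Om0.
have r2' := r2.
have e1 : u 0 o0 = - (z * u 0 o2 / r).
  by apply: (mulfI rn); rewrite mulrN mulrC (mulrC r) divfK//; lra.
have e2 : w 0 o0 = - (z * w 0 o2 / r) - z ^+ 2 * u 0 o1.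
  apply: (mulfI rn); rewrite mulrBr mulrN (mulrC r (_ / r)) divfK//; lra.
have zd : z ^+ 2 - 2 * r ^+ 2 = 1 - 3 * r ^+ 2 by ring: r2'.
rewrite /jacobi_of /jacobi /al /be !mulr0 cos0 sin0.
congr pair; apply: ext3; rewrite ?vecE ?e1 ?e2 /coef_a /coef_x /coef_y /coef_b /=.
- by field; rewrite ?rn ?On ?dn ?zn ?Ln.
- by field; rewrite ?rn ?On ?dn ?zn ?Ln.
- by field; rewrite ?rn ?On ?dn ?zn ?Ln.
- by rewrite /L; field: r2'; rewrite ?rn ?On ?dn ?zn ?Ln.
- by rewrite zd; field; rewrite ?rn ?On ?dn ?zn ?Ln.
- by field; rewrite ?rn ?On ?dn ?zn ?Ln.
Qed.

Lemma cos_lt1 (x : R) : 0 < x -> x < 2 * pi -> cos x < 1.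
Proof.
move=> x0 x2; have s0 : 0 < sin (x / 2) by apply: sin_gt0_pi; rewrite ?divr_gt0//; lra.
have -> : cos x = 1 - 2 * sin (x / 2) ^+ 2.
  rewrite {1}(splitr x) cosD -!expr2; have := cos2Dsin2 (x / 2); lra.
by have := exprn_gt0 2 s0; lra.
Qed.

(** For nearby initial points the conserved speed stays positive, so integral curves exist, and at
    most 2, so they stay in the ball of radius 2 where the [C11] bounds hold. Then
    [solution_is_derive] applies with the explicit Jacobi field. *)
Lemma flow_latitude (c : R -> E * E) v : (forall s, cotangent_bundle (c s)) ->
  c 0 = latitude 0 -> is_derive (0 : R) (1 : R) c v ->
  forall t, 0 <= t ->
  is_derive (0 : R) (1 : R) (flow round_metric magnetic t \o c) (jacobi_of v t).
Proof.
move=> hc c0 dc t t0.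
have tv := tangent_of_curve hc dc; rewrite c0 in tv.
have speed0 : dot (c 0).2 (c 0).2 = (r * z ^+ 2) ^+ 2 by rewrite c0 latitude_speed.
have rz1 : 0 < r * z ^+ 2 < 1.
  by rewrite mulr_gt0 ?exprn_gt0//=; have := r2; have := sqr_ge0 (r - 1); nra.
have nspeed : \forall s \near (0 : R), 0 < dot (c s).2 (c s).2 <= 2 ^+ 2.
  have /is_derive_pairP[_ d2] := dc.
  have /derive_continuous/cvgrPdist_lt/(_ ((r * z ^+ 2) ^+ 2)) := is_derive_dot d2 d2.
  rewrite exprn_gt0; last by case/andP: rz1.
  move=> /(_ erefl); apply: filterS => s; rewrite speed0 ltr_norml => /andP[h1 h2].
  case/andP: rz1 => h3 h4; have : (r * z ^+ 2) ^+ 2 < 1 by rewrite expr_lt1// ltW.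
  by move=> h5; apply/andP; split; lra.
pose X s t := pk (flow round_metric magnetic t (c s)).
(* Existence rules out the default value of [xget]; which integral curve is chosen does not affect
   the estimate. *)
have flowP s : 0 < dot (c s).2 (c s).2 ->
   integral_curve round_metric magnetic (fun t => flow round_metric magnetic t (c s)) /\
   flow round_metric magnetic 0 (c s) = c s.
  move=> s0; have [y hy] := integral_curve_exists (hc s) s0.
  have [h1 h2] := @xgetPex _ (fun=> c s) [set y | integral_curve round_metric magnetic y /\ y 0 = c s]
    (ex_intro _ y hy).
  by split.
have Ck : C11 2 (fun w : S6 => (fun x : E * E => dot x.2 x.2) (upk w))
   (fun w (v : S6) => (fun x y : E * E => 2 * dot x.2 y.2) (upk w) (upk v)).
  have M0 : 0 <= 2 :> R by [].
  have cp j := C11_coord M0 (rshift 3 j : 'I_(3 + 3)).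
  apply: (C11_ext _ _ (C11D (C11D (C11M M0 (cp o0) (cp o0)) (C11M M0 (cp o1) (cp o1))) (C11M M0 (cp o2) (cp o2)))).
    by move=> w; rewrite dotE !upkr.
  by move=> w w'; rewrite dotE !upkr; ring.
have klin : forall (x : E * E) k (w v : S6), (fun x y : E * E => 2 * dot x.2 y.2) x (upk (k *: w + v)) =
    k * (fun x y : E * E => 2 * dot x.2 y.2) x (upk w) + (fun x y : E * E => 2 * dot x.2 y.2) x (upk v).
  by move=> x k w w'; rewrite !dotE !upkr !mxE; ring.
apply/is_derive_pk => i.
have := @solution_is_derive R (3 + 3) 2 (ler0n _ 2) _ _
  (@C11_field6 R (fun x : E * E => dot x.2 x.2) (fun x y : E * E => 2 * dot x.2 y.2) 2 (ler0n _ _) Ck)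
  (@dfield6_linear R (fun x : E * E => dot x.2 x.2) (fun x y : E * E => 2 * dot x.2 y.2) klin)
  X (pk \o latitude) (pk \o jacobi_of v) t t0.
apply.
- apply: filterS nspeed => s /andP[s0 s4]; have [ic f0] := flowP s s0; split.
    exact: integral_curve_solution ic.
  move=> t'; apply: norm_pk_le; first by have /integral_curveP[] := ic.
  by rewrite (speed_conserved t' ic) f0.
- exact: (integral_curve_solution latitude_integral_curve).
- move=> t'; apply: norm_pk_le; first exact: latitude_bundle.
  by rewrite latitude_speed; case/andP: rz1 => h1 h2; rewrite ler_pXn2r ?nnegrE//; lra.
- move=> t' j; have /is_derive_pk/(_ j) := is_derive_jacobi (coef_a v) (coef_b v) (coef_x v) (coef_y v) t'.
  by rewrite /dfield6 /comp !pkK.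
- rewrite /X /=; have [s0 _] := andP (nbhs_singleton nspeed).
  by have [_ ->] := flowP 0 s0; rewrite c0.
- move=> j; rewrite /= jacobi_of0//; have /is_derive_pk/(_ j) := dc.
  apply: near_eq_is_derive; apply: filterS nspeed => s /andP[s0 _].
  by rewrite /X; have [_ ->] := flowP s s0.
Qed.

(** Over one period the transverse oscillation turns by the angle [2 pi sqrt (1 - 3 r^2)], less than
    a full turn, so a fixed vector has [x = y = 0]. The direction of the family of latitudes is
    sheared along the orbit because the period varies, so [b = 0]. Only the flow direction [a]
    remains. *)
Lemma latitude_strongly_nondegenerate :
  strongly_nondegenerate round_metric magnetic latitude T.
Proof.
pose lM := GRing.isLinear.Build _ _ _ _ _ (jacobi_of_linear T).
pose LL : {linear (E * E)%type -> (E * E)%type} := HB.pack (jacobi_of ^~ T) lM.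
have T0 : 0 < T by rewrite divr_gt0 ?mulr_gt0 ?pi_gt0 ?exprn_gt0.
exists LL; split.
  by move=> c v hc c0 dc; apply: flow_latitude => //; exact: ltW.
have zT : z ^+ 2 * T = pi *+ 2 by rewrite -[pi *+ 2]mulr_natl; field; exact: lt0r_neq0.
have cT : cos (z ^+ 2 * T) = 1 by rewrite zT cos2pi.
have sT : sin (z ^+ 2 * T) = 0 by rewrite zT sin2pi.
have rzn : r * z ^+ 2 != 0 by rewrite lt0r_neq0// mulr_gt0// exprn_gt0.
have jE a : jacobi a 0 0 0 0 = a *: jacobi 1 0 0 0 0.
  by rewrite /jacobi /al /be; congr pair; apply: ext3; rewrite /= !mxE /=; ring.
have j01 : (jacobi 1 0 0 0 0).1 0 o1 = r * z ^+ 2.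
  by rewrite /= vec1 /al /be !mulr0 cos0 sin0; ring.
exists (fun _ => jacobi 1 0 0 0 0); split.
  move=> a; rewrite big_ord1 => /(congr1 (fun v : E * E => v.1 0 o1)) h i.
  rewrite ord1; apply/eqP; have : a ord0 * (r * z ^+ 2) = 0 by rewrite -j01; move: h; rewrite /= !mxE.
  by move/eqP; rewrite mulf_eq0 (negbTE rzn) orbF.
apply/seteqP; split=> v /=.
  move=> [tv]; have v0 := jacobi_of0 tv; rewrite -{2}v0 => /eqP; rewrite subr_eq0 => /eqP Lv.
  set a := coef_a v in v0 Lv; set b := coef_b v in v0 Lv; set x := coef_x v in v0 Lv; set y := coef_y v in v0 Lv.
  rewrite /jacobi_of -/a -/b -/x -/y in v0 Lv.
  have h1 := congr1 (fun v : E * E => v.1 0 o2) Lv; have h2 := congr1 (fun v : E * E => v.2 0 o2) Lv.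
  have h3 := congr1 (fun v : E * E => v.1 0 o1) Lv.
  rewrite /= !vecE /al /be !mulr0 cos0 sin0 ?cT ?sT in h1 h2 h3.
  have Ln := lt0r_neq0 L0; have rn := lt0r_neq0 r0; have On := lt0r_neq0 Om0.
  set CT := cos (Om * T) in h1 h2 h3; set ST := sin (Om * T) in h1 h2 h3.
  have e1 : x * CT - Om * y * ST = x by apply: (mulfI rn); lra.
  have e2 : y * CT + x / Om * ST = y by apply: (mulfI (mulf_neq0 rn Ln)); lra.
  have CT1 : CT < 1.
    have sd0 : 0 < Num.sqrt (1 - 3 * r ^+ 2) by rewrite sqrtr_gt0.
    have sd1 : Num.sqrt (1 - 3 * r ^+ 2) < 1.
      by rewrite -[ltRHS]sqrtr1 ltr_sqrt// ltrBlDr ltrDl mulr_gt0// exprn_gt0.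
    have eO : Om * T = 2 * pi * Num.sqrt (1 - 3 * r ^+ 2) by rewrite /Om; field; exact: lt0r_neq0.
    apply: cos_lt1; first exact: mulr_gt0.
    by rewrite eO -[ltRHS]mulr1 ltr_pM2l// mulr_gt0// pi_gt0.
  have CS : ST ^+ 2 = 1 - CT ^+ 2 by exact: sin2.
  (* [2 - 2 * CT] is the determinant of the transverse rotation minus the identity; [x] is
     eliminated as by Cramer's rule. *)
  have x0 : x = 0.
    have : (2 - 2 * CT) * x = 0.
      have -> : (2 - 2 * CT) * x = (1 - CT) * (x - (x * CT - Om * y * ST)) + Om * ST * (y * CT + x / Om * ST - y).
        by field: CS.
      by rewrite e1 e2 !subrr !mulr0 addr0.
    by move=> /eqP; rewrite mulf_eq0 => /orP[/eqP|/eqP//]; lra.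
  have y0 : y = 0.
    move: e2; rewrite x0 mul0r mul0r addr0 => /eqP; rewrite -subr_eq0 -{2}(mulr1 y) -mulrBr mulf_eq0.
    by move=> /orP[/eqP//|/eqP]; lra.
  (* With [x = y = 0], the second coordinate has moved by [- 2 z r^2 T b] after one period. *)
  have b0 : b = 0.
    have zn := lt0r_neq0 z0.
    have : (z * r ^+ 2 * T) * b = 0 by move: h3; rewrite x0 y0; lra.
    move=> /eqP; rewrite mulf_eq0 => /orP[|/eqP//].
    by rewrite (negbTE (lt0r_neq0 _))// mulr_gt0// mulr_gt0// exprn_gt0.
  exists (fun=> a); rewrite big_ord1.
  by rewrite -{1}v0 x0 y0 b0; exact: jE.
move=> [a ->]; rewrite big_ord1 -jE; set c := a ord0.
have cb : coef_b (jacobi c 0 0 0 0) = 0.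
  by rewrite /coef_b /= vec1 /al /be !mulr0 cos0 sin0; ring.
have cy : coef_y (jacobi c 0 0 0 0) = 0.
  by rewrite /coef_y /= vec2 /al /be !mulr0 cos0 sin0; ring.
have cx : coef_x (jacobi c 0 0 0 0) = 0.
  by rewrite /coef_x cb /= vec2 /al /be !mulr0 cos0 sin0; ring.
have ca : coef_a (jacobi c 0 0 0 0) = c.
  rewrite /coef_a cy /= vec1 /al /be !mulr0 cos0 sin0; field.
  by rewrite ?(lt0r_neq0 r0) ?(lt0r_neq0 z0) ?(lt0r_neq0 Om0).
split.
  split; rewrite /= !dotE !vecE /al /be !mulr0 cos0 sin0; ring.
apply/eqP; rewrite subr_eq0; apply/eqP.
rewrite /jacobi_of ca cb cx cy /jacobi /al /be cT sT !mulr0 cos0 sin0.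
by congr pair; apply: ext3; rewrite ?vecE; ring.
Qed.

End Jacobi.
End Latitudes.

(** * The orbit cylinder of latitudes parametrized by energy *)

Section Cylinder.
Context {R : realType}.
Local Notation E := 'rV[R]_3.

Definition energy (r : R) : R := 2^-1 * (r - r ^+ 3) ^+ 2.

Definition stable_radius : set R := [set r | 0 < r /\ 3 * r ^+ 2 < 1].

Lemma cube_lt (r : R) : stable_radius r -> r ^+ 3 < r.
Proof.
move=> [r0 r1]; rewrite -{2}(mulr1 r) exprS ltr_pM2l//.
by have := sqr_ge0 r; lra.
Qed.

(** Equal energies give [(r - s) (1 - (r^2 + r s + s^2)) = 0], and the second factor is positive for
    stable radii. *)
Lemma energy_inj r s : stable_radius r -> stable_radius s -> energy r = energy s -> r = s.
Proof.
have n2 : (2^-1 : R) != 0 by rewrite invr_neq0// pnatr_eq0.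
move=> hr hs /(mulfI n2)/eqP.
rewrite eqrXn2// ?subr_ge0 ?(ltW (cube_lt _))// => /eqP e.
case: hr hs => [r0 r1] [s0 s1].
have : (r - s) * (1 - (r ^+ 2 + r * s + s ^+ 2)) = 0.
  by rewrite -[RHS](subrr (r - r ^+ 3)) {2}e; ring.
move=> /eqP; rewrite mulf_eq0 subr_eq0 => /orP[/eqP//|/eqP].
by have := sqr_ge0 (r - s); nra.
Qed.

Lemma is_derive_energy (r : R) : is_derive r (1 : R) energy ((r - r ^+ 3) * (1 - 3 * r ^+ 2)).
Proof. by apply: is_derive_eq; rewrite /GRing.scale/=; field. Qed.

Lemma energy_surj (e : R) : 0 < e < 2 / 27 -> exists2 r, stable_radius r & energy r = e.
Proof.
(* [c] is the critical radius, where the energy takes its maximal value [2/27] on the interval of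
   stable radii closed up. *)
move=> /andP[e0 e1]; pose c : R := Num.sqrt 3^-1.
have c2 : c ^+ 2 = 3^-1 by rewrite sqr_sqrtr// invr_ge0.
have Ec : energy c = 2 / 27.
  rewrite /energy (_ : c - c ^+ 3 = c * (1 - c ^+ 2)); last by ring.
  by rewrite exprMn c2; field.
have E0 : energy 0 = 0 by rewrite /energy; ring.
have c0 : 0 <= c by exact: sqrtr_ge0.
have cE : {within `[0, c], continuous energy}.
  by apply: derivable_within_continuous => r _; have [] := is_derive_energy r.
have [|r] := @IVT R energy 0 c e c0 cE; first by rewrite E0 Ec min_l ?max_r; lra.
rewrite in_itv/= => /andP[r0 rc] Er; exists r => //; split.
  by rewrite lt_neqAle r0 andbT; apply: contraL e0 => /eqP r_; rewrite -Er -r_ E0 ltxx.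
have rc' : r < c by rewrite lt_neqAle rc andbT; apply: contraL e1 => /eqP r_; rewrite -Er r_ Ec ltxx.
have : r ^+ 2 < 3^-1 by rewrite -c2 ltr_pXn2r ?nnegrE.
by lra.
Qed.

Definition radius (e : R) : R := xget 0 [set r | stable_radius r /\ energy r = e].

Lemma radiusP (e : R) : 0 < e < 2 / 27 -> stable_radius (radius e) /\ energy (radius e) = e.
Proof.
move=> /energy_surj[r hr Er].
exact: (@xgetPex _ 0 [set r | stable_radius r /\ energy r = e] (ex_intro _ r (conj hr Er))).
Qed.

Lemma energyK (r : R) : stable_radius r -> radius (energy r) = r.
Proof.
move=> hr; have [h1 h2] := @xgetPex _ 0 [set s | stable_radius s /\ energy s = energy r]
  (ex_intro _ r (conj hr erefl)).
exact: energy_inj.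
Qed.

Lemma stable_radius_open : open stable_radius.
Proof.
have -> : stable_radius = [set r | 0 < r] `&` ((fun r : R => 3 * r ^+ 2) @^-1` [set x | x < 1]) by [].
apply: openI; first exact: open_gt.
apply: open_comp; last exact: open_lt.
by move=> r _; apply: cvgM; [exact: cvg_cst|exact: exprn_continuous].
Qed.

Lemma energy_lt (r : R) : stable_radius r -> 0 < energy r < 2 / 27.
Proof.
move=> hr; have r2 := sqr_ge0 r; have [r0 r1] := hr.
have r3 : 0 < r - r ^+ 3 by rewrite subr_gt0; exact: cube_lt.
rewrite /energy mulr_gt0 ?exprn_gt0//=.
(* As a cubic in [r^2], the difference from the critical value has a double root at [1/3]. *)
have -> : (r - r ^+ 3) ^+ 2 = 4 / 27 - (3^-1 - r ^+ 2) ^+ 2 * (4 / 3 - r ^+ 2) by field.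
have : 0 < (3^-1 - r ^+ 2) ^+ 2 * (4 / 3 - r ^+ 2) by rewrite mulr_gt0 ?exprn_gt0//; lra.
by lra.
Qed.

Lemma is_derive_radius (e : R) : 0 < e < 2 / 27 ->
  is_derive e (1 : R) radius
    (((radius e - radius e ^+ 3) * (1 - 3 * radius e ^+ 2))^-1).
Proof.
move=> /radiusP[[r0 r1] {1}<-].
have op := stable_radius_open.
apply: is_derive_inverse.
- by apply: filterS (open_nbhs_nbhs (conj op (conj r0 r1))) => r /energyK.
- suff h : forall r : R, {for r, continuous energy} by exact: (@filterE _ (nbhs (radius e)) _ _ h).
  by move=> r; have [d _] := is_derive_energy r; apply: differentiable_continuous; apply/derivable1_diffP.
- exact: is_derive_energy.
- by rewrite mulf_neq0// lt0r_neq0 ?subr_gt0//; exact: cube_lt.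
Qed.

Lemma Ck_subset (V W : normedModType R) (U U' : set V) (f : V -> W) n :
  U `<=` U' -> Ck_on U' n f -> Ck_on U n f.
Proof.
move=> sU; elim: n f => [|n ih] f /=; first by move=> h x /sU /h.
by move=> [h1 h2]; split=> [x /sU/h1//|v]; exact: ih.
Qed.

Lemma smooth_vec (V : normedModType R) (U : set V) (a b c : V -> R) : open U ->
  smooth_on U a -> smooth_on U b -> smooth_on U c -> smooth_on U (fun x => vec (a x) (b x) (c x)).
Proof.
move=> oU ha hb hc; apply: smooth_mx => // i; apply: ord3P.
- by apply: (smooth_ext oU _ ha) => x _; rewrite mxE.
- by apply: (smooth_ext oU _ hb) => x _; rewrite mxE.
- by apply: (smooth_ext oU _ hc) => x _; rewrite mxE.
Qed.

Lemma smooth_pow (V : normedModType R) (U : set V) (f : V -> R) n : open U ->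
  smooth_on U f -> smooth_on U (fun x => f x ^+ n).
Proof.
move=> oU hf; elim: n => [|n ih].
  by under eq_fun do rewrite expr0; exact: smooth_cst.
by under eq_fun do rewrite exprS; exact: smoothM.
Qed.

Definition height (r : R) : R := Num.sqrt (1 - r ^+ 2).

Lemma height_gt0 (r : R) : stable_radius r -> 0 < height r.
Proof. by move=> [_ r1]; rewrite sqrtr_gt0; have := sqr_ge0 r; lra. Qed.

Lemma height2 (r : R) : stable_radius r -> height r ^+ 2 = 1 - r ^+ 2.
Proof. by move=> [_ r1]; rewrite sqr_sqrtr//; have := sqr_ge0 r; lra. Qed.

Lemma stable_closed_orbit (r : R) : stable_radius r ->
  closed_orbit round_metric magnetic (energy r) (latitude r (height r)) (2 * pi / height r ^+ 2).
Proof.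
move=> hr; rewrite (_ : energy r = 2^-1 * (r * height r ^+ 2) ^+ 2).
  by apply: latitude_closed_orbit; [exact: height_gt0|rewrite height2// addrC subrK].
by rewrite height2// /energy; congr (_ * _ ^+ 2); ring.
Qed.

Let A : set R := [set e | 0 < e < 2 / 27].

Let A_open : open A.
Proof.
have -> : A = [set e | 0 < e] `&` [set e | e < 2 / 27].
  by apply/seteqP; split=> e; [move=> /andP|move=> [h1 h2]; apply/andP].
by apply: openI; [exact: open_gt|exact: open_lt].
Qed.

(** The derivative of the inverse function is a smooth expression of [radius] itself, so
    [smooth_ode] applies. *)
Lemma smooth_radius : smooth_on A radius.
Proof.
apply: (@smooth_ode _ _ _ (fun r => ((r - r ^+ 3) * (1 - 3 * r ^+ 2))^-1) A_open).
- move=> e; rewrite inE => /is_derive_radius[d _].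
  by apply: differentiable_continuous; apply/derivable1_diffP.
- by move=> e; exact: is_derive_radius.
- move=> n hn.
  pose p (r : R) : R := (r - r ^+ 3) * (1 - 3 * r ^+ 2).
  apply: (@Ck_comp _ _ A stable_radius n (fun r => (p r)^-1) _ A_open) hn; last first.
    by move=> e /radiusP[].
  apply: (smooth_comp stable_radius_open smooth_inv).
    by move=> r hr; have [r0 r1] := hr; rewrite /= mulr_gt0 ?subr_gt0//; exact: cube_lt.
  have op := stable_radius_open.
  have si : smooth_on stable_radius (fun r : R => r) by apply: (@smooth_linear R R R _ idfun) => x; exact: cvg_id.
  apply: smoothM => //; apply: smoothB => //; first exact: smooth_pow.
    exact: smooth_cst.
  by apply: smoothM => //; [exact: smooth_cst|exact: smooth_pow].
Qed.

Lemma latitude_correction_term (r : R) : stable_radius r ->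
  correction_term round_metric magnetic (energy r) (latitude r (height r))
    (2 * pi / height r ^+ 2) (-1).
Proof.
move=> hr; have /andP[E0 E1] := energy_lt hr.
(* The energies of the cylinder stay inside [(0, 2/27)], the range over which [radius] inverts
   [energy]. *)
pose eps := Num.min (energy r) (2 / 27 - energy r).
have hA e : `|e - energy r| < eps -> A e.
  by rewrite lt_min !ltr_norml /A/= => /andP[/andP[h1 h2] /andP[h3 h4]]; apply/andP; split; lra.
have oA (V : normedModType R) (f : V -> R) : continuous f -> open [set x | `|f x - energy r| < eps].
  move=> cf; apply: (@open_comp _ _ (fun x => `|f x - energy r|) [set u | u < eps]); last exact: open_lt.
  by move=> x _; apply: cvg_norm; apply: cvgB; [exact: cf|exact: cvg_cst].
pose P e : R := 2 * pi / height (radius e) ^+ 2.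
pose Y e := latitude (radius e) (height (radius e)).
exists eps, Y, P; split; last first.
  (* On this range [height ^+ 2] is [1 - radius ^+ 2], so no square root has to be
     differentiated. *)
  have hP : \forall e \near energy r, 2 * pi / (1 - radius e ^+ 2) = P e.
    apply: filterS (open_nbhs_nbhs (conj A_open (energy_lt hr))) => e /radiusP[he _].
    by rewrite /P height2.
  have dr := is_derive_radius (energy_lt hr); rewrite energyK// in dr.
  have n0 : 1 - radius (energy r) ^+ 2 != 0 by rewrite energyK// -height2// expf_neq0// lt0r_neq0// height_gt0.
  set l := (_^-1) in dr.
  have dP : is_derive (energy r) (1 : R) P (2 * pi * ((1 - r ^+ 2) ^- 2 * (2 * r * l))).
    apply: near_eq_is_derive hP _.
    apply: is_derive_eq; rewrite /GRing.scale/= energyK//; ring.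
  rewrite derive1E; have [_ ->] := dP.
  apply: ltr0_sg; rewrite oppr_lt0.
  have [r0 r1] := hr.
  have h1 : 0 < 1 - r ^+ 2 by rewrite -height2// exprn_gt0// height_gt0.
  have l0 : 0 < l by rewrite invr_gt0 mulr_gt0 ?subr_gt0//; exact: cube_lt.
  by do ?[apply: mulr_gt0] => //; rewrite ?pi_gt0 ?invr_gt0 ?exprn_gt0//; case: hr.
split.
- by rewrite lt_min E0 subr_gt0.
- by rewrite /Y energyK.
- by rewrite /P energyK.
- by move=> e /hA/radiusP[he {1}<-]; exact: stable_closed_orbit.
have o1 := oA _ id (fun x => cvg_id); split.
  apply: (@smooth_ext _ _ _ _ (fun e => 2 * pi * (1 - radius e ^+ 2)^-1)) => //.
    by move=> e /hA/radiusP[he _]; rewrite /P height2.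
  have sr : smooth_on [set e : R | `|e - energy r| < eps] radius.
    by move=> n; apply: Ck_subset (smooth_radius n).
  apply: smoothM => //; first exact: smooth_cst.
  apply: (smooth_comp o1 smooth_inv).
    by move=> e /hA/radiusP[he _]; rewrite /= -height2// exprn_gt0// height_gt0.
  by apply: smoothB => //; [exact: smooth_cst|exact: smooth_pow].
set B := [set x : R * R | _].
have oB : open B by apply: (oA _ fst) => x; exact: cvg_fst.
have sr : smooth_on B (fun x => radius x.1).
  move=> n; apply: (@Ck_subset _ _ _ (fst @^-1` A)); first by move=> x /hA.
  apply: (Ck_comp _ smooth_radius) => //.
    by apply: open_comp A_open => x _; exact: cvg_fst.
  exact: smooth_fst.
have sz : smooth_on B (fun x => height (radius x.1)).
  apply: (smooth_comp oB smooth_sqrt).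
    by move=> x /hA/radiusP[he _]; rewrite /= -height2// exprn_gt0// height_gt0.
  by apply: smoothB => //; [exact: smooth_cst|exact: smooth_pow].
have sw : smooth_on B (fun x => height (radius x.1) ^+ 2 * x.2).
  by apply: smoothM => //; [exact: smooth_pow|exact: smooth_snd].
have sc := smooth_comp oB smooth_cos (fun _ _ => I) sw.
have ss := smooth_comp oB smooth_sin (fun _ _ => I) sw.
have sM := smoothM oB sr (smooth_pow 2 oB sz).
rewrite /Y /latitude; apply: smooth_pair => //; apply: smooth_vec => //.
- exact: smoothM.
- exact: smoothM.
- by apply: smoothN => //; exact: smoothM.
- exact: smoothM.
- exact: smooth_cst.
Qed.

End Cylinder.

(** * Paths of loops and Stokes' theorem *)

Section PathCalculus.
Context {R : realType}.
Local Notation leb := (@lebesgue_measure R).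
Local Notation I01 := (`[0%R, 1%R]%classic : set R).
Implicit Types (F G : R -> R -> R) (f g : R -> R).

(** Uniform convergence, for the values of a path of loops, and below L^2 convergence, for its weak
    derivatives. Unlike the W^{1,2} norm, this pair of notions behaves well under products: uniform
    times uniform is uniform, uniform times L^2 is L^2. *)
Definition cvS F f := [/\ forall e, Bm (F e), Bm f &
  forall eps : R, 0 < eps -> \forall e \near 0^', forall t, I01 t -> `|F e t - f t| <= eps].

Definition cvL F f := [/\ forall e, L2 (F e), L2 f &
  forall eps : R, 0 < eps -> \forall e \near 0^', ing (fun t => (F e t - f t) ^+ 2) <= eps].

Lemma cvS_ext F G f g : (forall e t, F e t = G e t) -> (forall t, f t = g t) -> cvS F f -> cvS G g.
Proof.
move=> h1 h2; have -> : G = F by apply/funext => e; apply/funext => t.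
by have -> : g = f by apply/funext => t.
Qed.

Lemma cvL_ext F G f g : (forall e t, F e t = G e t) -> (forall t, f t = g t) -> cvL F f -> cvL G g.
Proof.
move=> h1 h2; have -> : G = F by apply/funext => e; apply/funext => t.
by have -> : g = f by apply/funext => t.
Qed.

Lemma cvS_cst f : Bm f -> cvS (fun=> f) f.
Proof.
move=> hf; split=> // eps e0; apply: filterE => e t _.
by rewrite subrr normr0 ltW.
Qed.

Lemma cvL_cst f : L2 f -> cvL (fun=> f) f.
Proof.
move=> hf; split=> // eps e0; apply: filterE => e.
rewrite (@ing_ext _ _ (fun=> 0)) ?ing_cst ?ltW//.
by move=> t _; rewrite subrr expr0n.
Qed.

Lemma cvS_fun (c : R -> R) (l : R) : c @ 0^' --> l -> cvS (fun e _ => c e) (fun _ => l).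
Proof.
move=> /cvgrPdist_le h; split=> [e||eps e0]; try exact: Bm_cst.
by apply: filterS (h _ e0) => e he t _; rewrite distrC.
Qed.

Lemma cvSD F f G g : cvS F f -> cvS G g -> cvS (fun e t => F e t + G e t) (fun t => f t + g t).
Proof.
move=> [F1 f1 hF] [G1 g1 hG]; split=> [e||eps e0]; try exact: BmD.
have e2 : 0 < eps / 2 by rewrite divr_gt0.
apply: filterS2 (hF _ e2) (hG _ e2) => e h1 h2 t ht.
have := h1 t ht; have := h2 t ht; rewrite opprD addrACA => k1 k2.
by apply: le_trans (ler_normD _ _) _; lra.
Qed.

Lemma cvSM F f G g : cvS F f -> cvS G g -> cvS (fun e t => F e t * G e t) (fun t => f t * g t).
Proof.
move=> [F1 f1 hF] [G1 g1 hG]; split=> [e||eps e0]; try exact: BmM.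
have [_ [M hM]] := f1; have [_ [N hN]] := g1.
have M0 : 0 <= M by apply: le_trans (hM _ (I01_0)).
have N0 : 0 <= N by apply: le_trans (hN _ (I01_0)).
pose a := Num.min 1 (eps / (M + N + 1)).
have MN : 0 < M + N + 1 by lra.
have a0 : 0 < a by rewrite lt_min ltr01 divr_gt0.
have a1 : a <= 1 by rewrite ge_min lexx.
have a2 : a * (M + N + 1) <= eps by rewrite -ler_pdivlMr// ge_min lexx orbT.
apply: filterS2 (hF _ a0) (hG _ a0) => e h1 h2 t ht.
have k1 := h1 t ht; have k2 := h2 t ht; have k3 := hM t ht; have k4 := hN t ht.
rewrite (_ : _ - _ = (F e t - f t) * (G e t - g t) + (F e t - f t) * g t + f t * (G e t - g t)); last by ring.
apply: le_trans (ler_normD _ _) _; apply: le_trans (lerD (ler_normD _ _) (lexx _)) _.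
rewrite !normrM.
have l1 := ler_pM (normr_ge0 _) (normr_ge0 _) k1 (le_trans k2 a1).
have l2 := ler_pM (normr_ge0 _) (normr_ge0 _) k1 k4.
have l3 := ler_pM (normr_ge0 _) (normr_ge0 _) k3 k2.
lra.
Qed.

Lemma cvLD F f G g : cvL F f -> cvL G g -> cvL (fun e t => F e t + G e t) (fun t => f t + g t).
Proof.
move=> [F1 f1 hF] [G1 g1 hG]; split=> [e||eps e0]; try exact: L2D.
have e2 : 0 < eps / 4 by rewrite divr_gt0.
apply: filterS2 (hF _ e2) (hG _ e2) => e h1 h2.
have [_ l1] := L2B (F1 e) f1; have [_ l2] := L2B (G1 e) g1.
apply: (@le_trans _ _ (ing (fun t => 2 * (F e t - f t) ^+ 2 + 2 * (G e t - g t) ^+ 2))).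
  apply: ing_le.
  - by have [] := L2B (L2D (F1 e) (G1 e)) (L2D f1 g1).
  - by apply: L1D; exact: L1Z.
  - by move=> t _; have := sqr_ge0 ((F e t - f t) - (G e t - g t)); lra.
rewrite ingD ?ingZ//; try exact: L1Z.
lra.
Qed.

Lemma cvSL F f G g : cvS F f -> cvL G g -> cvL (fun e t => F e t * G e t) (fun t => f t * g t).
Proof.
move=> [F1 f1 hF] [G1 g1 hG]; split=> [e||eps e0]; try exact: L2M.
have [_ [M hM]] := f1.
have M0 : 0 <= M by apply: le_trans (hM _ (I01_0)).
pose N := ing (fun t => g t ^+ 2).
have N0 : 0 <= N by apply: ing_ge0 => t _; exact: sqr_ge0.
have p1 : 0 < 4 * (N + 1) by lra.
have p2 : 0 < 4 * (M + 1) ^+ 2 by rewrite mulr_gt0// exprn_gt0//; lra.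
pose a := Num.min 1 (eps / (4 * (N + 1))).
have a0 : 0 < a by rewrite lt_min ltr01 divr_gt0.
have a1 : a <= 1 by rewrite ge_min lexx.
have a2 : a * (4 * (N + 1)) <= eps by rewrite -ler_pdivlMr// ge_min lexx orbT.
have b0 : 0 < eps / (4 * (M + 1) ^+ 2) by rewrite divr_gt0.
apply: filterS2 (hF _ a0) (hG _ b0) => e h1 h2.
have [_ l1] := g1; have [_ l2] := L2B (G1 e) g1.
apply: (@le_trans _ _ (ing (fun t => 2 * a * g t ^+ 2 + 2 * (M + 1) ^+ 2 * (G e t - g t) ^+ 2))).
  apply: ing_le.
  - by have [] := L2B (L2M (F1 e) (G1 e)) (L2M f1 g1).
  - by apply: L1D; exact: L1Z.
  - move=> t ht; have k1 := h1 t ht; have k2 := hM t ht.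
    have k3 : (F e t - f t) ^+ 2 <= a.
      rewrite -real_normK ?num_real// expr2.
      by apply: le_trans (ler_pM (normr_ge0 _) (normr_ge0 _) k1 (le_trans k1 a1)) _; rewrite mulr1.
    have k4 : F e t ^+ 2 <= (M + 1) ^+ 2.
      rewrite -(real_normK (num_real (F e t))) ler_pXn2r ?nnegrE//; last lra.
      by rewrite -(subrK (f t) (F e t)); apply: le_trans (ler_normD _ _) _; lra.
    have k5 := ler_wpM2r (sqr_ge0 (g t)) k3.
    have k6 := ler_wpM2r (sqr_ge0 (G e t - g t)) k4.
    have := sqr_ge0 ((F e t - f t) * g t - F e t * (G e t - g t)); lra.
rewrite ingD ?ingZ//; try exact: L1Z.
rewrite -/N; move: h2; rewrite ler_pdivlMr//; lra.
Qed.

Lemma cvL_ing F f : cvL F f -> (fun e => ing (F e)) @ 0^' --> ing f.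
Proof.
move=> [F1 f1 hF]; apply/cvgrPdist_le => eps e0.
have e2 : 0 < eps ^+ 2 by rewrite exprn_gt0.
apply: filterS (hF _ e2) => e he; rewrite distrC.
rewrite -ingB; [|exact: L2_L1|exact: L2_L1].
rewrite -ler_sqr ?nnegrE ?(ltW e0)// real_normK ?num_real//.
apply: le_trans he; have := @inab_CS R 0 1 _ (lexx _) ler01 (lexx _) (L2B (F1 e) f1).
by rewrite subr0 mul1r !inab01.
Qed.

Lemma cvSN F f : cvS F f -> cvS (fun e t => - F e t) (fun t => - f t).
Proof.
move=> h; apply: cvS_ext (cvSM (cvS_cst (Bm_cst (-1))) h) => [e t|t] /=; exact: mulN1r.
Qed.

Lemma cvLN F f : cvL F f -> cvL (fun e t => - F e t) (fun t => - f t).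
Proof.
move=> h; apply: cvL_ext (cvSL (cvS_cst (Bm_cst (-1))) h) => [e t|t] /=; exact: mulN1r.
Qed.

Section Paths.
Variable s : R.
Implicit Types (x y u v : R -> R -> R).

Definition dS x x' := cvS (fun e t => e^-1 * (x (s + e) t - x s t)) (x' s).
Definition dL u u' := cvL (fun e t => e^-1 * (u (s + e) t - u s t)) (u' s).
Definition cS x := cvS (fun e => x (s + e)) (x s).
Definition cL u := cvL (fun e => u (s + e)) (u s).

Lemma cvS_id : cvS (fun e _ => e) (fun _ => 0).
Proof. by apply: cvS_fun; exact: nbhs_dnbhs. Qed.

Lemma dS_cS x x' : Bm (x s) -> dS x x' -> cS x.
Proof.
move=> xs h; have := cvSD (cvS_cst xs) (cvSM cvS_id h).
apply: cvS_ext => [e t|t] /=; last by rewrite mul0r addr0.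
have [->|e0] := eqVneq e 0; first by rewrite mul0r !addr0.
by rewrite mulVKf// addrC subrK.
Qed.

Lemma dL_cL u u' : L2 (u s) -> dL u u' -> cL u.
Proof.
move=> xs h; have := cvLD (cvL_cst xs) (cvSL cvS_id h).
apply: cvL_ext => [e t|t] /=; last by rewrite mul0r addr0.
have [->|e0] := eqVneq e 0; first by rewrite mul0r !addr0.
by rewrite mulVKf// addrC subrK.
Qed.

Lemma dSD x x' y y' : dS x x' -> dS y y' -> dS (fun s t => x s t + y s t) (fun s t => x' s t + y' s t).
Proof. by move=> hx hy; apply: cvS_ext (cvSD hx hy) => e // t; ring. Qed.

Lemma dLD x x' y y' : dL x x' -> dL y y' -> dL (fun s t => x s t + y s t) (fun s t => x' s t + y' s t).
Proof. by move=> hx hy; apply: cvL_ext (cvLD hx hy) => e // t; ring. Qed.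

Lemma dSM x x' y y' : Bm (x s) -> cS y -> dS x x' -> dS y y' ->
  dS (fun s t => x s t * y s t) (fun s t => x' s t * y s t + x s t * y' s t).
Proof.
move=> bx cy hx hy.
by apply: cvS_ext (cvSD (cvSM hx cy) (cvSM (cvS_cst bx) hy)) => e // t; ring.
Qed.

Lemma dSL x x' u u' : Bm (x s) -> cL u -> dS x x' -> dL u u' ->
  dL (fun s t => x s t * u s t) (fun s t => x' s t * u s t + x s t * u' s t).
Proof.
move=> bx cy hx hy.
by apply: cvL_ext (cvLD (cvSL hx cy) (cvSL (cvS_cst bx) hy)) => e // t; ring.
Qed.

Lemma dL_ing u u' : (forall s, L1 (u s)) -> dL u u' ->
  is_derive s (1 : R) (fun s => ing (u s)) (ing (u' s)).
Proof.
move=> u1 /cvL_ing h.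
have {}h : (fun e : R => e^-1 *: (((fun s => ing (u s)) \o shift s) (e *: (1 : R)) - ing (u s))) @ 0^' --> ing (u' s).
  apply: cvg_trans h; apply: near_eq_cvg; apply: filterE => e /=.
  rewrite /GRing.scale/= mulr1 [e + s]addrC -ingB// -ingZ//; exact: L1B.
by apply: DeriveDef; [apply/cvg_ex; exists (ing (u' s))|exact: cvg_lim].
Qed.

End Paths.
End PathCalculus.

(** * Algebra of C^1 paths of W^{1,2} functions and Stokes' theorem for the magnetic form *)

Section Stokes.
Context {R : realType}.
Implicit Types x u y v : R -> R -> R.

(* [x' s] is the velocity at [s] of the C^1 path [x] of W^{1,2} functions; [u s]
   and [u' s] are the weak derivatives of [x s] and [x' s]. *)
Definition wpath x u x' u' := forall s : R,
  [/\ wd (x s) (u s), wd (x' s) (u' s), dS s x x', dL s u u' & cS s x' /\ cL s u'].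

Lemma wpath_cS x u x' u' s : wpath x u x' u' -> cS s x.
Proof. by move=> /(_ s)[/wd_Bm h _ /(dS_cS h)]. Qed.

Lemma wpath_cL x u x' u' s : wpath x u x' u' -> cL s u.
Proof. by move=> /(_ s)[[h _] _ _ /(dL_cL h)]. Qed.

Lemma wpath_ext x u x' u' y v y' v' : (forall s t, x s t = y s t) -> (forall s t, u s t = v s t) ->
  (forall s t, x' s t = y' s t) -> (forall s t, u' s t = v' s t) -> wpath x u x' u' -> wpath y v y' v'.
Proof.
move=> h1 h2 h3 h4.
have -> : y = x by apply/funext => s; apply/funext => t.
have -> : v = u by apply/funext => s; apply/funext => t.
have -> : y' = x' by apply/funext => s; apply/funext => t.
by have -> : v' = u' by apply/funext => s; apply/funext => t.
Qed.

Lemma wpathD x u x' u' y v y' v' : wpath x u x' u' -> wpath y v y' v' ->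
  wpath (fun s t => x s t + y s t) (fun s t => u s t + v s t)
    (fun s t => x' s t + y' s t) (fun s t => u' s t + v' s t).
Proof.
move=> hx hy s; have [x1 x2 x3 x4 [x5 x6]] := hx s; have [y1 y2 y3 y4 [y5 y6]] := hy s.
split; [exact: wdD|exact: wdD|exact: dSD|exact: dLD|].
by split; [exact: cvSD|exact: cvLD].
Qed.

Lemma wpathM x u x' u' y v y' v' : wpath x u x' u' -> wpath y v y' v' ->
  wpath (fun s t => x s t * y s t) (fun s t => x s t * v s t + y s t * u s t)
    (fun s t => x' s t * y s t + x s t * y' s t)
    (fun s t => (x' s t * v s t + y s t * u' s t) + (x s t * v' s t + y' s t * u s t)).
Proof.
move=> hx hy s; have [x1 x2 x3 x4 [x5 x6]] := hx s; have [y1 y2 y3 y4 [y5 y6]] := hy s.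
have cx := wpath_cS s hx; have cy := wpath_cS s hy; have lu := wpath_cL s hx; have lv := wpath_cL s hy.
have bx := wd_Bm x1; have bY := wd_Bm y1.
split; [exact: wdM|by apply: wdD; exact: wdM|exact: dSM| |].
  by apply: cvL_ext (dLD (dSL bx lv x3 y4) (dSL bY lu y3 x4)) => [e t|t]; ring.
split; first by apply: cvSD; exact: cvSM.
by apply: cvLD; apply: cvLD; exact: cvSL.
Qed.

Lemma wpath_stationary (f w : R -> R) : wd f w ->
  wpath (fun=> f) (fun=> w) (fun _ _ => 0) (fun _ _ => 0).
Proof.
move=> h s; have b0 := Bm_cst (0 : R); have l0 := Bm_L2 b0; split=> //.
- exact: wd_cst.
- by apply: cvS_ext (cvS_cst b0) => // e t; rewrite subrr mulr0.
- by apply: cvL_ext (cvL_cst l0) => // e t; rewrite subrr mulr0.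
- by split; [exact: cvS_cst|exact: cvL_cst].
Qed.

Lemma wpath_scalar (l l' : R -> R) : (forall s : R, is_derive s (1 : R) l (l' s)) -> continuous l' ->
  wpath (fun s _ => l s) (fun _ _ => 0) (fun s _ => l' s) (fun _ _ => 0).
Proof.
move=> dl cl s; have b0 := Bm_cst (0 : R); have l0 := Bm_L2 b0; split=> //.
- exact: wd_cst.
- exact: wd_cst.
- apply: cvS_fun; have [d1 d2] := dl s; rewrite -d2.
  have e1 : (fun e => e^-1 * (l (s + e) - l s)) = (fun h : R => h^-1 *: ((l \o shift s) (h *: (1 : R)) - l s)).
    by apply/funext => e /=; rewrite /GRing.scale/= mulr1 [e + s]addrC.
  by rewrite e1; exact: d1.
- by apply: cvL_ext (cvL_cst l0) => // e t; rewrite subrr mulr0.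
- split; last exact: cvL_cst.
  have h : (fun e => l' (s + e)) @ (0 : R) --> l' (s + 0).
    by apply: (@continuous_comp _ _ _ (fun e => s + e) l'); [apply: cvgD; [exact: cvg_cst|exact: cvg_id]|exact: cl].
  rewrite addr0 in h; apply: cvS_fun.
  exact: cvg_trans (cvg_app _ (@nbhs_dnbhs _ (0 : R))) h.
Qed.

Lemma wpathV x u x' u' (m : R) : 0 < m -> (forall s t, m <= x s t) -> wpath x u x' u' ->
  wpath (fun s t => (x s t)^-1) (fun s t => - (x s t) ^- 2 * u s t)
    (fun s t => - (x' s t * (x s t) ^- 2))
    (fun s t => 2 * (x s t) ^- 3 * u s t * x' s t - (x s t) ^- 2 * u' s t).
Proof.
move=> m0 mx hx s; have [x1 x2 x3 x4 [x5 x6]] := hx s.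
have x0 r t : x r t != 0 by apply: lt0r_neq0; exact: lt_le_trans (mx r t).
have hg r : wd (fun t => (x r t)^-1) (fun t => - (x r t) ^- 2 * u r t).
  by have [h _ _ _ _] := hx r; apply: (@wd_inv R _ _ m).
have hg2 r : wd (fun t => (x r t) ^- 2) (fun t => - 2 * (x r t) ^- 3 * u r t).
  apply: wd_ext (wdM (hg r) (hg r)) => t _; first by field; rewrite x0.
  by field; rewrite x0.
have bg r := wd_Bm (hg r).
have cx := wpath_cS s hx; have lu := wpath_cL s hx.
have cg : cS s (fun r t => (x r t)^-1).
  case: cx => [X1 X2 X3]; split=> [e||eps e0]; try exact: bg.
  have em : 0 < eps * m ^+ 2 by rewrite mulr_gt0// exprn_gt0.
  apply: filterS (X3 _ em) => e h t ht.
  have -> : (x (s + e) t)^-1 - (x s t)^-1 = (x s t - x (s + e) t) / (x (s + e) t * x s t).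
    by field; rewrite !x0.
  have p1 := lt_le_trans m0 (mx (s + e) t); have p2 := lt_le_trans m0 (mx s t).
  rewrite normrM distrC normfV (gtr0_norm (mulr_gt0 p1 p2)) ler_pdivrMr ?mulr_gt0//.
  apply: le_trans (h t ht) _; rewrite ler_pM2l// expr2; apply: ler_pM => //; exact: ltW.
have dg : dS s (fun r t => (x r t)^-1) (fun r t => - (x' r t * (x r t) ^- 2)).
  apply: cvS_ext (cvSN (cvSM x3 (cvSM cg (cvS_cst (bg s))))) => [e t|t].
    have [->|e0] := eqVneq e 0; first by rewrite invr0 !mul0r oppr0.
    by field; rewrite !x0 e0.
  by field; rewrite x0.
have bg2 := wd_Bm (hg2 s).
have dg2 : dS s (fun r t => (x r t) ^- 2) (fun r t => - 2 * (x r t) ^- 3 * x' r t).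
  by apply: cvS_ext (dSM (bg s) cg dg dg) => [e t|t]; rewrite -!exprVn; ring.
have cg2 := dS_cS bg2 dg2.
split=> //.
- apply: wd_ext (wdZ (-1) (wdM x2 (hg2 s))) => t _; first by rewrite mulN1r.
  by field; rewrite x0.
- apply: cvL_ext (cvLN (dSL bg2 lu dg2 x4)) => [e t|t]; first by ring.
  by field; rewrite x0.
split; first by apply: cvS_ext (cvSN (cvSM x5 cg2)).
have b3 := cvSM cg cg2.
apply: cvL_ext (cvLD (cvSL (cvSM (cvSM (cvS_cst (Bm_cst 2)) b3) x5) lu) (cvLN (cvSL cg2 x6))) => [e t|t];
  by rewrite -!exprVn; ring.
Qed.

Variables x u x' u' y v y' v' : R -> R -> R.
Hypothesis (hx : wpath x u x' u') (hy : wpath y v y' v').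
Hypothesis (px : forall s, x s 1 = x s 0) (px' : forall s, x' s 1 = x' s 0).
Hypothesis (py : forall s, y s 1 = y s 0) (py' : forall s, y' s 1 = y' s 0).

(** The line integral of [potential] along the plane loop [(a, b)] with velocity [(w, z)]. *)
Definition area (a w b z : R -> R) : R :=
  ing (fun t => ((a t * a t + b t * b t) / 4 - 2^-1) * (a t * z t - b t * w t)).

(** The first variation of a line integral is the flux of the differential of the form swept by the
    velocity, up to an exact term which vanishes on closed loops. *)
Lemma is_derive_area s : is_derive s (1 : R) (fun s => area (x s) (u s) (y s) (v s))
  (- ing (fun t => (1 - x s t * x s t - y s t * y s t) * (v s t * x' s t - u s t * y' s t))).
Proof.
have c0 := wpath_stationary (wd_cst (- 2^-1)); have c4 := wpath_stationary (wd_cst (4^-1)).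
have cm := wpath_stationary (wd_cst (-1)).
have hF := wpathD (wpathM (wpathD (wpathM hx hx) (wpathM hy hy)) c4) c0.
have [F1 F2 F3 F4 [F5 F6]] := hF s; have [x1 x2 x3 x4 [x5 x6]] := hx s; have [y1 y2 y3 y4 [y5 y6]] := hy s.
have hn := wpathM cm hy.
have [_ _ n3 _ _] := hn s; have cn := wpath_cS s hn; have bn := cn.
have cx := wpath_cS s hx; have lu := wpath_cL s hx; have lv := wpath_cL s hy.
have bx := wd_Bm x1; have [_ {}bn _] := cn.
have L2u r : L2 (u r) by have [[]] := hx r.
have L2v r : L2 (v r) by have [_ _ _ _ _] := hy r; have [[]] := hy r.
have bmx r : Bm (x r) by have [/wd_Bm] := hx r.
have bmy r : Bm (y r) by have [/wd_Bm] := hy r.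
have bmF r := wd_Bm (let: And5 h _ _ _ _ := hF r in h).
have := dL_ing _ (dSL (wd_Bm F1) (cvLD (cvSL cx lv) (cvSL cn lu)) F3 (dLD (dSL bx lv x3 y4) (dSL bn lu n3 x4))).
have h0 r : L2 (fun t => x r t * v r t + -1 * y r t * u r t).
  by apply: L2D; apply: L2M => //; exact: BmZ.
move=> /(_ (fun r => L2_L1 (L2M (bmF r) (h0 r)))).
have -> : (fun r => area (x r) (u r) (y r) (v r)) = (fun r => ing (fun t =>
   ((x r t * x r t + y r t * y r t) * 4^-1 + - 2^-1) * (x r t * v r t + -1 * y r t * u r t))).
  by apply/funext => r; rewrite /area; apply: ing_ext => t _; ring.
have bx' := wd_Bm x2; have by' := wd_Bm y2; have bY := wd_Bm y1.
have L1t : L1 (fun t => (1 - x s t * x s t - y s t * y s t) * (v s t * x' s t - u s t * y' s t)).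
  apply: L1M.
    by apply: BmB; [apply: BmB; [exact: Bm_cst|exact: BmM]|exact: BmM].
  apply: L1B; [apply: L1_ext (L2_L1 (L2M bx' (L2v s)))|apply: L1_ext (L2_L1 (L2M by' (L2u s)))] => t _; exact: mulrC.
(* The exact term: the derivative in [t] of the form evaluated on the velocity of the path, of mean
   zero by periodicity. *)
have hW := wdM F1 (wdB (wdM x1 y2) (wdM y1 x2)).
have := wd_ing hW; rewrite px px' py py' subrr => W0.
set V := ing _; suff -> : V = - ing (fun t => (1 - x s t * x s t - y s t * y s t) * (v s t * x' s t - u s t * y' s t)) by [].
rewrite -[RHS]add0r -W0 -ingB//; last exact: wd_L1 hW.
by apply: ing_ext => t _; field.
Qed.

(** Integrate [is_derive_area] in [s]; the convergences in [wpath] make the derivative continuous,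
    so the fundamental theorem applies. *)
Lemma stokes :
  ing (fun s => ing (fun t => (1 - x s t * x s t - y s t * y s t) * (v s t * x' s t - u s t * y' s t))) =
  area (x 0) (u 0) (y 0) (v 0) - area (x 1) (u 1) (y 1) (v 1).
Proof.
pose G s := - ing (fun t => (1 - x s t * x s t - y s t * y s t) * (v s t * x' s t - u s t * y' s t)).
have cG : continuous G.
  move=> s; have [x1 x2 x3 x4 [x5 x6]] := hx s; have [y1 y2 y3 y4 [y5 y6]] := hy s.
  have cx := wpath_cS s hx; have cy := wpath_cS s hy; have lu := wpath_cL s hx; have lv := wpath_cL s hy.
  have c1 := cvSD (cvSD (cvS_cst (Bm_cst 1)) (cvSN (cvSM cx cx))) (cvSN (cvSM cy cy)).
  have := cvL_ing (cvSL c1 (cvLD (cvSL x5 lv) (cvLN (cvSL y5 lu)))).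
  have e r : ing (fun t => (1 + - (x r t * x r t) + - (y r t * y r t)) * (x' r t * v r t + - (y' r t * u r t))) = - G r.
    by rewrite /G opprK; apply: ing_ext => t _; ring.
  rewrite e => /cvgN; rewrite opprK => h; apply/continuous_withinNshiftx; apply: cvg_trans h.
  by apply: near_eq_cvg; apply: filterE => r /=; rewrite [r + s]addrC -[RHS]opprK -(e (s + r)).
have hw : wd (fun s => area (x s) (u s) (y s) (v s)) G := wd_C1 is_derive_area cG.
have e := wd_ing hw; rewrite /= in e; rewrite -[RHS]opprB -e -mulN1r -ingZ; last exact: wd_L1 hw.
by apply: ing_ext => s _; rewrite mulN1r opprK.
Qed.

End Stokes.

(** * Translation between homotopies in the W^{1,2} norm and coordinate paths *)

Section LoopHomotopies.
Context {R : realType}.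
Local Notation E := 'rV[R]_3.
Local Notation leb := (@lebesgue_measure R).
Local Notation I01 := (`[0%R, 1%R]%classic : set R).
Implicit Types (f w : R -> E).

Lemma wderivP f w : weak_derivative f w -> weak_derivative f (wderiv f).
Proof. by move=> h; exact: (@xgetPex _ 0 [set u | weak_derivative f u] (ex_intro _ w h)). Qed.

Lemma W12_wd f i : W12 f -> wd (fun t => f t 0 i) (fun t => wderiv f t 0 i).
Proof. by move=> [_ [w /wderivP/weak_derivativeP]]. Qed.

Lemma wderiv_ae f w i : (forall i, wd (fun t => f t 0 i) (fun t => w t 0 i)) ->
  {ae leb, forall t, I01 t -> wderiv f t 0 i = w t 0 i}.
Proof.
move=> h; have /weak_derivativeP h2 := wderivP (proj2 (weak_derivativeP f w) h).
exact: wd_uniq (h2 i) (h i).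
Qed.

Lemma dot_L1 f : (forall i, L2 (fun t => f t 0 i)) -> L1 (fun t => dot (f t) (f t)).
Proof.
move=> h; have l i := L2M_L1 (h i) (h i).
by apply: L1_ext (L1D (L1D (l o0) (l o1)) (l o2)) => t _; rewrite dotE.
Qed.

Lemma ing_dot f : (forall i, L2 (fun t => f t 0 i)) ->
  ing (fun t => dot (f t) (f t)) = \sum_(i < 3) ing (fun t => f t 0 i ^+ 2).
Proof.
move=> h; have l i : L1 (fun t => f t 0 i ^+ 2) by have [] := h i.
rewrite sum3 -!ingD//; last exact: L1D.
by apply: ing_ext => t _; rewrite dotE !expr2.
Qed.

Lemma W12norm_sqr f w : (forall i, wd (fun t => f t 0 i) (fun t => w t 0 i)) ->
  W12norm f ^+ 2 = \sum_(i < 3) (ing (fun t => f t 0 i ^+ 2) + ing (fun t => w t 0 i ^+ 2)).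
Proof.
move=> h; have hd := proj1 (weak_derivativeP _ _) (wderivP (proj2 (weak_derivativeP f w) h)).
have lf i : L2 (fun t => f t 0 i) by apply: Bm_L2; exact: wd_Bm (h i).
have lw i : L2 (fun t => wderiv f t 0 i) by have [] := hd i.
rewrite /W12norm -/(ing _) ingD; [|exact: dot_L1..].
rewrite sqr_sqrtr; last by rewrite addr_ge0// ing_ge0// => t _; exact: dot_ge0.
rewrite !ing_dot// -big_split/=; apply: eq_bigr => i _; congr (_ + _).
apply: ing_ae; [by have [] := lw i|by have [[_]] := h i|].
have [N [mN N0 sN]] := wderiv_ae i h; exists N; split=> //.
by apply: subset_trans sN => t /= k1 k2; apply: k1 => It; rewrite k2.
Qed.

Lemma W12norm_ge0 f : 0 <= W12norm f.
Proof. exact: sqrtr_ge0. Qed.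

(** The uniform convergence of the values comes from the Sobolev bound [wd_sup]; conversely uniform
    convergence on the unit interval bounds the L^2 part of the norm. *)
Lemma W12norm_cvg0 (F w : R -> R -> E) : (forall e i, wd (fun t => F e t 0 i) (fun t => w e t 0 i)) ->
  (fun e => W12norm (F e)) @ 0^' --> 0 <->
  forall i, cvS (fun e t => F e t 0 i) (fun=> 0) /\ cvL (fun e t => w e t 0 i) (fun=> 0).
Proof.
move=> h; have hn e := W12norm_sqr (h e); split=> [|hi].
  move=> /cvgrPdist_le hc i.
  have p e j : 0 <= ing (fun t => F e t 0 j ^+ 2) by apply: ing_ge0 => t _; exact: sqr_ge0.
  have p' e j : 0 <= ing (fun t => w e t 0 j ^+ 2) by apply: ing_ge0 => t _; exact: sqr_ge0.
  have le e : ing (fun t => F e t 0 i ^+ 2) + ing (fun t => w e t 0 i ^+ 2) <= W12norm (F e) ^+ 2.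
    by rewrite hn (bigD1 i)//= lerDl sumr_ge0// => j _; rewrite addr_ge0.
  split; split=> [e||eps e0]; [exact: wd_Bm (h e i)|exact: Bm_cst| |by have [] := h e i|exact/Bm_L2/Bm_cst|].
    have e2 : 0 < eps / 2 by rewrite divr_gt0.
    apply: filterS (hc _ e2) => e; rewrite sub0r normrN ger0_norm ?W12norm_ge0// => he t ht.
    rewrite subr0 -ler_sqr ?nnegrE ?(ltW e0)// real_normK ?num_real//.
    apply: le_trans (wd_sup (h e i) ht) _.
    have := ler_pM (W12norm_ge0 _) (W12norm_ge0 _) he he; rewrite -!expr2.
    have := le e; have -> : eps ^+ 2 = 4 * (eps / 2) ^+ 2 by field.
    have := sqr_ge0 (eps / 2); lra.
  have e2 : 0 < Num.min 1 eps by rewrite lt_min ltr01.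
  apply: filterS (hc _ e2) => e; rewrite sub0r normrN ger0_norm ?W12norm_ge0// => he.
  rewrite (@ing_ext _ _ (fun t => w e t 0 i ^+ 2)); last by move=> t _; rewrite subr0.
  have he1 : W12norm (F e) <= 1 by apply: le_trans he _; rewrite ge_min lexx.
  have he2 : W12norm (F e) <= eps by apply: le_trans he _; rewrite ge_min lexx orbT.
  have := ler_pM (W12norm_ge0 _) (W12norm_ge0 _) he1 he2; rewrite -expr2 mul1r.
  have := le e; have := p e i; lra.
apply/cvgrPdist_le => eps e0; pose d := Num.min 1 (eps ^+ 2 / 6).
have d0 : 0 < d by rewrite lt_min ltr01 divr_gt0// exprn_gt0.
have key i : \forall e \near 0^', ing (fun t => F e t 0 i ^+ 2) + ing (fun t => w e t 0 i ^+ 2) <= eps ^+ 2 / 3.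
  have [[_ _ h1] [_ _ h2]] := hi i.
  apply: filterS2 (h1 _ d0) (h2 _ d0) => e k1 k2.
  have {}k2 : ing (fun t => w e t 0 i ^+ 2) <= d.
    by apply: le_trans k2; rewrite le_eqVlt; apply/orP; left; apply/eqP/ing_ext => t _; rewrite subr0.
  have k3 : ing (fun t => F e t 0 i ^+ 2) <= d.
    rewrite -[leRHS](@ing_cst R); apply: ing_le.
    - by have [] := Bm_L2 (wd_Bm (h e i)).
    - exact: L1_cst.
    move=> t ht; have := k1 t ht; rewrite subr0 => k.
    have d1 : d <= 1 by rewrite ge_min lexx.
    have := ler_pM (normr_ge0 _) (normr_ge0 _) k (le_trans k d1).
    by rewrite mulr1 -expr2 real_normK ?num_real.
  have : d <= eps ^+ 2 / 6 by rewrite ge_min lexx orbT.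
  lra.
apply: filterS3 (key o0) (key o1) (key o2) => e k0 k1 k2.
rewrite sub0r normrN ger0_norm ?W12norm_ge0// -ler_sqr ?nnegrE ?W12norm_ge0 ?(ltW e0)//.
by rewrite hn sum3; lra.
Qed.

Lemma loop_homotopy_wpath (q q0 : R -> E) h h' i : loop_homotopy q q0 h h' ->
  wpath (fun s t => h s t 0 i) (fun s t => wderiv (h s) t 0 i)
    (fun s t => h' s t 0 i) (fun s t => wderiv (h' s) t 0 i).
Proof.
move=> [_ _ hl hd hc] s.
have wh r j : wd (fun t => h r t 0 j) (fun t => wderiv (h r) t 0 j) by have [[/W12_wd hw _] _] := hl r; exact: hw.
have wh' r j : wd (fun t => h' r t 0 j) (fun t => wderiv (h' r) t 0 j) by have [_ /W12_wd hw] := hl r; exact: hw.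
have k1 e j : wd (fun t => (e^-1 *: (h (s + e) - h s) - h' s) t 0 j)
    (fun t => (e^-1 *: (wderiv (h (s + e)) - wderiv (h s)) - wderiv (h' s)) t 0 j).
  apply: wd_ext (wdB (wdZ (e^-1) (wdB (wh (s + e) j) (wh s j))) (wh' s j)) => t _;
  by rewrite !mxE.
have k2 e j : wd (fun t => (h' (s + e) - h' s) t 0 j) (fun t => (wderiv (h' (s + e)) - wderiv (h' s)) t 0 j).
  by apply: wd_ext (wdB (wh' (s + e) j) (wh' s j)) => t _; rewrite !mxE.
have /(W12norm_cvg0 k1)/(_ i)[a1 a2] := hd s.
have /(W12norm_cvg0 k2)/(_ i)[b1 b2] := hc s.
have bh' := wd_Bm (wh' s i); have [lh' _] := wh' s i.
split; [exact: wh|exact: wh'| | |split].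
- by apply: cvS_ext (cvSD a1 (cvS_cst bh')) => [e t|t]; rewrite ?add0r// !mxE subrK.
- by apply: cvL_ext (cvLD a2 (cvL_cst lh')) => [e t|t]; rewrite ?add0r// !mxE subrK.
- by apply: cvS_ext (cvSD b1 (cvS_cst bh')) => [e t|t]; rewrite ?add0r// !mxE subrK.
- by apply: cvL_ext (cvLD b2 (cvL_cst lh')) => [e t|t]; rewrite ?add0r// !mxE subrK.
Qed.

Lemma wpath_loop_homotopy (h u h' u' : R -> R -> E) :
  (forall i, wpath (fun s t => h s t 0 i) (fun s t => u s t 0 i)
                   (fun s t => h' s t 0 i) (fun s t => u' s t 0 i)) ->
  (forall s t, h s (t + 1) = h s t) -> (forall s t, h' s (t + 1) = h' s t) ->
  (forall s t, sphere (h s t)) -> loop_homotopy (h 0) (h 1) h h'.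
Proof.
move=> hw ph ph' Sh.
have wh s i : wd (fun t => h s t 0 i) (fun t => u s t 0 i) by have [] := hw i s.
have wh' s i : wd (fun t => h' s t 0 i) (fun t => u' s t 0 i) by have [] := hw i s.
split=> // s.
- split; first by split=> //; split=> //; exists (u s); apply/weak_derivativeP.
  by split=> //; exists (u' s); apply/weak_derivativeP.
- have k1 e i : wd (fun t => (e^-1 *: (h (s + e) - h s) - h' s) t 0 i)
    (fun t => (e^-1 *: (u (s + e) - u s) - u' s) t 0 i).
    apply: wd_ext (wdB (wdZ (e^-1) (wdB (wh (s + e) i) (wh s i))) (wh' s i)) => t _;
    by rewrite !mxE.
  apply/(W12norm_cvg0 k1) => i; have [_ _ h1 h2 _] := hw i s.
  have bh' := wd_Bm (wh' s i); have [lh' _] := wh' s i; split.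
    by apply: cvS_ext (cvSD h1 (cvSN (cvS_cst bh'))) => [e t|t]; rewrite ?subrr// !mxE.
  by apply: cvL_ext (cvLD h2 (cvLN (cvL_cst lh'))) => [e t|t]; rewrite ?subrr// !mxE.
- have k2 e i : wd (fun t => (h' (s + e) - h' s) t 0 i) (fun t => (u' (s + e) - u' s) t 0 i).
    by apply: wd_ext (wdB (wh' (s + e) i) (wh' s i)) => t _; rewrite !mxE.
  apply/(W12norm_cvg0 k2) => i; have [_ _ _ _ [h1 h2]] := hw i s.
  have bh' := wd_Bm (wh' s i); have [lh' _] := wh' s i; split.
    by apply: cvS_ext (cvSD h1 (cvSN (cvS_cst bh'))) => [e t|t]; rewrite ?subrr// !mxE.
  by apply: cvL_ext (cvLD h2 (cvLN (cvL_cst lh'))) => [e t|t]; rewrite ?subrr// !mxE.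
Qed.

Definition loop_area (q : R -> E) : R :=
  area (fun t => q t 0 o0) (fun t => wderiv q t 0 o0) (fun t => q t 0 o1) (fun t => wderiv q t 0 o1).

(** On the sphere [z^2 = 1 - x^2 - y^2], so the pulled back form involves only the first two
    coordinates and [stokes] applies to their plane curves. The flux therefore depends only on the
    end loops. *)
Lemma homotopy_flux_magnetic (q q0 : R -> E) h h' : loop_homotopy q q0 h h' ->
  homotopy_flux magnetic h h' = loop_area q - loop_area q0.
Proof.
move=> hh; have wx := loop_homotopy_wpath o0 hh; have wy := loop_homotopy_wpath o1 hh.
have [h0 h1 hl _ _] := hh.
have p s i : h s 1 0 i = h s 0 0 i by have [[[ph _] _] _] := hl s; rewrite -[1]add0r ph.
have p' s i : h' s 1 0 i = h' s 0 0 i by have [_ [ph _]] := hl s; rewrite -[1]add0r ph.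
have := stokes wx wy (p ^~ o0) (p' ^~ o0) (p ^~ o1) (p' ^~ o1).
rewrite /loop_area -h0 -h1 => <-.
rewrite /homotopy_flux; apply: ing_ext => s _; apply: ing_ext => t _.
rewrite bil_magnetic; congr (_ * _).
by have [[_ /(_ t)]] := hl s; rewrite /sphere /= dotE => <- _; ring.
Qed.

End LoopHomotopies.

(** * Homotopies of loops *)

Section Covering.
Context {R : realType}.
Local Notation leb := (@lebesgue_measure R).
Local Notation I01 := (`[0%R, 1%R]%classic : set R).

Definition box (a b d : R) : set (measurableTypeR R * measurableTypeR R) :=
  `[a - d, a + d]%classic `*` `[b - d, b + d]%classic.

Lemma measurable_box a b d : measurable (box a b d).
Proof. by apply: measurableX; exact: measurable_itv. Qed.

Lemma measure_box a b d : 0 <= d -> (leb \x leb)%E (box a b d) = (4 * d ^+ 2)%:E.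
Proof.
have l c : 0 <= d -> leb `[c - d, c + d]%classic = (2 * d)%:E.
  move=> d0; rewrite lebesgue_measure_itv/= lte_fin; case: ltP => h.
    by rewrite -EFinB; congr (_%:E); ring.
  by congr (_%:E); lra.
move=> d0; rewrite product_measure1E; [|exact: measurable_itv..].
transitivity ((2 * d)%:E * (2 * d)%:E)%E; first by congr (_ * _)%E; exact: l.
by rewrite -EFinM; congr (_%:E); ring.
Qed.

(** Comparison of areas: the box on the left is the square [[0, 1/2]^2]. *)
Lemma boxes_cover n (a b d a' b' d' : nat -> R) :
  (forall k, 0 <= d k) -> (forall k, 0 <= d' k) ->
  box 4^-1 4^-1 4^-1 `<=` \big[setU/set0]_(k < n) (box (a k) (b k) (d k) `|` box (a' k) (b' k) (d' k)) ->
  4^-1 <= 4 * \sum_(k < n) (d k ^+ 2 + d' k ^+ 2).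
Proof.
move=> d0 d0' hc; set F := fun k => box (a k) (b k) (d k) `|` box (a' k) (b' k) (d' k).
have mF k : measurable (F k) by apply: measurableU; exact: measurable_box.
have h : ((leb \x leb)%E (box 4^-1 4^-1 4^-1) <= \sum_(k < n) (leb \x leb)%E (F k))%E.
  exact: (@content_subadditive _ _ _ (leb \x leb)%E _ F n (fun k _ => mF k) (measurable_box _ _ _) hc).
rewrite measure_box// in h.
rewrite mulr_sumr -lee_fin -sumEFin.
apply: (@le_trans _ _ (4 * 4^-1 ^+ 2)%:E); first by rewrite lee_fin; lra.
apply: le_trans h _; apply: lee_sum => k _.
apply: (@le_trans _ _ ((leb \x leb)%E (box (a k) (b k) (d k)) + (leb \x leb)%E (box (a' k) (b' k) (d' k)))%E).
  by apply: measureU2; exact: measurable_box.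
by rewrite !measure_box// -EFinD lee_fin mulrDr.
Qed.

Lemma nat_bracket m (r : R) : 0 <= r <= m.+1%:R -> exists2 j, (j < m.+1)%N & j%:R <= r <= j.+1%:R.
Proof.
elim: m => [|m ih] /andP[r0 r1]; first by exists 0%N; rewrite ?r0.
have [h|h] := leP r m.+1%:R; last by exists m.+1; rewrite ?(ltW h).
by have [|j jm jr] := ih; [rewrite r0|exists j => //; exact: ltnW].
Qed.

(** The Hoelder bound on the [k]-th of [n + 1] equal pieces. Its square carries only the energy of
    that piece, so the squares add up to the total energy divided by [n + 1]. *)
Definition osc_bound (u v : R -> R) n k : R :=
  Num.sqrt (n.+1%:R^-1 * inab (k%:R / n.+1%:R) (k.+1%:R / n.+1%:R) (fun t => u t ^+ 2 + v t ^+ 2)).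

Lemma sum_osc_bound u v n : L2 u -> L2 v ->
  \sum_(k < n.+1) osc_bound u v n k ^+ 2 = (ing (fun t => u t ^+ 2) + ing (fun t => v t ^+ 2)) / n.+1%:R.
Proof.
move=> [_ hu] [_ hv]; pose g t := u t ^+ 2 + v t ^+ 2.
have n0 : 0 < n.+1%:R :> R by [].
have g0 t : 0 <= g t by rewrite addr_ge0 ?sqr_ge0.
have e k : osc_bound u v n k ^+ 2 = n.+1%:R^-1 * inab (k%:R / n.+1%:R) (k.+1%:R / n.+1%:R) g.
  by rewrite sqr_sqrtr// mulr_ge0 ?invr_ge0// inab_ge0// => t _; exact: g0.
under eq_bigr do rewrite e; rewrite -mulr_sumr mulrC; congr (_ * _).
have main m : (m <= n.+1)%N -> \sum_(k < m) inab (k%:R / n.+1%:R) (k.+1%:R / n.+1%:R) g = inab 0 (m%:R / n.+1%:R) g.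
  elim: m => [_|m ih mn].
    by rewrite big_ord0 mul0r /inab set_itv1 /Rintegral integral_set1.
  rewrite big_ord_recr/= ih 1?ltnW// -inab_split//.
  - by rewrite ler_pM2r ?invr_gt0// ler_nat.
  - by rewrite ler_pdivrMr// mul1r ler_nat.
  - exact: L1D.
by rewrite main// divff ?gt_eqF// inab01 ingD.
Qed.

Lemma curve_in_boxes (x u y v : R -> R) n t : wd x u -> wd y v -> I01 t ->
  exists2 k, (k < n.+1)%N &
    box (x (k%:R / n.+1%:R)) (y (k%:R / n.+1%:R)) (osc_bound u v n k) (x t, y t).
Proof.
move=> hx hy; rewrite in01 => /andP[t0 t1].
have n0 : 0 < n.+1%:R :> R by [].
have [|k kn /andP[k1 k2]] := @nat_bracket n (t * n.+1%:R).
  by rewrite mulr_ge0//= -[leRHS]mul1r ler_pM2r.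
rewrite -ler_pdivrMr// in k1; rewrite -ler_pdivlMr// in k2; exists k => //.
set p := k%:R / _; set q := k.+1%:R / _ in k2.
have p0 : 0 <= p by rewrite divr_ge0.
have q1 : q <= 1 by rewrite ler_pdivrMr// mul1r ler_nat.
have [[_ hu] _] := hx; have [[_ hv] _] := hy.
have hg : L1 (fun t => u t ^+ 2 + v t ^+ 2) by exact: L1D.
have pt : 0 <= t - p by rewrite subr_ge0.
have ptn : t - p <= n.+1%:R^-1.
  have -> : n.+1%:R^-1 = q - p by rewrite /q /p -mulrBl -natrB// subSnn mul1r.
  by rewrite lerB.
have bnd f w : wd f w -> (forall s, w s ^+ 2 <= u s ^+ 2 + v s ^+ 2) ->
    f p - osc_bound u v n k <= f t <= f p + osc_bound u v n k.
  move=> hf le; have [[_ hw] _] := hf.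
  suff : `|f t - f p| <= osc_bound u v n k by rewrite ler_norml => /andP[h1 h2]; apply/andP; split; lra.
  rewrite -ler_sqr ?nnegrE ?sqrtr_ge0// real_normK ?num_real// sqr_sqrtr; last first.
    by rewrite mulr_ge0 ?invr_ge0// inab_ge0// => s _; rewrite addr_ge0 ?sqr_ge0.
  apply: le_trans (wd_holder hf p0 k1 t1) _; apply: ler_pM => //.
    by apply: inab_ge0 => s _; exact: sqr_ge0.
  rewrite -/p -/q (inab_split p0 k1 k2 q1 hg).
  apply: (@le_trans _ _ (inab p t (fun s => u s ^+ 2 + v s ^+ 2))).
    by apply: inab_le.
  by rewrite lerDl inab_ge0// => s _; rewrite addr_ge0 ?sqr_ge0.
by split; rewrite /= in_itv/=; [apply: (bnd x u)|apply: (bnd y v)] => // s; rewrite ?lerDl ?lerDr sqr_ge0.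
Qed.

(* A W^{1,2} plane curve is 1/2-Hoelder with a locally small constant, hence covered
   by n squares of total area O(1/n). *)
Lemma exists_off_curves (x u y v x' u' y' v' : R -> R) :
  wd x u -> wd y v -> wd x' u' -> wd y' v' ->
  exists a b, [/\ 0 <= a <= 2^-1, 0 <= b <= 2^-1 &
    forall t, I01 t -> (x t, y t) <> (a, b) /\ (x' t, y' t) <> (a, b)].
Proof.
move=> hx hy hx' hy'; apply: contrapT => no.
have lu := proj1 hx; have lv := proj1 hy; have lu' := proj1 hx'; have lv' := proj1 hy'.
pose K := ing (fun t => u t ^+ 2) + ing (fun t => v t ^+ 2) + (ing (fun t => u' t ^+ 2) + ing (fun t => v' t ^+ 2)).
suff : 4^-1 <= 0 :> R by rewrite leNgt invr_gt0 ltr0n.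
apply: (@archi_le0 _ _ (4 * K)) => n.
have -> : 4 * K / n.+1%:R = 4 * (\sum_(k < n.+1) (osc_bound u v n k ^+ 2 + osc_bound u' v' n k ^+ 2)).
  by rewrite big_split/= (sum_osc_bound n lu lv) (sum_osc_bound n lu' lv') -mulrDl mulrA.
apply: (@boxes_cover _ (fun k => x (k%:R / n.+1%:R)) (fun k => y (k%:R / n.+1%:R)) _
  (fun k => x' (k%:R / n.+1%:R)) (fun k => y' (k%:R / n.+1%:R))) => [k|k|]; try exact: sqrtr_ge0.
move=> [a b] [/=]; rewrite !in_itv/= subrr => a0 b0.
have e2 : (4^-1 + 4^-1 : R) = 2^-1 by field.
rewrite e2 in a0 b0.
have [t It hit] : exists2 t, I01 t & (x t, y t) = (a, b) \/ (x' t, y' t) = (a, b).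
  apply: contrapT => nt; apply: no; exists a, b; split=> // t It.
  by split=> e; apply: nt; exists t; [|left| |right].
case: hit => <-.
  by have [k kn hk] := curve_in_boxes n hx hy It; rewrite (bigD1 (Ordinal kn))//=; left; left.
by have [k kn hk] := curve_in_boxes n hx' hy' It; rewrite (bigD1 (Ordinal kn))//=; left; right.
Qed.

End Covering.

(** * Connectedness of the loop space of the sphere through C^1 paths *)

Section LoopsHomotopic.
Context {R : realType}.
Local Notation E := 'rV[R]_3.
Local Notation I01 := (`[0%R, 1%R]%classic : set R).

(** A C^1 cutoff, zero for [x <= 0] and equal to 1 at 1, with which two deformations are run one
    after the other without a corner. *)
Definition hinge (x : R) : R := Num.max 0 x ^+ 2.

Lemma is_derive_hinge (x : R) : is_derive x (1 : R) hinge (2 * Num.max 0 x).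
Proof.
apply/is_derive_errorP => e e0; apply: filterS (nbhs0_le e0) => h he.
have : `|hinge (x + h) - hinge x - h * (2 * Num.max 0 x)| <= `|h| * `|h|.
  rewrite -expr2 real_normK ?num_real// /hinge ler_norml.
  case: (leP 0 x) => x0; case: (leP 0 (x + h)) => xh; apply/andP; split; nra.
by move=> /le_trans; apply; rewrite ler_wpM2r.
Qed.

Lemma hinge_continuous : continuous (fun x : R => 2 * Num.max 0 x).
Proof.
move=> x; apply: cvgM; first exact: cvg_cst.
by apply: continuous_max; [exact: cvg_cst|exact: cvg_id].
Qed.

(** A periodic coordinate of a C^1 path of loops. Weak derivative and velocity are quantified away,
    so closure under ring operations and inverses suffices to recognize such a path. *)
Definition ploop (x : R -> R -> R) := exists u x' u', [/\ wpath x u x' u',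
  forall s t, x s (t + 1) = x s t & forall s t, x' s (t + 1) = x' s t].

Lemma ploopD x y : ploop x -> ploop y -> ploop (fun s t => x s t + y s t).
Proof.
move=> [u [x' [u' [h1 h2 h3]]]] [v [y' [v' [k1 k2 k3]]]].
do 3!eexists; split; first exact: wpathD h1 k1.
  by move=> s t; rewrite h2 k2.
by move=> s t /=; rewrite h3 k3.
Qed.

Lemma ploopM x y : ploop x -> ploop y -> ploop (fun s t => x s t * y s t).
Proof.
move=> [u [x' [u' [h1 h2 h3]]]] [v [y' [v' [k1 k2 k3]]]].
do 3!eexists; split; first exact: wpathM h1 k1.
  by move=> s t; rewrite h2 k2.
by move=> s t /=; rewrite h3 k3 h2 k2.
Qed.

Lemma ploopV x (m : R) : 0 < m -> (forall s t, m <= x s t) -> ploop x -> ploop (fun s t => (x s t)^-1).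
Proof.
move=> m0 mx [u [x' [u' [h1 h2 h3]]]].
do 3!eexists; split; first exact: wpathV m0 mx h1.
  by move=> s t; rewrite h2.
by move=> s t /=; rewrite h3 h2.
Qed.

Lemma ploop_stationary (f w : R -> R) : wd f w -> (forall t, f (t + 1) = f t) -> ploop (fun=> f).
Proof. by move=> h p; do 3!eexists; split; first exact: wpath_stationary h. Qed.

Lemma ploop_cst (c : R) : ploop (fun _ _ => c).
Proof. by apply: ploop_stationary; first exact: wd_cst. Qed.

Lemma ploop_scalar (l l' : R -> R) : (forall s : R, is_derive s (1 : R) l (l' s)) -> continuous l' ->
  ploop (fun s _ => l s).
Proof. by move=> h1 h2; do 3!eexists; split; first exact: wpath_scalar h1 h2. Qed.

Lemma ploop_homotopy (x : 'I_3 -> R -> R -> R) : (forall i, ploop (x i)) ->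
  (forall s t, sphere (\row_i x i s t)) ->
  exists h', loop_homotopy (fun t => \row_i x i 0 t) (fun t => \row_i x i 1 t) (fun s t => \row_i x i s t) h'.
Proof.
move=> hx Sx.
have {}hx i : exists p : (R -> R -> R) * (R -> R -> R) * (R -> R -> R),
    [/\ wpath (x i) p.1.1 p.1.2 p.2, forall s t, x i s (t + 1) = x i s t & forall s t, p.1.2 s (t + 1) = p.1.2 s t].
  by have [u [x' [u' h]]] := hx i; exists (u, x', u').
have [p hp] := choice hx.
exists (fun s t => \row_i (p i).1.2 s t).
apply: (@wpath_loop_homotopy R _ (fun s t => \row_i (p i).1.1 s t) _ (fun s t => \row_i (p i).2 s t)).
- by move=> i; have [h _ _] := hp i; apply: wpath_ext h => s t; rewrite mxE.
- by move=> s t; apply/rowP => i; rewrite !mxE; have [_ h _] := hp i.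
- by move=> s t; apply/rowP => i; rewrite !mxE; have [_ _ h] := hp i.
- exact: Sx.
Qed.

Lemma periodic_shift (T : Type) (f : R -> T) : (forall t, f (t + 1) = f t) ->
  forall t, exists2 t', I01 t' & f t = f t'.
Proof.
move=> pf t.
have pn n r : f (r + n%:R) = f r.
  elim: n r => [|n ih] r; first by rewrite addr0.
  by rewrite -natr1 addrA pf ih.
have pz (n : int) r : f (r + n%:~R) = f r.
  by case: n => n; [exact: pn|rewrite NegzE mulrNz -(pn n.+1) subrK].
exists (t - (Num.floor t)%:~R); last by rewrite -[RHS](pz (Num.floor t)) subrK.
by rewrite in01 subr_ge0 ge_floor/= lerBlDr addrC ltW// -intrD1 floorD1_gt.
Qed.

(* Stereographic projection from [- c], a homothety of ratio [l], and back. *)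
Definition squeeze (c : E) (l : R) (q : E) : E :=
  let a := 1 + dot q c in
  \row_i (2 * l * (q 0 i - (a - 1) * c 0 i) * (a + l * l * (2 - a))^-1
          + 2 * a * c 0 i * (a + l * l * (2 - a))^-1 - c 0 i).

Lemma squeeze_sphere c l (q : E) : sphere c -> sphere q -> 0 < 1 + dot q c -> sphere (squeeze c l q).
Proof.
rewrite /sphere /= => Sc Sq a0.
have a2 : 0 <= 2 - (1 + dot q c).
  by have := dot_ge0 (q - c); move: Sc Sq; rewrite !dotE !mxE; lra.
have D0 : 1 + dot q c + l * l * (2 - (1 + dot q c)) != 0.
  by rewrite lt0r_neq0// ltr_wpDr// mulr_ge0// -expr2 sqr_ge0.
set a := 1 + dot q c in a0 a2 D0 *; have ea : dot q c = a - 1 by rewrite /a addrC addKr.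
rewrite dotE !mxE -/a; move: Sc Sq ea; rewrite !dotE; clearbody a.
move: (c 0 o0) (c 0 o1) (c 0 o2) (q 0 o0) (q 0 o1) (q 0 o2) => c0 c1 c2 q0 q1 q2 Sc Sq ea.
set G := (_^-1).
transitivity (4 * l ^+ 2 * G ^+ 2 * ((q0 * q0 + q1 * q1 + q2 * q2) - 2 * (a - 1) * (q0 * c0 + q1 * c1 + q2 * c2) + (a - 1) ^+ 2 * (c0 * c0 + c1 * c1 + c2 * c2))
  + 4 * l * G * (2 * a * G - 1) * ((q0 * c0 + q1 * c1 + q2 * c2) - (a - 1) * (c0 * c0 + c1 * c1 + c2 * c2))
  + (2 * a * G - 1) ^+ 2 * (c0 * c0 + c1 * c1 + c2 * c2)); first by ring.
by rewrite Sc Sq ea /G; field.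
Qed.

Lemma squeeze1 c q : squeeze c 1 q = q.
Proof.
apply/rowP => i; rewrite mxE.
have -> : 1 + dot q c + 1 * 1 * (2 - (1 + dot q c)) = 2 by ring.
by field.
Qed.

Lemma squeeze0 c q : 0 < 1 + dot q c -> squeeze c 0 q = c.
Proof.
move=> /lt0r_neq0 a0; apply/rowP => i; rewrite mxE mulr0 !mul0r addr0 add0r.
by field.
Qed.

Lemma ploop_squeeze (q u : R -> E) c (l l' : R -> R) m i : sphere c ->
  (forall i, wd (fun t => q t 0 i) (fun t => u t 0 i)) -> (forall t, q (t + 1) = q t) ->
  (forall t, sphere (q t)) -> 0 < m -> (forall t, m <= 1 + dot (q t) c) ->
  (forall s : R, is_derive s (1 : R) l (l' s)) -> continuous l' ->
  ploop (fun s t => squeeze c (l s) (q t) 0 i).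
Proof.
move=> Sc hq pq Sq m0 mq dl cl.
have pqi j : ploop (fun _ t => q t 0 j).
  by apply: (ploop_stationary (hq j)) => t; rewrite pq.
have pl := ploop_scalar dl cl.
have pa : ploop (fun _ t => 1 + dot (q t) c).
  have h j := ploopM (pqi j) (ploop_cst (c 0 j)).
  have := ploopD (ploop_cst 1) (ploopD (ploopD (h o0) (h o1)) (h o2)).
  by congr ploop; apply/funext => s; apply/funext => t; rewrite dotE.
have pn := ploopM (ploop_cst (-1)) pa.
have pD := ploopD pa (ploopM (ploopM pl pl) (ploopD (ploop_cst 2) pn)).
have mD s t : m <= 1 + dot (q t) c + l s * l s * (2 + -1 * (1 + dot (q t) c)).
  apply: le_trans (mq t) _; rewrite lerDl mulr_ge0 -?expr2 ?sqr_ge0// mulN1r.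
  by have := dot_ge0 (q t - c); move: Sc (Sq t); rewrite /sphere/= !dotE !mxE; lra.
have pG := ploopV m0 mD pD.
have pp := ploopD (pqi i) (ploopM (ploopD pn (ploop_cst 1)) (ploop_cst (c 0 i))).
have := ploopD (ploopD (ploopM (ploopM (ploopM (ploop_cst 2) pl) pp) pG)
  (ploopM (ploopM (ploopM (ploop_cst 2) pa) (ploop_cst (c 0 i))) pG)) (ploop_cst (- c 0 i)).
congr ploop; apply/funext => s; apply/funext => t; rewrite mxE mulN1r.
by congr (_ * _ * _ + _ * _ - _); ring.
Qed.

(** For unit vectors [1 + q . c] is half of [|q + c|^2], positive when [q] differs from [- c];
    compactness of a period gives a uniform bound, which the inverse in [squeeze] needs. *)
Lemma off_loop (q : R -> E) c : loop_space q -> sphere c ->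
  (forall t, I01 t -> q t <> - c) -> exists2 m, 0 < m & forall t, m <= 1 + dot (q t) c.
Proof.
move=> [Wq Sq] Sc qc; have hq i := W12_wd i Wq.
have h0 := wdD (wd_cst 1) (wdD (wdD (wdZ (c 0 o0) (hq o0)) (wdZ (c 0 o1) (hq o1))) (wdZ (c 0 o2) (hq o2))).
have [t0 It0 ht0] := EVT_min ler01 (wd_continuous h0).
have e t : 1 + (c 0 o0 * q t 0 o0 + c 0 o1 * q t 0 o1 + c 0 o2 * q t 0 o2) = 1 + dot (q t) c.
  by rewrite dotE; ring.
rewrite e in ht0; exists (1 + dot (q t0) c).
  have {}qc := qc t0 It0; have : 0 < dot (q t0 + c) (q t0 + c).
    by apply: dot_gt0; apply: contra_notN qc; rewrite addr_eq0 => /eqP.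
  by move: Sc (Sq t0); rewrite /sphere /= !dotE !mxE; lra.
move=> t; have [t' It' ->] := periodic_shift (proj1 Wq) t.
by rewrite -(e t'); exact: ht0.
Qed.

(* Both loops avoid [- c] for some [c]: shrink the first one to [c], then expand [c]
   to the second one. *)
Lemma loops_homotopic (q q0 : R -> E) : loop_space q -> loop_space q0 ->
  exists h h', loop_homotopy q q0 h h'.
Proof.
move=> hq hq0; have [Wq Sq] := hq; have [Wq0 Sq0] := hq0.
have [a [b [/andP[a0 a1] /andP[b0 b1] hab]]] :=
  exists_off_curves (W12_wd o0 Wq) (W12_wd o1 Wq) (W12_wd o0 Wq0) (W12_wd o1 Wq0).
have ab : 0 <= 1 - a ^+ 2 - b ^+ 2 by nra.
(* The first two coordinates of [- c] are [(a, b)], a point missed by the projections of both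
   loops. *)
pose c : E := vec (- a) (- b) (Num.sqrt (1 - a ^+ 2 - b ^+ 2)).
have Sc : sphere c by rewrite /sphere /= dotE !vecE -[X in _ + X]expr2 sqr_sqrtr//; ring.
have [|m m0 hm] := off_loop hq Sc.
  by move=> t It e; have [+ _] := hab t It; rewrite e !mxE /= !opprK.
have [|n n0 hn] := off_loop hq0 Sc.
  by move=> t It e; have [_] := hab t It; rewrite e !mxE /= !opprK.
(* [f] falls from 1 to 0 on [[0, 1/2]] and [g] rises from 0 to 1 on [[1/2, 1]]. They are C^1 on the
   whole line, where [loop_homotopy] requires its path. *)
pose f (s : R) := hinge (cos (pi * s)); pose g (s : R) := hinge (- cos (pi * s)).
have df s : is_derive s (1 : R) f (2 * Num.max 0 (cos (pi * s)) * - (pi * sin (pi * s))).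
  exact: is_derive1_comp (is_derive_hinge _) (is_derive_cos_lin pi s).
have dg s : is_derive s (1 : R) g (2 * Num.max 0 (- cos (pi * s)) * (pi * sin (pi * s))).
  apply: is_derive1_comp (is_derive_hinge _) _.
  by have d := is_derive_cos_lin pi s; apply: is_derive_eq; rewrite opprK.
have clin : continuous (fun s : R => pi * s) by move=> s; apply: cvgM; [exact: cvg_cst|exact: cvg_id].
have cc : continuous (fun s : R => cos (pi * s)).
  by move=> s; apply: continuous_comp; [exact: clin|exact: continuous_cos].
have cs : continuous (fun s : R => pi * sin (pi * s)).
  move=> s; apply: cvgM; first exact: cvg_cst.
  by apply: continuous_comp; [exact: clin|exact: continuous_sin].
have cf : continuous (fun s : R => 2 * Num.max 0 (cos (pi * s)) * - (pi * sin (pi * s))).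
  move=> s; apply: cvgM; last by apply: cvgN; exact: cs.
  by apply: (@continuous_comp _ _ _ (fun s => cos (pi * s)) (fun x => 2 * Num.max 0 x)); [exact: cc|exact: hinge_continuous].
have cg : continuous (fun s : R => 2 * Num.max 0 (- cos (pi * s)) * (pi * sin (pi * s))).
  move=> s; apply: cvgM; last exact: cs.
  apply: (@continuous_comp _ _ _ (fun s => - cos (pi * s)) (fun x => 2 * Num.max 0 x)); last exact: hinge_continuous.
  by apply: cvgN; exact: cc.
(* At every time one of the two squeezed loops is constantly [c] and cancels the last term, so the
   sum stays on the sphere. *)
pose x i s t := squeeze c (f s) (q t) 0 i + squeeze c (g s) (q0 t) 0 i + - c 0 i.
have px i : ploop (x i).
  apply: ploopD; last exact: ploop_cst.
  apply: ploopD.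
    exact: (ploop_squeeze i Sc (fun i => W12_wd i Wq) (proj1 Wq) Sq m0 hm df cf).
  exact: (ploop_squeeze i Sc (fun i => W12_wd i Wq0) (proj1 Wq0) Sq0 n0 hn dg cg).
have xE s t : \row_i x i s t = squeeze c (f s) (q t) + squeeze c (g s) (q0 t) - c.
  apply/rowP => i; rewrite mxE /x [RHS]mxE [X in _ = X + _]mxE; congr (_ + _).
  by rewrite [RHS]mxE.
have am t := lt_le_trans m0 (hm t); have an t := lt_le_trans n0 (hn t).
have [|h' hh] := ploop_homotopy px.
  move=> s t; rewrite xE; have [h|h] := leP (cos (pi * s)) 0.
    have -> : f s = 0 by rewrite /f /hinge max_l// expr0n.
    by rewrite squeeze0// addrAC subrr add0r; exact: squeeze_sphere.
  have -> : g s = 0 by rewrite /g /hinge max_l ?expr0n// oppr_le0 ltW.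
  by rewrite squeeze0// addrK; exact: squeeze_sphere.
exists (fun s t => \row_i x i s t), h'.
have e0 : (fun t => \row_i x i 0 t) = q.
  apply/funext => t; rewrite xE /f /g /hinge mulr0 cos0 max_r// expr1n max_l ?oppr_le0// expr0n.
  by rewrite squeeze1 squeeze0// addrK.
have e1 : (fun t => \row_i x i 1 t) = q0.
  apply/funext => t; rewrite xE /f /g /hinge mulr1 cospi opprK max_l ?oppr_le0// [Num.max 0 1]max_r//.
  by rewrite expr0n expr1n squeeze1 squeeze0// addrAC subrr add0r.
by rewrite -e0 -e1.
Qed.

(** A homotopy exists, so [xget] returns the flux of some homotopy, and by Stokes all of them give
    the same value. *)
Lemma magnetic_termE (q q0 : R -> E) : loop_space q -> loop_space q0 ->
  magnetic_term magnetic q0 q = loop_area q - loop_area q0.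
Proof.
move=> hq hq0; have [h [h' hh]] := loops_homotopic hq hq0.
have [g [g' [hg e]]] := @xgetPex _ 0 [set a | exists h h', loop_homotopy q q0 h h' /\
  a = homotopy_flux magnetic h h'] (ex_intro _ _ (ex_intro _ h (ex_intro _ h' (conj hh erefl)))).
by rewrite /magnetic_term e; exact: homotopy_flux_magnetic.
Qed.

End LoopsHomotopic.

(** * The second variation of the action *)

Section Jets.
Context {R : realType}.
Implicit Types (f h w : R -> R).

(** Value and first two derivatives at 0, with differentiability on a neighbourhood because
    [derive1n 2] differentiates the derivative function. The rules below make the Hessians a
    computation with truncated Taylor series. *)
Definition jet2 f (a b c : R) := exists f1, [/\ f 0 = a, f1 0 = b,
  \forall s \near (0 : R), is_derive s (1 : R) f (f1 s) & is_derive (0 : R) (1 : R) f1 c].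

Lemma jet2_derive1n f a b c : jet2 f a b c -> derive1n 2 f 0 = c.
Proof.
move=> [f1 [_ _ h1 h2]]; rewrite /= derive1E.
have [_ <-] := h2; apply: near_eq_derive.
by apply: filterS h1 => s [_ <-]; rewrite derive1E.
Qed.

Lemma jet2_near f h a b c : (\forall s \near (0 : R), f s = h s) -> jet2 f a b c -> jet2 h a b c.
Proof.
move=> fh [f1 [h0 h1 h2 h3]]; exists f1; split=> //; first by rewrite -(nbhs_singleton fh).
have := near_join fh; apply: filterS2 h2 => s hs d.
exact: near_eq_is_derive d hs.
Qed.

Lemma jet2_cst (a : R) : jet2 (fun=> a) a 0 0.
Proof.
have d (s x : R) : is_derive s (1 : R) (fun=> x) 0 by exact: is_derive_cst.
by exists (fun=> 0); split=> //; apply: (filterE (F := nbhs (0 : R))) => s.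
Qed.

Lemma jet2_id : jet2 id 0 1 0.
Proof.
have d (s : R) : is_derive s (1 : R) id 1 by exact: is_derive_id.
have d1 : is_derive (0 : R) (1 : R) (fun=> 1 : R) 0 by exact: is_derive_cst.
by exists (fun=> 1); split=> //; apply: (filterE (F := nbhs (0 : R))) => s.
Qed.

Lemma jet2D f h a b c a' b' c' : jet2 f a b c -> jet2 h a' b' c' ->
  jet2 (fun s => f s + h s) (a + a') (b + b') (c + c').
Proof.
move=> [f1 [f0 f10 df df1]] [h1 [h0 h10 dh dh1]]; exists (fun s => f1 s + h1 s).
split; [by rewrite f0 h0|by rewrite f10 h10| |exact: is_deriveD].
by apply: filterS2 df dh => s d1 d2; exact: is_deriveD.
Qed.

Lemma jet2M f h a b c a' b' c' : jet2 f a b c -> jet2 h a' b' c' ->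
  jet2 (fun s => f s * h s) (a * a') (b * a' + a * b') (c * a' + 2 * b * b' + a * c').
Proof.
move=> [f1 [f0 f10 df df1]] [h1 [h0 h10 dh dh1]]; exists (fun s => f1 s * h s + f s * h1 s).
split; [by rewrite f0 h0|by rewrite f10 h10 f0 h0| |].
  by apply: filterS2 df dh => s d1 d2; apply: is_derive_eq; rewrite /GRing.scale/=; ring.
have df0 := nbhs_singleton df; have dh0 := nbhs_singleton dh.
by apply: is_derive_eq; rewrite /GRing.scale/= f0 f10 h0 h10; ring.
Qed.

Lemma jet2V f a b c : a != 0 -> jet2 f a b c ->
  jet2 (fun s => (f s)^-1) a^-1 (- b / a ^+ 2) (2 * b ^+ 2 / a ^+ 3 - c / a ^+ 2).
Proof.
move=> a0 [f1 [f0 f10 df df1]]; exists (fun s => - f1 s / f s ^+ 2).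
have df0 := nbhs_singleton df; have f00 : f 0 != 0 by rewrite f0.
have nz : \forall s \near (0 : R), f s != 0.
  have := derive_continuous df0; move=> /cvgrPdist_lt/(_ `|f 0|); rewrite normr_gt0 => /(_ f00).
  by apply: filterS => s; apply: contraTneq => ->; rewrite subr0 ltxx.
split; [by rewrite f0|by rewrite f10 f0| |].
  apply: filterS2 df nz => s d fs; apply: is_derive_eq; rewrite /GRing.scale/=.
  by field.
have n2 : f 0 ^+ 2 != 0 by rewrite expf_neq0.
by apply: is_derive_eq; rewrite /GRing.scale/= f0 f10; field.
Qed.

(** The weight is only integrable: it will be a product of weak derivatives, so the factor depending
    on [s] has to converge uniformly. *)
Lemma dS_ing (x x' : R -> R -> R) w s : (forall s, Bm (x s)) -> L1 w -> dS s x x' ->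
  is_derive s (1 : R) (fun s => ing (fun t => x s t * w t)) (ing (fun t => x' s t * w t)).
Proof.
move=> bx lw [h1 h2 h3].
have lx r : L1 (fun t => x r t * w t) by exact: L1M.
have key : (fun e : R => e^-1 *: (((fun s => ing (fun t => x s t * w t)) \o shift s) (e *: (1 : R)) -
    ing (fun t => x s t * w t))) @ 0^' --> ing (fun t => x' s t * w t).
  apply/cvgrPdist_le => eps e0; pose N := ing (fun t => `|w t|).
  have N0 : 0 <= N by apply: ing_ge0 => t _; exact: normr_ge0.
  have d0 : 0 < eps / (N + 1) by rewrite divr_gt0// ltr_wpDl.
  apply: filterS (h3 _ d0) => e he /=.
  rewrite /GRing.scale/= mulr1 [e + s]addrC -ingB// -ingZ; last exact: L1B.
  rewrite distrC -ingB; [|by apply: L1Z; exact: L1B|exact: L1M].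
  have lr : L1 (fun t => (e^-1 * (x (s + e) t - x s t) - x' s t) * w t).
    by apply: L1M => //; apply: BmB => //; exact: h1.
  rewrite (@ing_ext _ _ (fun t => (e^-1 * (x (s + e) t - x s t) - x' s t) * w t)); last by move=> t _; ring.
  apply: le_trans (ing_norm lr) _.
  apply: (@le_trans _ _ (ing (fun t => eps / (N + 1) * `|w t|))).
    apply: ing_le; [exact: L1_norm|by apply: L1Z; exact: L1_norm|].
    by move=> t ht; rewrite normrM ler_wpM2r//; exact: he.
  rewrite ingZ; last exact: L1_norm.
  by rewrite -/N mulrAC ler_pdivrMr ?ltr_wpDl// mulrDr mulr1 lerDl ltW.
by apply: DeriveDef; [apply/cvg_ex; exists (ing (fun t => x' s t * w t))|exact: cvg_lim].
Qed.

Variables g g' : R -> R.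
Hypothesis (hg : wd g g') (g0 : forall t, 0 <= g t).

(* With [g = |xi|^2] and [xi] tangent along [q], this is [|q + s xi|^-2]. *)
Definition damping (s t : R) : R := (1 + s ^+ 2 * g t)^-1.

Let bg : Bm g := wd_Bm hg.

Let wpath_damping : exists u u', wpath damping u (fun s t => - 2 * s * g t * damping s t ^+ 2) u'.
Proof.
have d1 (s : R) : is_derive s (1 : R) (fun s => s ^+ 2) (2 * s).
  by apply: is_derive_eq; rewrite /GRing.scale/=; ring.
have c1 : continuous (fun s : R => 2 * s) by move=> s; apply: cvgM; [exact: cvg_cst|exact: cvg_id].
have h := wpathD (wpath_stationary (wd_cst (1 : R))) (wpathM (wpath_scalar d1 c1) (wpath_stationary hg)).
have hm (s t : R) : 1 <= 1 + s ^+ 2 * g t by rewrite lerDl mulr_ge0// sqr_ge0.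
have hV := wpathV ltr01 hm h.
do 2!eexists; apply: wpath_ext hV => s t; [by []|reflexivity| |reflexivity].
by rewrite /damping -exprVn; ring.
Qed.

Lemma damping_Bm s : Bm (damping s).
Proof. by have [u [u' /(_ s)[/wd_Bm]]] := wpath_damping. Qed.

Lemma dS_damping s : dS s damping (fun s t => - 2 * s * g t * damping s t ^+ 2).
Proof. by have [u [u' /(_ s)[]]] := wpath_damping. Qed.

Lemma dS_damping_pow n s : dS s (fun s t => damping s t ^+ n)
  (fun s t => - 2 * n%:R * s * g t * damping s t ^+ n.+1).
Proof.
elim: n s => [|n ih] s.
  have b0 := Bm_cst (0 : R); apply: cvS_ext (cvS_cst b0) => [e t|t]; last by ring.
  by rewrite !expr0 subrr mulr0.
apply: cvS_ext (dSM (damping_Bm s) (dS_cS (BmX n (damping_Bm s)) (ih s)) (dS_damping s) (ih s)) => [e t|t].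
  by rewrite !exprS.
by rewrite -[n.+1%:R]natr1 !exprS expr0; ring.
Qed.

(** The action along the chart is a combination of these integrals with polynomial coefficients in
    [s]. Differentiating one of them raises [n] by one and brings out a factor [s]. *)
Definition damped n w (s : R) : R := ing (fun t => damping s t ^+ n * w t).

Lemma is_derive_damped n w s : L1 w ->
  is_derive s (1 : R) (damped n w) (- 2 * n%:R * s * damped n.+1 (fun t => g t * w t) s).
Proof.
move=> lw; have := dS_ing (fun s => BmX n (damping_Bm s)) lw (dS_damping_pow n s).
congr is_derive; rewrite /damped -ingZ; last by apply: L1M; [exact: BmX (damping_Bm s)|exact: L1M].
by apply: ing_ext => t _; ring.
Qed.

Lemma jet2_damped n w : L1 w -> jet2 (damped n w) (ing w) 0 (- 2 * n%:R * ing (fun t => g t * w t)).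
Proof.
have d0 m v : damped m v 0 = ing v.
  by apply: ing_ext => t _; rewrite /damping expr0n mul0r addr0 invr1 expr1n mul1r.
move=> lw; exists (fun s => - 2 * n%:R * s * damped n.+1 (fun t => g t * w t) s); split.
- exact: d0.
- by rewrite mulr0 mul0r.
- by apply: filterE => s; exact: is_derive_damped.
have d1 := is_derive_damped n.+1 0 (L1M bg lw).
by apply: is_derive_eq; rewrite /GRing.scale/= d0; ring.
Qed.

Lemma dampedZ n c w s : L1 w -> damped n (fun t => c * w t) s = c * damped n w s.
Proof.
move=> lw; rewrite /damped -ingZ; last by apply: L1M => //; exact: BmX (damping_Bm s).
by apply: ing_ext => t _; rewrite mulrCA.
Qed.

Lemma dampedD n w v s : L1 w -> L1 v -> damped n (fun t => w t + v t) s = damped n w s + damped n v s.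
Proof.
move=> lw lv; have b := BmX n (damping_Bm s); rewrite /damped -ingD; [|exact: L1M..].
by apply: ing_ext => t _; rewrite mulrDr.
Qed.

Lemma damped_quadratic n w0 w1 w2 s c : L1 w0 -> L1 w1 -> L1 w2 ->
  damped n (fun t => w0 t + c * w1 t + c ^+ 2 * w2 t) s =
  damped n w0 s + c * damped n w1 s + c ^+ 2 * damped n w2 s.
Proof.
move=> h0 h1 h2; rewrite -!dampedZ// -!dampedD//; try (by do ?[apply: L1D|apply: L1Z]).
Qed.

End Jets.

(** * The action along [loop_chart] and its second derivatives *)

Section Chart.
Context {R : realType}.
Local Notation E := 'rV[R]_3.
Local Notation leb := (@lebesgue_measure R).
Local Notation I01 := (`[0%R, 1%R]%classic : set R).
Variables q q' xi xi' : R -> E.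
Hypothesis (hq : loop_space q) (hxi : vector_field_along q xi).
Hypothesis (dq : forall i, wd (fun t => q t 0 i) (fun t => q' t 0 i)).
Hypothesis (dxi : forall i, wd (fun t => xi t 0 i) (fun t => xi' t 0 i)).
Hypothesis qq' : forall t, dot (q t) (q' t) = 0.

Let bq i : Bm (fun t => q t 0 i) := wd_Bm (dq i).
Let bx i : Bm (fun t => xi t 0 i) := wd_Bm (dxi i).
Let lq i : L2 (fun t => q' t 0 i) := proj1 (dq i).
Let lx i : L2 (fun t => xi' t 0 i) := proj1 (dxi i).

Let g t : R := dot (xi t) (xi t).

Let hg : wd g (fun t => 2 * dot (xi t) (xi' t)).
Proof.
apply: wd_ext (wdD (wdD (wd_sqr (dxi o0)) (wd_sqr (dxi o1))) (wd_sqr (dxi o2))) => t _.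
  by rewrite /g dotE !expr2.
by rewrite dotE; ring.
Qed.

Let g0 t : 0 <= g t. Proof. exact: dot_ge0. Qed.

(** Both 0 and the product rule give a weak derivative of [q . xi], which vanishes by tangency. *)
Lemma tangent_derivative_ae : {ae leb, forall t, I01 t -> dot (q t) (xi' t) + dot (xi t) (q' t) = 0}.
Proof.
have h := wdD (wdD (wdM (dq o0) (dxi o0)) (wdM (dq o1) (dxi o1))) (wdM (dq o2) (dxi o2)).
have h0 : wd (fun t => q t 0 o0 * xi t 0 o0 + q t 0 o1 * xi t 0 o1 + q t 0 o2 * xi t 0 o2) (fun=> 0).
  apply: wd_ext (wd_cst (0 : R)) => // t _.
  by have [_ /(_ t)] := hxi; rewrite /tangent /= dotE.
have [N [mN N0 sN]] := wd_uniq h h0; exists N; split=> //.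
apply: subset_trans sN => t /= k1 k2; apply: k1 => It; rewrite -(k2 It) !dotE; ring.
Qed.

Lemma chart_norm s t : dot (q t + s *: xi t) (q t + s *: xi t) = 1 + s ^+ 2 * g t.
Proof.
have [_ /(_ t)] := hxi; have [_ /(_ t)] := hq; rewrite /g /sphere /tangent /= !dotE !mxE => h1 h2.
transitivity ((q t 0 o0 * q t 0 o0 + q t 0 o1 * q t 0 o1 + q t 0 o2 * q t 0 o2) +
  2 * s * (q t 0 o0 * xi t 0 o0 + q t 0 o1 * xi t 0 o1 + q t 0 o2 * xi t 0 o2) +
  s ^+ 2 * (xi t 0 o0 * xi t 0 o0 + xi t 0 o1 * xi t 0 o1 + xi t 0 o2 * xi t 0 o2)); first by ring.
by rewrite h1 h2; ring.
Qed.

Let mu s t : R := (Num.sqrt (1 + s ^+ 2 * g t))^-1.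
Let mu' s t : R := - mu s t ^+ 3 * (s ^+ 2 * dot (xi t) (xi' t)).

Let den s t : 1 <= 1 + s ^+ 2 * g t.
Proof. by rewrite lerDl mulr_ge0 ?sqr_ge0. Qed.

Let mu2 s t : mu s t ^+ 2 = damping g s t.
Proof. by rewrite /mu exprVn sqr_sqrtr// (le_trans ler01). Qed.

Let dmu s : wd (mu s) (mu' s).
Proof.
have h : wd (fun t => 1 + s ^+ 2 * g t) (fun t => 0 + s ^+ 2 * (2 * dot (xi t) (xi' t))).
  exact: wdD (wd_cst 1) (wdZ (s ^+ 2) hg).
have h1 := wd_sqrt (fun t _ => den s t) h.
have sq1 t : 1 <= Num.sqrt (1 + s ^+ 2 * g t) by rewrite -[leLHS]sqrtr1 ler_sqrt// (le_trans ler01).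
apply: wd_ext (wd_inv ltr01 (fun t _ => sq1 t) h1) => // t _.
by rewrite /mu' /mu; field; rewrite lt0r_neq0// (lt_le_trans ltr01).
Qed.

Definition chart_derivative s t : E :=
  mu s t *: (q' t + s *: xi' t) + mu' s t *: (q t + s *: xi t).

Lemma chart_wd s i : wd (fun t => loop_chart q (s *: xi) t 0 i) (fun t => chart_derivative s t 0 i).
Proof.
apply: wd_ext (wdM (dmu s) (wdD (dq i) (wdZ s (dxi i)))) => t _.
  by rewrite /loop_chart -[(s *: xi) t]/(s *: xi t) chart_norm !mxE.
by rewrite !mxE; ring.
Qed.

Lemma chart_loop_space s : loop_space (loop_chart q (s *: xi)).
Proof.
have [[pq _] Sq] := hq; have [[px _] Tx] := hxi; split; first split.
- by move=> t; rewrite /loop_chart -![(s *: xi) _]/(s *: xi _) pq px.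
- by exists (chart_derivative s); apply/weak_derivativeP => i; exact: chart_wd.
move=> t; rewrite /sphere /= /loop_chart -[(s *: xi) t]/(s *: xi t) chart_norm -/(mu s t).
transitivity (mu s t ^+ 2 * dot (q t + s *: xi t) (q t + s *: xi t)); first by rewrite !dotE !mxE; ring.
by rewrite mu2 chart_norm /damping mulVf// lt0r_neq0// (lt_le_trans ltr01).
Qed.

Lemma dot2_L1 (f h : R -> E) : (forall i, L2 (fun t => f t 0 i)) -> (forall i, L2 (fun t => h t 0 i)) ->
  L1 (fun t => dot (f t) (h t)).
Proof.
move=> hf hh; have l i := L2M_L1 (hf i) (hh i).
by apply: L1_ext (L1D (L1D (l o0) (l o1)) (l o2)) => t _; rewrite dotE.
Qed.

Let k3L : L2 (fun t => dot (xi t) (xi' t)).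
Proof.
have l i := L2M (bx i) (lx i).
have := L2D (L2D (l o0) (l o1)) (l o2).
by congr L2; apply/funext => t; rewrite dotE.
Qed.

Lemma ing_chart_velocity s :
  ing (fun t => dot (wderiv (loop_chart q (s *: xi)) t) (wderiv (loop_chart q (s *: xi)) t)) =
  ing (fun t => damping g s t ^+ 1 * (dot (q' t) (q' t) + s * (2 * dot (q' t) (xi' t)) + s ^+ 2 * dot (xi' t) (xi' t)))
  - ing (fun t => damping g s t ^+ 2 * (s ^+ 4 * dot (xi t) (xi' t) ^+ 2)).
Proof.
have hw i := chart_wd s i; have [Wc _] := chart_loop_space s.
have bd := damping_Bm hg g0.
have l1 : L1 (fun t => damping g s t ^+ 1 * (dot (q' t) (q' t) + s * (2 * dot (q' t) (xi' t)) + s ^+ 2 * dot (xi' t) (xi' t))).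
  apply: L1M; first exact: BmX (bd s).
  by apply: L1D; [apply: L1D; [|apply: L1Z; apply: L1Z]|apply: L1Z]; exact: dot2_L1.
have l2 : L1 (fun t => damping g s t ^+ 2 * (s ^+ 4 * dot (xi t) (xi' t) ^+ 2)).
  by apply: L1M; [exact: BmX (bd s)|apply: L1Z; have [] := k3L].
rewrite -ingB// ing_dot; last by move=> i; have [] := W12_wd i Wc.
transitivity (ing (fun t => dot (chart_derivative s t) (chart_derivative s t))).
  rewrite ing_dot; last by move=> i; have [] := hw i.
  apply: eq_bigr => i _; apply: ing_ae; [by have [[_]] := W12_wd i Wc|by have [[_]] := hw i|].
  have [N [mN N0 sN]] := wderiv_ae i hw; exists N; split=> //.
  by apply: subset_trans sN => t /= k1 k2; apply: k1 => It; rewrite k2.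
apply: ing_ae; [by apply: dot_L1 => i; have [] := hw i|exact: L1B|].
have [N [mN N0 sN]] := tangent_derivative_ae; exists N; split=> //.
apply: subset_trans sN => t /= k1 k2; apply: k1 => It; have {k2} := k2 It.
have := qq' t; have := chart_norm s t; rewrite -mu2 /chart_derivative /mu'.
have : mu s t ^+ 2 * (1 + s ^+ 2 * g t) = 1.
  by rewrite mu2 /damping mulVf// lt0r_neq0// (lt_le_trans ltr01).
move: (mu s t) (g t) => m gt; rewrite !dotE !mxE.
move: (q t 0 o0) (q t 0 o1) (q t 0 o2) (q' t 0 o0) (q' t 0 o1) (q' t 0 o2) => q0 q1 q2 u0 u1 u2.
move: (xi t 0 o0) (xi t 0 o1) (xi t 0 o2) (xi' t 0 o0) (xi' t 0 o1) (xi' t 0 o2) => x0 x1 x2 v0 v1 v2.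
move=> h1 h2 h3 h4.
(* [|(X / |X|)'|^2 = |X'|^2 / |X|^2 - (X . X')^2 / |X|^4], where [X = q + s xi] *)
pose XX := (q0 + s * x0) * (q0 + s * x0) + (q1 + s * x1) * (q1 + s * x1) + (q2 + s * x2) * (q2 + s * x2).
pose XU := (q0 + s * x0) * (u0 + s * v0) + (q1 + s * x1) * (u1 + s * v1) + (q2 + s * x2) * (u2 + s * v2).
pose c := x0 * v0 + x1 * v1 + x2 * v2.
have eXU : XU = s ^+ 2 * c.
  transitivity ((q0 * u0 + q1 * u1 + q2 * u2) + s * (q0 * v0 + q1 * v1 + q2 * v2 + (x0 * u0 + x1 * u1 + x2 * u2)) + s ^+ 2 * c).
    by rewrite /XU /c; ring.
  by rewrite h3 h4; ring.
have eXX : m ^+ 2 * XX = 1 by rewrite /XX h2.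
transitivity (m ^+ 2 * ((u0 + s * v0) * (u0 + s * v0) + (u1 + s * v1) * (u1 + s * v1) + (u2 + s * v2) * (u2 + s * v2))
  - 2 * m ^+ 4 * (s ^+ 2 * c) * XU + m ^+ 4 * (s ^+ 2 * c) ^+ 2 * (m ^+ 2 * XX)); first by rewrite /XU /XX /c; ring.
by rewrite eXU eXX /c; ring.
Qed.

(** With [X = q + s xi], the functions [r0], [r1], [r2] and [b0], [b1], [b2] are the coefficients of
    1, [s], [s^2] in [x^2 + y^2] and in [x dy - y dx] along [X]. *)
Let r0 t : R := q t 0 o0 * q t 0 o0 + q t 0 o1 * q t 0 o1.
Let r1 t : R := 2 * (q t 0 o0 * xi t 0 o0 + q t 0 o1 * xi t 0 o1).
Let r2 t : R := xi t 0 o0 * xi t 0 o0 + xi t 0 o1 * xi t 0 o1.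
Let b0 t : R := q t 0 o0 * q' t 0 o1 - q t 0 o1 * q' t 0 o0.
Let b1 t : R := (q t 0 o0 * xi' t 0 o1 - q t 0 o1 * xi' t 0 o0) + (xi t 0 o0 * q' t 0 o1 - xi t 0 o1 * q' t 0 o0).
Let b2 t : R := xi t 0 o0 * xi' t 0 o1 - xi t 0 o1 * xi' t 0 o0.

Let br0 : Bm r0. Proof. by apply: BmD; exact: BmM. Qed.
Let br1 : Bm r1. Proof. by apply: BmZ; apply: BmD; exact: BmM. Qed.
Let br2 : Bm r2. Proof. by apply: BmD; exact: BmM. Qed.
Let lb0 : L1 b0. Proof. by apply: L2_L1; apply: L2B; exact: L2M. Qed.
Let lb1 : L1 b1. Proof. by apply: L2_L1; apply: L2D; apply: L2B; exact: L2M. Qed.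
Let lb2 : L1 b2. Proof. by apply: L2_L1; apply: L2B; exact: L2M. Qed.

Lemma chart_area s : loop_area (loop_chart q (s *: xi)) =
  4^-1 * ing (fun t => damping g s t ^+ 2 * ((r0 t + s * r1 t + s ^+ 2 * r2 t) * (b0 t + s * b1 t + s ^+ 2 * b2 t)))
  - 2^-1 * ing (fun t => damping g s t ^+ 1 * (b0 t + s * b1 t + s ^+ 2 * b2 t)).
Proof.
have hw i := chart_wd s i; have [Wc _] := chart_loop_space s; have hd i := W12_wd i Wc.
have bd := damping_Bm hg g0.
have lb : L1 (fun t => b0 t + s * b1 t + s ^+ 2 * b2 t) by apply: L1D; [apply: L1D => //|]; exact: L1Z.
have br : Bm (fun t => r0 t + s * r1 t + s ^+ 2 * r2 t) by apply: BmD; [apply: BmD => //|]; exact: BmZ.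
have l1 : L1 (fun t => damping g s t ^+ 1 * (b0 t + s * b1 t + s ^+ 2 * b2 t)) by apply: L1M => //; exact: BmX (bd s).
have l2 : L1 (fun t => damping g s t ^+ 2 * ((r0 t + s * r1 t + s ^+ 2 * r2 t) * (b0 t + s * b1 t + s ^+ 2 * b2 t))).
  by apply: L1M; [exact: BmX (bd s)|exact: L1M].
rewrite -!ingZ// -ingB; [|exact: L1Z..].
have bc i : Bm (fun t => loop_chart q (s *: xi) t 0 i) := wd_Bm (hw i).
apply: ing_ae.
- apply: L1M.
    apply: BmB; last exact: Bm_cst.
    by apply: BmM; [apply: BmD; exact: BmM|exact: Bm_cst].
  by apply: L2_L1; apply: L2B; apply: L2M => //; have [] := hd o0; have [] := hd o1.
- by apply: L1B; exact: L1Z.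
have := negligibleU (wderiv_ae o0 hw) (wderiv_ae o1 hw); apply: negligibleS => t /= k.
apply: contrapT => /not_orP[/contrapT h0 /contrapT h1]; apply: k => It.
rewrite h0// h1//.
rewrite /loop_chart -[(s *: xi) t]/(s *: xi t) chart_norm -/(mu s t) -mu2 /chart_derivative.
rewrite /r0 /r1 /r2 /b0 /b1 /b2 !mxE; by field.
Qed.

Let lk0 : L1 (fun t => dot (q' t) (q' t)). Proof. exact: dot2_L1. Qed.
Let lk1 : L1 (fun t => 2 * dot (q' t) (xi' t)). Proof. by apply: L1Z; exact: dot2_L1. Qed.
Let lk2 : L1 (fun t => dot (xi' t) (xi' t)). Proof. exact: dot2_L1. Qed.
Let lk3 : L1 (fun t => dot (xi t) (xi' t) ^+ 2). Proof. by have [] := k3L. Qed.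

Let jD n w (lw : L1 w) := jet2_damped hg g0 n lw.

Lemma chart_velocity_jet : jet2
  (fun s => ing (fun t => dot (wderiv (loop_chart q (s *: xi)) t) (wderiv (loop_chart q (s *: xi)) t)))
  (ing (fun t => dot (q' t) (q' t))) (2 * ing (fun t => dot (q' t) (xi' t)))
  (2 * ing (fun t => dot (xi' t) (xi' t)) - 2 * ing (fun t => dot (xi t) (xi t) * dot (q' t) (q' t))).
Proof.
have ji := @jet2_id R; have bd := damping_Bm hg g0.
have := jet2D (jet2D (jet2D (jD 1 lk0) (jet2M ji (jD 1 lk1))) (jet2M (jet2M ji ji) (jD 1 lk2)))
   (jet2M (jet2M (jet2M ji ji) (jet2M ji ji)) (jet2M (jet2_cst (-1)) (jD 2 lk3))).
have e : ing (fun t => 2 * dot (q' t) (xi' t)) = 2 * ing (fun t => dot (q' t) (xi' t)).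
  by apply: ingZ; exact: dot2_L1.
congr jet2; [|by ring|by rewrite e; ring|by rewrite /g e; ring].
apply/funext => s; transitivity (damped g 1 (fun t => dot (q' t) (q' t) + s * (2 * dot (q' t) (xi' t)) + s ^+ 2 * dot (xi' t) (xi' t)) s
  - damped g 2 (fun t => s ^+ 4 * dot (xi t) (xi' t) ^+ 2) s); last exact/esym/ing_chart_velocity.
by rewrite (damped_quadratic hg g0)// [X in _ - X](dampedZ hg g0)//=; ring.
Qed.

Let la0 : L1 (fun t => r0 t * b0 t). Proof. exact: L1M. Qed.
Let la1 : L1 (fun t => r0 t * b1 t + r1 t * b0 t). Proof. by apply: L1D; exact: L1M. Qed.
Let la2 : L1 (fun t => r0 t * b2 t + r1 t * b1 t + r2 t * b0 t).
Proof. by apply: L1D; [apply: L1D|]; exact: L1M. Qed.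
Let la3 : L1 (fun t => r1 t * b2 t + r2 t * b1 t). Proof. by apply: L1D; exact: L1M. Qed.
Let la4 : L1 (fun t => r2 t * b2 t). Proof. exact: L1M. Qed.

(** The radial projection multiplies [rho (x dy - y dx)] by [damping ^+ 2] and [x dy - y dx] by
    [damping]. The second derivatives of these factors, [- 4 g] and [- 2 g] at 0, produce the last
    term of the integrand. *)
Lemma chart_area_jet : exists a b, jet2 (fun s => loop_area (loop_chart q (s *: xi))) a b
  (ing (fun t => 2^-1 * (r0 t * b2 t + r1 t * b1 t + r2 t * b0 t) - b2 t + g t * ((1 - r0 t) * b0 t))).
Proof.
have ji := @jet2_id R; have bd := damping_Bm hg g0.
do 2!eexists.
have j2 := jet2D (jet2D (jD 2 la0) (jet2M ji (jD 2 la1)))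
   (jet2D (jet2M (jet2M ji ji) (jD 2 la2))
     (jet2M (jet2M ji ji) (jet2D (jet2M ji (jD 2 la3)) (jet2M (jet2M ji ji) (jD 2 la4))))).
have j1 := jet2D (jet2D (jD 1 lb0) (jet2M ji (jD 1 lb1))) (jet2M (jet2M ji ji) (jD 1 lb2)).
have := jet2D (jet2M (jet2_cst 4^-1) j2) (jet2M (jet2_cst (- 2^-1)) j1).
have bg := wd_Bm hg.
congr jet2; last first.
  rewrite -[RHS](_ : 2^-1 * ing (fun t => r0 t * b2 t + r1 t * b1 t + r2 t * b0 t) - ing b2 +
    (ing (fun t => g t * b0 t) - ing (fun t => g t * (r0 t * b0 t))) = _); last first.
    have lg0 : L1 (fun t => g t * b0 t) by exact: L1M.
    have lg1 : L1 (fun t => g t * (r0 t * b0 t)) by exact: L1M.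
    rewrite -(ingB lg0 lg1) -(ingZ _ la2) -(ingB (L1Z _ la2) lb2) -ingD.
    - by apply: ing_ext => t _; ring.
    - by apply: L1B => //; exact: L1Z.
    - exact: L1B.
  by rewrite !(mul0r, mulr0, add0r, addr0); field.
apply/funext => s; transitivity (
  4^-1 * damped g 2 (fun t => r0 t * b0 t + s * (r0 t * b1 t + r1 t * b0 t) +
     s ^+ 2 * (r0 t * b2 t + r1 t * b1 t + r2 t * b0 t + s * (r1 t * b2 t + r2 t * b1 t) + s ^+ 2 * (r2 t * b2 t))) s
  - 2^-1 * damped g 1 (fun t => b0 t + s * b1 t + s ^+ 2 * b2 t) s).
  rewrite !(damped_quadratic hg g0)//; last by apply: L1D; [apply: L1D => //|]; exact: L1Z.
  by rewrite /=; ring.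
rewrite chart_area; congr (_ * _ - _).
by apply: ing_ext => t _; ring.
Qed.

Lemma action_chart q0 k s (T : R) : loop_space q0 -> T != 0 ->
  free_time_action round_metric magnetic q0 k (loop_chart q (s *: xi)) T =
  2^-1 * T^-1 * ing (fun t => dot (wderiv (loop_chart q (s *: xi)) t) (wderiv (loop_chart q (s *: xi)) t))
  + k * T + (loop_area (loop_chart q (s *: xi)) - loop_area q0).
Proof.
move=> h0 T0; have hc := chart_loop_space s; have [Wc _] := hc.
rewrite /free_time_action magnetic_termE//; congr (_ + _).
have lw : L1 (fun t => dot (wderiv (loop_chart q (s *: xi)) t) (wderiv (loop_chart q (s *: xi)) t)).
  by apply: dot_L1 => i; have [] := W12_wd i Wc.
rewrite -/(ing _) (@ing_ext _ _ (fun t => 2^-1 * T ^- 2 *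
  dot (wderiv (loop_chart q (s *: xi)) t) (wderiv (loop_chart q (s *: xi)) t) + k)); last first.
  by move=> t _; rewrite /lagrangian bil_round !dotE !mxE; field.
rewrite ingD; [|exact: L1Z|exact: L1_cst].
by rewrite ingZ// ing_cst; field.
Qed.

Let A2 := ing (fun t => 2^-1 * (r0 t * b2 t + r1 t * b1 t + r2 t * b0 t) - b2 t + g t * ((1 - r0 t) * b0 t)).
Let K0 := ing (fun t => dot (q' t) (q' t)).
Let K1 := ing (fun t => dot (q' t) (xi' t)).
Let K2 := ing (fun t => dot (xi' t) (xi' t)) - ing (fun t => dot (xi t) (xi t) * dot (q' t) (q' t)).

Lemma fixed_time_hessian q0 k (T : R) : loop_space q0 -> T != 0 ->
  hessian_fixed_time round_metric magnetic q0 k q T xi = T^-1 * K2 + A2.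
Proof.
move=> h0 T0.
have [a [b jA]] := chart_area_jet; have jK := chart_velocity_jet.
have := jet2D (jet2D (jet2M (jet2_cst (2^-1 * T^-1)) jK) (jet2_cst (k * T)))
  (jet2D jA (jet2_cst (- loop_area q0))).
move=> /jet2_derive1n; rewrite /hessian_fixed_time.
have -> : (fun s => free_time_action round_metric magnetic q0 k (loop_chart q (s *: xi)) T) = (fun s =>
   2^-1 * T^-1 * ing (fun t => dot (wderiv (loop_chart q (s *: xi)) t) (wderiv (loop_chart q (s *: xi)) t))
  + k * T + (loop_area (loop_chart q (s *: xi)) - loop_area q0)).
  by apply/funext => s; exact: action_chart.
by move=> ->; rewrite /K2 -/A2; field.
Qed.

Definition hessian_density (T t : R) : R :=
  T^-1 * (dot (xi' t) (xi' t) - dot (xi t) (xi t) * dot (q' t) (q' t)) +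
  (2^-1 * (r0 t * b2 t + r1 t * b1 t + r2 t * b0 t) - b2 t + g t * ((1 - r0 t) * b0 t)).

Let lgk : L1 (fun t => dot (xi t) (xi t) * dot (q' t) (q' t)).
Proof. by apply: L1M => //; exact: (wd_Bm hg). Qed.

Let lA2 : L1 (fun t => 2^-1 * (r0 t * b2 t + r1 t * b1 t + r2 t * b0 t) - b2 t + g t * ((1 - r0 t) * b0 t)).
Proof.
apply: L1D; first by apply: L1B => //; exact: L1Z.
by apply: L1M; [exact: (wd_Bm hg)|apply: L1M => //; apply: BmB => //; exact: Bm_cst].
Qed.

Lemma hessian_density_L1 T : L1 (hessian_density T).
Proof. by apply: L1D => //; apply: L1Z; exact: L1B. Qed.

Lemma fixed_time_hessianE q0 k (T : R) : loop_space q0 -> T != 0 ->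
  hessian_fixed_time round_metric magnetic q0 k q T xi = ing (hessian_density T).
Proof.
move=> h0 T0; rewrite fixed_time_hessian// /K2 -ingB// -ingZ; last exact: L1B.
by rewrite /A2 -ingD//; apply: L1Z; exact: L1B.
Qed.

(** The period enters through [E / (2 T) + k T], where [E] is the integral of the squared velocity.
    The second summand is affine, so the terms in [tau] come from the expansion of [1 / (T + s tau)]
    against that of [E]. *)
Lemma free_time_hessian q0 k (T tau : R) : loop_space q0 -> T != 0 ->
  hessian_free_time round_metric magnetic q0 k q T (xi, tau) =
  hessian_fixed_time round_metric magnetic q0 k q T xi - 2 * tau / T ^+ 2 * K1 + tau ^+ 2 / T ^+ 3 * K0.
Proof.
move=> h0 T0; rewrite fixed_time_hessian//.
have [a [b jA]] := chart_area_jet; have jK := chart_velocity_jet.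
have jT : jet2 (fun s => T + s * tau) T tau 0.
  have := jet2D (jet2_cst T) (jet2M (@jet2_id R) (jet2_cst tau)); congr jet2; ring.
have := jet2D (jet2D (jet2M (jet2M (jet2_cst 2^-1) (jet2V T0 jT)) jK) (jet2M (jet2_cst k) jT))
  (jet2D jA (jet2_cst (- loop_area q0))).
have [T1 [_ _ hT _]] := jT.
have nz : \forall s \near (0 : R), T + s * tau != 0.
  have := derive_continuous (nbhs_singleton hT); move=> /cvgrPdist_lt/(_ `|T|).
  rewrite mul0r addr0 normr_gt0 => /(_ T0).
  by apply: filterS => s; apply: contraTneq => ->; rewrite subr0 ltxx.
move=> j; rewrite /hessian_free_time; set F := (X in derive1n 2 X).
rewrite (jet2_derive1n (jet2_near _ j)); last first.
  by apply: filterS nz => s hs; rewrite /F action_chart.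
by rewrite /K0 /K1 /K2 -/A2; field.
Qed.

End Chart.

(** * Two criteria for the value of a Morse index *)

Section MorseIndex.
Context {R : realType} {V : lmodType R}.
Implicit Types (D : set V) (Q : V -> R).

Lemma morse_index0 D Q : D 0 -> (forall v, D v -> 0 <= Q v) -> morse_index D Q 0.
Proof.
move=> D0 Q0; split.
  exists [set 0]; split; [by move=> v ->| |by move=> v -> /eqP].
  exists (fun=> 0); split; first by move=> a _ [].
  apply/seteqP; split=> v; first by move=> ->; exists (fun=> 0); rewrite big_ord0.
  by move=> [a ->]; rewrite big_ord0.
case=> // m [A [AD [e [ei Ae]] neg]].
have Ae0 : A (e ord0).
  rewrite Ae; exists (fun i => (i == ord0)%:R); rewrite (bigD1 ord0)//= ?eqxx ?mulr1n scale1r big1 ?addr0//.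
  by move=> i /negbTE ->; rewrite scale0r.
have e0 : e ord0 != 0.
  apply/eqP => e0; have /ei/(_ ord0)/eqP : \sum_i (i == ord0)%:R *: e i = 0.
    by rewrite big1// => i _; case: eqVneq => [->|_]; rewrite ?e0 ?scaler0 ?scale0r.
  by rewrite eqxx oner_eq0.
by have := neg _ Ae0 e0; rewrite ltNge Q0//; exact: AD.
Qed.

(** A subspace of dimension two meets the kernel of [l] nontrivially, and there [Q] is not negative.
    Linearity is asked on [D] only, since [l] will be an integral, additive on integrable
    functions. *)
Lemma morse_index1 D Q (l : V -> R) v0 :
  (forall a, D (a *: v0)) -> (forall a, a != 0 -> Q (a *: v0) < 0) -> v0 != 0 ->
  (forall a b u v, D u -> D v -> l (a *: u + b *: v) = a * l u + b * l v) ->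
  (forall v, D v -> l v = 0 -> 0 <= Q v) -> morse_index D Q 1.
Proof.
move=> Dv Qv v00 ll hQ; split.
  exists [set v | exists a, v = a *: v0]; split.
  - by move=> v [a ->].
  - exists (fun=> v0); split.
      move=> a; rewrite big_ord1 => /eqP; rewrite scaler_eq0 (negbTE v00) orbF => /eqP h i.
      by rewrite ord1.
    apply/seteqP; split=> v [a ->]; first by exists (fun=> a); rewrite big_ord1.
    by exists (a ord0); rewrite big_ord1.
  - move=> v [a ->] h; apply: Qv; apply: contraNneq h => ->; by rewrite scale0r.
move=> [|[|m]]// [A [AD [e [ei Ae]] neg]]; exfalso.
pose i0 : 'I_m.+2 := ord0; pose i1 : 'I_m.+2 := lift ord0 ord0.
have cE x y : \sum_i (if i == i0 then x else if i == i1 then y else 0) *: e i = x *: e i0 + y *: e i1.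
  rewrite (bigD1 i0)//= (bigD1 i1)//= big1 ?addr0//.
  by move=> i /andP[/negbTE -> /negbTE ->]; rewrite scale0r.
have Ac x y : A (x *: e i0 + y *: e i1) by rewrite Ae; eexists; rewrite -cE.
have A0 : A (e i0) by have := Ac 1 0; rewrite scale1r scale0r addr0.
have A1 : A (e i1) by have := Ac 0 1; rewrite scale1r scale0r add0r.
have c0 x y : x *: e i0 + y *: e i1 = 0 -> x = 0 /\ y = 0.
  by rewrite -cE => /ei h; split; [have := h i0|have := h i1]; rewrite ?eqxx.
have contra x y : x * l (e i0) + y * l (e i1) = 0 -> x = 0 /\ y = 0.
  move=> lxy; apply: c0; apply: contrapT => /eqP n0.
  have := neg _ (Ac x y) n0; rewrite ltNge hQ//; first exact: AD.
  by rewrite ll//; exact: AD.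
(* The combination of the first two basis vectors annihilated by [l] must be trivial, so [l]
   vanishes on both; but then the first alone is already a contradiction. *)
have [|l1 l0] := contra (l (e i1)) (- l (e i0)); first by rewrite mulNr mulrC subrr.
have [] := contra 1 0; first by rewrite mul0r addr0 mul1r; apply/eqP; rewrite -oppr_eq0 l0.
by move/eqP; rewrite oner_eq0.
Qed.

End MorseIndex.

(** * The Hessians at a latitude and their indices *)

Section LatitudeIndex.
Context {R : realType}.
Local Notation E := 'rV[R]_3.
Local Notation leb := (@lebesgue_measure R).
Local Notation I01 := (`[0%R, 1%R]%classic : set R).
Variables r z : R.
Hypothesis (r0 : 0 < r) (z0 : 0 < z) (rz : r ^+ 2 + z ^+ 2 = 1).
Local Notation w := (2 * pi : R).
Local Notation T := (w / z ^+ 2).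

Let C (t : R) : R := cos (w * t).
Let S (t : R) : R := sin (w * t).

Definition latitude_loop (t : R) : E := vec (r * C t) (r * S t) z.
Definition latitude_loop' (t : R) : E := vec (- (r * w * S t)) (r * w * C t) 0.

Lemma loop_of_latitude : loop_of_orbit (latitude r z) T = latitude_loop.
Proof.
apply/funext => t; rewrite /loop_of_orbit /latitude /= /latitude_loop /C /S.
by have -> : z ^+ 2 * (T * t) = w * t by field; exact: lt0r_neq0.
Qed.

Let S2 t : S t ^+ 2 = 1 - C t ^+ 2. Proof. exact: sin2. Qed.
Let r2 : r ^+ 2 = 1 - z ^+ 2. Proof. by rewrite -rz addrK. Qed.

Let dC : wd C (fun t => - (w * S t)).
Proof.
apply: wd_C1; first by move=> t; exact: is_derive_cos_lin.
move=> t; apply: cvgN; apply: cvgM; first exact: cvg_cst.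
apply: continuous_comp; last exact: continuous_sin.
by apply: cvgM; [exact: cvg_cst|exact: cvg_id].
Qed.

Let dS' : wd S (fun t => w * C t).
Proof.
apply: wd_C1; first by move=> t; exact: is_derive_sin_lin.
move=> t; apply: cvgM; first exact: cvg_cst.
apply: continuous_comp; last exact: continuous_cos.
by apply: cvgM; [exact: cvg_cst|exact: cvg_id].
Qed.

Let wd_q i : wd (fun t => latitude_loop t 0 i) (fun t => latitude_loop' t 0 i).
Proof.
move: i; apply: ord3P.
- by apply: wd_ext (wdZ r dC) => t _; rewrite vecE //; ring.
- by apply: wd_ext (wdZ r dS') => t _; rewrite vecE //; ring.
- by apply: wd_ext (wd_cst z) => t _; rewrite vecE.
Qed.

Let C1 t : C (t + 1) = C t.
Proof. by rewrite /C mulrDr mulr1 mulr_natl cosD2pi. Qed.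

Let S1 t : S (t + 1) = S t.
Proof. by rewrite /S mulrDr mulr1 mulr_natl sinD2pi. Qed.

Lemma latitude_loop_space : loop_space latitude_loop.
Proof.
split; first split.
- by move=> t; rewrite /latitude_loop C1 S1.
- by exists latitude_loop'; apply/weak_derivativeP.
by move=> t; rewrite /sphere /= dotE !vecE; ring: (S2 t) r2.
Qed.

Let qq' t : dot (latitude_loop t) (latitude_loop' t) = 0.
Proof. by rewrite dotE !vecE; ring. Qed.

Section Field.
Variables xi xi' : R -> E.
Hypothesis hxi : vector_field_along latitude_loop xi.
Hypothesis dxi : forall i, wd (fun t => xi t 0 i) (fun t => xi' t 0 i).

(* [- r * colatitude xi] is the vertical component of [xi]. *)
Definition colatitude (t : R) : R := - (xi t 0 o2 / r).
Definition colatitude' (t : R) : R := - (xi' t 0 o2 / r).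
Definition longitude (t : R) : R := - S t * xi t 0 o0 + C t * xi t 0 o1.
(** The [beta] of the overview, [eta] being [colatitude]: the component of [xi'] along the latitude.
    It differs from the derivative of [longitude] because the tangent direction rotates. *)
Definition spin (t : R) : R := - S t * xi' t 0 o0 + C t * xi' t 0 o1.

Lemma wd_colatitude : wd colatitude colatitude'.
Proof. by apply: wd_ext (wdZ (- r^-1) (dxi o2)) => t _; rewrite mulNr mulrC. Qed.

Lemma colatitude_per : colatitude 0 = colatitude 1.
Proof. by have [[p _] _] := hxi; rewrite /colatitude -[1]add0r p. Qed.

Let radial t : C t * xi t 0 o0 + S t * xi t 0 o1 = z * colatitude t.
Proof.
have [_ /(_ t)] := hxi; rewrite /tangent /= dotE !vecE => h.
apply: (mulfI (lt0r_neq0 r0)); transitivity (- (z * xi t 0 o2)); first by rewrite -[RHS]addr0 -h; ring.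
by rewrite /colatitude; field; exact: lt0r_neq0.
Qed.

Lemma wd_longitude : wd longitude (fun t => spin t - w * (z * colatitude t)).
Proof.
apply: wd_ext (wdD (wdZ (-1) (wdM dS' (dxi o0))) (wdM dC (dxi o1))) => t _; first by rewrite /longitude; ring.
by rewrite -radial /spin; ring.
Qed.

Lemma longitude_per : longitude 1 = longitude 0.
Proof. by have [[p _] _] := hxi; rewrite /longitude -[1]add0r C1 S1 p. Qed.

Lemma spin_L2 : L2 spin.
Proof.
by apply: L2D; apply: L2M; try exact: (proj1 (dxi _)); [apply: BmN|]; exact: wd_Bm dS' || exact: wd_Bm dC.
Qed.

(** The derivative of the periodic function [longitude] has mean zero. *)
Lemma ing_spin : ing spin = w * z * ing colatitude.
Proof.
have lc : L1 (fun t => w * (z * colatitude t)).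
  by apply: L1Z; apply: L1Z; apply: Bm_L1; exact: wd_Bm wd_colatitude.
have := wd_ing wd_longitude; rewrite longitude_per subrr (ingB (L2_L1 spin_L2) lc) => /eqP.
rewrite subr_eq0 => /eqP ->.
have lc0 : L1 colatitude by apply: Bm_L1; exact: wd_Bm wd_colatitude.
by rewrite ingZ ?ingZ ?mulrA//; exact: L1Z.
Qed.

Let D : R := w ^+ 2 * (1 - 3 * r ^+ 2).

Lemma latitude_fixed_hessian q0 k : loop_space q0 ->
  hessian_fixed_time round_metric magnetic q0 k latitude_loop T xi =
  T^-1 * (ing (fun t => colatitude' t ^+ 2) + ing (fun t => spin t ^+ 2) - D * ing (fun t => colatitude t ^+ 2)).
Proof.
move=> h0.
have w0 : w != 0 by rewrite lt0r_neq0// mulr_gt0// pi_gt0.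
have zn := lt0r_neq0 z0; have rn := lt0r_neq0 r0.
have T0 : T != 0 by rewrite mulf_neq0// invr_neq0// expf_neq0.
rewrite (fixed_time_hessianE latitude_loop_space hxi wd_q dxi qq' k h0 T0).
have [[_ l1] _] := wd_colatitude; have [_ l2] := spin_L2.
have [_ l3] := Bm_L2 (wd_Bm wd_colatitude).
(* Both integrands differ by the derivative of a multiple of [colatitude * longitude]. *)
pose kap : R := w / z ^+ 2 * (3 * r ^+ 2 / 2 - 1).
have hW := wdZ (T^-1 * kap) (wdM (wdZ z wd_colatitude) wd_longitude).
have := wd_ing hW; rewrite -colatitude_per longitude_per subrr => W0.
have lD : L1 (fun t => T^-1 * (colatitude' t ^+ 2 + spin t ^+ 2 - D * colatitude t ^+ 2)).
  by apply: L1Z; apply: L1B; [exact: L1D|exact: L1Z].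
rewrite -(ingD l1 l2) -(ingZ _ l3) -(ingB (L1D l1 l2) (L1Z _ l3)).
rewrite -(ingZ _ (L1B (L1D l1 l2) (L1Z _ l3))).
rewrite -[RHS]addr0 -W0 -ingD//; last exact: wd_L1 hW.
apply: ing_ae.
- exact: hessian_density_L1.
- by apply: L1D => //; exact: wd_L1 hW.
have := tangent_derivative_ae hxi wd_q dxi; apply: negligibleS => t /= k1 k2; apply: k1 => It.
have {k2} := k2 It; have := radial t; have := S2 t; have := r2.
have c2 : xi t 0 o2 = - (r * colatitude t) by rewrite /colatitude; field.
have c2' : xi' t 0 o2 = - (r * colatitude' t) by rewrite /colatitude'; field.
rewrite /hessian_density !dotE c2 c2' !vecE /kap /D.
move: (colatitude t) (colatitude' t) => e e'.
rewrite /longitude /spin.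
move: (xi t 0 o0) (xi t 0 o1) (xi' t 0 o0) (xi' t 0 o1) (C t) (S t) => x0 x1 v0 v1 c s.
move=> hr hs h1 h2.
(* [xi] and [xi'] are expressed in the rotating frame of the radial and tangential directions: [b]
   and [be] are tangential components, and [a'], the radial component of [xi'], comes from the
   differentiated tangency. *)
pose b := - s * x0 + c * x1; pose be := - s * v0 + c * v1.
have a' : c * v0 + s * v1 = z * e' - w * b.
  apply: (mulfI rn); rewrite /b; lra.
have ex0 : x0 = c * (z * e) - s * b by rewrite -h1 /b; ring: hs.
have ex1 : x1 = s * (z * e) + c * b by rewrite -h1 /b; ring: hs.
have ev0 : v0 = c * (z * e' - w * b) - s * be by rewrite -a' /be; ring: hs.
have ev1 : v1 = s * (z * e' - w * b) + c * be by rewrite -a' /be; ring: hs.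
rewrite -/b -/be; clearbody b be; rewrite ex0 ex1 ev0 ev1.
move: w0; move: (2 * pi : R) => W Wn.
by field: hs hr; rewrite zn.
Qed.

(** The terms in [tau] combine with the squared mean of [spin], known from [ing_spin], into a
    complete square. *)
Lemma latitude_free_hessian q0 k tau : loop_space q0 ->
  hessian_free_time round_metric magnetic q0 k latitude_loop T (xi, tau) =
  T^-1 * (ing (fun t => colatitude' t ^+ 2) + (ing (fun t => spin t ^+ 2) - ing spin ^+ 2)
    - D * ing (fun t => colatitude t ^+ 2) + w ^+ 2 * (r * tau / T - z * ing colatitude) ^+ 2).
Proof.
move=> h0.
have w0 : w != 0 by rewrite lt0r_neq0// mulr_gt0// pi_gt0.
have zn := lt0r_neq0 z0; have rn := lt0r_neq0 r0.
have T0 : T != 0 by rewrite mulf_neq0// invr_neq0// expf_neq0.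
rewrite (free_time_hessian latitude_loop_space hxi wd_q dxi qq' k _ h0 T0) latitude_fixed_hessian//.
have -> : ing (fun t => dot (latitude_loop' t) (xi' t)) = r * w * ing spin.
  rewrite -ingZ; last exact: L2_L1 spin_L2.
  by apply: ing_ext => t _; rewrite dotE !vecE /spin; ring.
have -> : ing (fun t => dot (latitude_loop' t) (latitude_loop' t)) = r ^+ 2 * w ^+ 2.
  rewrite -[RHS](@ing_cst R); apply: ing_ext => t _; rewrite dotE !vecE; ring: (S2 t).
rewrite ing_spin; move: T0; move: T => T1 T10.
by field.
Qed.

Lemma ing_sqr_ge (f : R -> R) : L2 f -> ing f ^+ 2 <= ing (fun t => f t ^+ 2).
Proof.
move=> hf; have := @inab_CS R 0 1 f (lexx _) ler01 (lexx _) hf.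
by rewrite subr0 mul1r !inab01.
Qed.

Hypothesis (r3 : 3 * r ^+ 2 < 1) (D8 : D <= 8).

Let D0 : 0 < D.
Proof. by rewrite mulr_gt0 ?subr_gt0// exprn_gt0// mulr_gt0// pi_gt0. Qed.

Let T_gt0 : 0 < T.
Proof. by rewrite divr_gt0 ?exprn_gt0// mulr_gt0// pi_gt0. Qed.

Let colatitude_variance :
  D * (ing (fun t => colatitude t ^+ 2) - ing colatitude ^+ 2) <= ing (fun t => colatitude' t ^+ 2).
Proof.
apply: le_trans (wirtinger wd_colatitude colatitude_per); apply: ler_wpM2r => //.
by rewrite subr_ge0; apply: ing_sqr_ge; apply: Bm_L2; exact: wd_Bm wd_colatitude.
Qed.

(** Split [eta] into mean and fluctuation. The fluctuation is absorbed by [colatitude_variance]. For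
    the mean, the integral of [spin ^+ 2] is at least the square of its mean [w z] times that of
    [eta], and [D <= (w z)^2] because [1 - 3 r^2 <= 1 - r^2]. *)
Lemma latitude_fixed_hessian_ge0 q0 k : loop_space q0 ->
  0 <= hessian_fixed_time round_metric magnetic q0 k latitude_loop T xi.
Proof.
move=> h0; rewrite latitude_fixed_hessian// mulr_ge0 ?invr_ge0 ?(ltW T_gt0)//.
have := ing_sqr_ge spin_L2; rewrite ing_spin => h1.
have h2 : D * ing colatitude ^+ 2 <= (w * z * ing colatitude) ^+ 2.
  rewrite exprMn ler_wpM2r ?sqr_ge0// /D [(w * z) ^+ 2]exprMn ler_wpM2l ?sqr_ge0//.
  by have := sqr_ge0 r; move: rz; lra.
have := colatitude_variance; lra.
Qed.

Lemma latitude_free_hessian_ge0 q0 k tau : loop_space q0 -> ing colatitude = 0 ->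
  0 <= hessian_free_time round_metric magnetic q0 k latitude_loop T (xi, tau).
Proof.
move=> h0 c0; rewrite latitude_free_hessian// mulr_ge0 ?invr_ge0 ?(ltW T_gt0)//.
have := ing_sqr_ge spin_L2; have := colatitude_variance; rewrite c0.
have : 0 <= w ^+ 2 * (r * tau / T - z * 0) ^+ 2 by rewrite mulr_ge0 ?sqr_ge0.
lra.
Qed.

End Field.

Hypothesis (r3 : 3 * r ^+ 2 < 1) (D8 : w ^+ 2 * (1 - 3 * r ^+ 2) <= 8).

Lemma vector_field0 (q : R -> E) : vector_field_along q 0.
Proof.
split; last by move=> t; rewrite /tangent /= dotE !mxE; ring.
split=> //; exists (fun=> 0); apply/weak_derivativeP => i.
by apply: wd_ext (wd_cst (0 : R)) => t _; rewrite !mxE.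
Qed.

Lemma latitude_fixed_index q0 k : loop_space q0 ->
  fixed_time_index round_metric magnetic q0 k latitude_loop T 0.
Proof.
move=> h0; apply: morse_index0; first exact: vector_field0.
move=> xi hxi; have [W _] := hxi.
exact: (latitude_fixed_hessian_ge0 hxi (fun i => W12_wd i W)).
Qed.

(** The unit field along the meridians pointing away from the north pole; it has [eta = 1] and
    constant [beta = z w]. *)
Definition meridional (t : R) : E := vec (z * C t) (z * S t) (- r).
Definition meridional' (t : R) : E := vec (- (z * w * S t)) (z * w * C t) 0.

Let wd_meridional a i : wd (fun t => (a *: meridional) t 0 i) (fun t => (a *: meridional') t 0 i).
Proof.
move: i; apply: ord3P.
- by apply: wd_ext (wdZ (a * z) dC) => t _; rewrite !mxE /=; ring.
- by apply: wd_ext (wdZ (a * z) dS') => t _; rewrite !mxE /=; ring.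
- by apply: wd_ext (wd_cst (- a * r)) => t _; rewrite !mxE /=; ring.
Qed.

Let meridional_field a : vector_field_along latitude_loop (a *: meridional).
Proof.
split; last by move=> t; rewrite /tangent /= dotE !mxE /=; ring: (S2 t).
split; first by move=> t; rewrite -![(a *: meridional) _]/(a *: meridional _) /meridional C1 S1.
by exists (a *: meridional'); apply/weak_derivativeP => i; exact: wd_meridional.
Qed.

Lemma latitude_free_index q0 k : loop_space q0 ->
  free_time_index round_metric magnetic q0 k latitude_loop T 1.
Proof.
move=> h0; have zn := lt0r_neq0 z0; have rn := lt0r_neq0 r0.
have T_gt0 : 0 < T by rewrite divr_gt0 ?exprn_gt0// mulr_gt0// pi_gt0.
have D0 : 0 < w ^+ 2 * (1 - 3 * r ^+ 2).
  by rewrite mulr_gt0 ?subr_gt0// exprn_gt0// mulr_gt0// pi_gt0.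
have l1 (v : (R -> E) * R) : vector_field_along latitude_loop v.1 -> L1 (fun t => v.1 t 0 o2).
  by move=> [W _]; apply: Bm_L1; exact: wd_Bm (W12_wd o2 W).
(* The functional is the mean of [eta] up to the factor [- r]. The value [z * T / r] annihilates the
   complete square, and constant [spin] has no variance, so only [- D a^2 / T] is left. *)
rewrite /free_time_index; apply: (@morse_index1 _ _ _ _ (fun v : (R -> E) * R => ing (fun t => v.1 t 0 o2)) (meridional, z * T / r)).
- by move=> a; exact: meridional_field.
- move=> a a0; rewrite -[a *: _]/(a *: meridional, a * (z * T / r)).
  rewrite (latitude_free_hessian (meridional_field a) (wd_meridional a))//.
  rewrite (_ : colatitude _ = fun=> a); last first.
    by apply/funext => t; rewrite /colatitude !mxE /=; field.
  rewrite (_ : spin _ = fun=> a * z * w); last first.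
    by apply/funext => t; rewrite /spin !mxE /=; ring: (S2 t).
  rewrite (_ : (fun t => colatitude' _ t ^+ 2) = fun=> 0); last first.
    by apply/funext => t; rewrite /colatitude' !mxE /=; ring.
  rewrite !ing_cst.
  have -> : r * (a * (z * T / r)) / T - z * a = 0.
    by move: (lt0r_neq0 T_gt0); move: T => T1 T10; field; rewrite T10.
  rewrite pmulr_rlt0 ?invr_gt0// subrr add0r expr0n mulr0 !addr0 add0r oppr_lt0.
  by rewrite mulr_gt0// exprn_even_gt0.
- apply/eqP => /(congr1 (fun v : (R -> E) * R => v.2)) /= h.
  have : 0 < z * T / r by apply: divr_gt0 => //; exact: mulr_gt0.
  by rewrite h ltxx.
- move=> a b u v hu hv; rewrite -!ingZ ?l1// -ingD; [|by apply: L1Z; exact: l1..].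
  by apply: ing_ext => t _; rewrite !mxE.
move=> [xi tau] /= hxi h; have [W _] := hxi.
apply: (latitude_free_hessian_ge0 hxi (fun i => W12_wd i W)) => //.
have -> : colatitude xi = fun t => - r^-1 * xi t 0 o2 by apply/funext => t; rewrite /colatitude mulNr mulrC.
by rewrite ingZ ?h ?mulr0//; exact: (l1 (xi, tau)).
Qed.

End LatitudeIndex.

Theorem mainTheorem5 (R : realType) :
  exists g sigma : 'rV[R]_3 -> 'M[R]_3,
    [/\ riemannian_metric g, exact_two_form sigma &
      exists (k : R) (y : R -> 'rV[R]_3 * 'rV[R]_3) (T : R),
        [/\ mane_critical_value g sigma < k,
            closed_orbit g sigma k y T,
            strongly_nondegenerate g sigma y T,
            correction_term g sigma k y T (-1) &
            forall q0 : R -> 'rV[R]_3, loop_space q0 ->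
              exists n : nat,
                fixed_time_index g sigma q0 k (loop_of_orbit y T) T n /\
                free_time_index g sigma q0 k (loop_of_orbit y T) T n.+1]].
Proof.
(* A rational just below the square root of [1/3]: [1 - 3 r^2 = 1/49] keeps [r] stable, brings the
   energy close to its maximum [2/27], hence above [1/20], and makes [D] small. *)
pose r : R := 4 / 7.
have r0 : 0 < r by rewrite divr_gt0.
have r3 : 3 * r ^+ 2 < 1 by rewrite /r; lra.
have hr : stable_radius r by [].
have z0 := height_gt0 hr; have rz : r ^+ 2 + height r ^+ 2 = 1 by rewrite height2// addrC subrK.
exists round_metric, magnetic; split; [exact: round_metricP|exact: magnetic_exact|].
exists (energy r), (latitude r (height r)), (2 * pi / height r ^+ 2); split.
- apply: le_lt_trans mane_le _; rewrite /energy /r; lra.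
- exact: stable_closed_orbit.
- exact: latitude_strongly_nondegenerate.
- exact: latitude_correction_term.
move=> q0 h0; exists 0%N; rewrite loop_of_latitude//.
(* Here [D] is [(2 pi)^2 / 49], so the crude bound [pi < 4] is enough. *)
have D8 : (2 * pi) ^+ 2 * (1 - 3 * r ^+ 2) <= 8 :> R.
  have p4 : pi < 4 :> R by have := @pihalf_lt2 R; lra.
  have := pi_gt0 R; rewrite /r; nra.
by split; [exact: latitude_fixed_index|exact: latitude_free_index].
Qed.
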